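(* For a tree $\Upsilon$ the following are equivalent: (1) $C_0(\Upsilon)$ admits an equivalent strictly convex norm; (2) $C_0(\Upsilon)$ admits an equivalent midpoint locally uniformly convex (MLUR) norm; (3) there exists an increasing function $\rho:\Upsilon\to\mathbb{R}$ such that (i) $\rho$ is constant on no ever-branching subset of $\Upsilon$, and (ii) for every $s\in\Upsilon$ there is at most one point $u$ which is bad for $\rho$ and satisfies $s\preceq u$ and $\rho(u)=\rho(s)$; (4) there is a bounded linear injection from $C_0(\Upsilon)$ into some space $c_0(I)$.
   Context: A tree is a partially ordered set $(\Upsilon,\preceq)$ such that for each $t\in\Upsilon$ the set $\{s: s\preceq t\}$ is well-ordered by $\preceq$. Write $(0,t]=\{s:s\preceq t\}$, $(0,t)=\{s:s\prec t\}$, $[t,\infty)=\{u:t\preceq u\}$, $(t,\infty)=\{u:t\prec u\}$, and let $r(t)$ be the order type of $(0,t)$. All trees are assumed Hausdorff: if $r(t)$ is a limit ordinal and $(0,t)=(0,t')$ then $t=t'$. $\Upsilon$ carries the coarsest topology in which every $(0,t]$ is open and closed (a locally compact Hausdorff topology). $C_0(\Upsilon)$ is the Banach space of continuous $f:\Upsilon\to\mathbb{R}$ such that $\{t:|f(t)|\ge\epsilon\}$ is compact for every $\epsilon>0$, with the supremum norm. The set $t^+$ of immediate successors of $t$ consists of those $u$ with $(0,u)=(0,t]$. A function $\rho:\Upsilon\to\mathbb{R}$ is increasing if $s\preceq t$ implies $\rho(s)\le\rho(t)$. For increasing $\rho$, a point $t$ is good for $\rho$ if there is a finite $F\subseteq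 t^+$ with $\inf_{u\in t^+\setminus F}\rho(u)>\rho(t)$ (an infimum over the empty set is $+\infty$); otherwise $t$ is bad for $\rho$. A subset $\Gamma\subseteq\Upsilon$ is ever-branching if it is non-empty and for every $t\in\Gamma$ the set $\Gamma\cap[t,\infty)$ is not totally ordered. A norm is strictly convex if $\|x\|=\|y\|=\tfrac12\|x+y\|$ implies $x=y$. A norm is MLUR if whenever $\|x+h_n\|\to\|x\|$ and $\|x-h_n\|\to\|x\|$ we have $\|h_n\|\to0$. ''Equivalent'' means equivalent to the supremum norm. *)

(* Defs.v *)
From Stdlib Require Import Reals List.
From Coquelicot Require Import Coquelicot.
Open Scope R_scope.

Section TreeDefs.
Variable T : Type.
Variable le : T -> T -> Prop.

Definition tree_lt (s t : T) : Prop := le s t /\ s <> t.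

Definition tree_down (t : T) : T -> Prop := fun s => le s t.

Definition well_ordered_down (t : T) : Prop :=
  forall A : T -> Prop, (forall s, A s -> le s t) -> (exists s, A s) ->
    exists m, A m /\ forall s, A s -> le m s.

(* r(t) (the order type of (0,t)) is a limit ordinal:
   (0,t) is nonempty and has no largest element *)
Definition rank_limit (t : T) : Prop :=
  (exists s, tree_lt s t) /\ forall s, tree_lt s t -> exists s', tree_lt s s' /\ tree_lt s' t.

Definition is_tree : Prop :=
  (forall t, le t t) /\
  (forall s t, le s t -> le t s -> s = t) /\
  (forall s t u, le s t -> le t u -> le s u) /\
  (forall t, well_ordered_down t).

Definition hausdorff_tree : Prop :=
  forall t t', rank_limit t -> (forall s, tree_lt s t <-> tree_lt s t') -> t = t'.

(* The coarsest topology in which every (0,t] is open and closed: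
   generated by the subbasis {(0,t]} ∪ {complement of (0,t]}.
   A subbasic set is coded by (t, b): b = true means (0,t], b = false its
   complement. *)
Definition subbasic (p : T * bool) : T -> Prop :=
  fun x => if snd p then le x (fst p) else ~ le x (fst p).

Definition tree_open (U : T -> Prop) : Prop :=
  forall x, U x -> exists l : list (T * bool),
    (forall p, In p l -> subbasic p x) /\
    (forall y, (forall p, In p l -> subbasic p y) -> U y).

Definition tree_compact (K : T -> Prop) : Prop :=
  forall (J : Type) (U : J -> T -> Prop),
    (forall j, tree_open (U j)) ->
    (forall x, K x -> exists j, U j x) ->
    exists l : list J, forall x, K x -> exists j, In j l /\ U j x.

Definition tree_continuous (f : T -> R) : Prop :=
  forall V : R -> Prop, open_set V -> tree_open (fun x => V (f x)).

Definition C0 (f : T -> R) : Prop :=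
  tree_continuous f /\
  forall eps, 0 < eps -> tree_compact (fun t => eps <= Rabs (f t)).

Definition tree_succ (t u : T) : Prop := forall s, tree_lt s u <-> le s t.

Definition tree_increasing (rho : T -> R) : Prop :=
  forall s t, le s t -> rho s <= rho t.

(* t is tree_good for rho: there is a finite F ⊆ t^+ with
   inf_{u ∈ t^+ \ F} rho(u) > rho(t)  (inf of the empty set = +oo) *)
Definition tree_good (rho : T -> R) (t : T) : Prop :=
  exists F : list T, (forall u, In u F -> tree_succ t u) /\
    Rbar_lt (Finite (rho t))
      (Glb_Rbar (fun y => exists u, tree_succ t u /\ ~ In u F /\ y = rho u)).

Definition tree_bad (rho : T -> R) (t : T) : Prop := ~ tree_good rho t.

Definition ever_branching (G : T -> Prop) : Prop :=
  (exists t, G t) /\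
  forall t, G t -> exists u v, G u /\ G v /\ le t u /\ le t v /\
                               ~ le u v /\ ~ le v u.

End TreeDefs.

(* supremum norm of a function on an arbitrary index type
   (sup of {|f x|} ∪ {0}, so that the empty index type gives 0) *)
Definition supn {X : Type} (f : X -> R) : R :=
  real (Lub_Rbar (fun y => y = 0 \/ exists x, y = Rabs (f x))).

Definition is_norm_on {X : Type} (V : (X -> R) -> Prop) (N : (X -> R) -> R)
  : Prop :=
  (forall f, V f -> 0 <= N f) /\
  (forall f, V f -> N f = 0 -> forall x, f x = 0) /\
  (forall f c, V f -> N (fun x => c * f x) = Rabs c * N f) /\
  (forall f g, V f -> V g -> N (fun x => f x + g x) <= N f + N g).

Definition equiv_norm_on {X : Type} (V : (X -> R) -> Prop) (N : (X -> R) -> R)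
  : Prop :=
  is_norm_on V N /\
  exists a b, 0 < a /\ 0 < b /\
    forall f, V f -> a * supn f <= N f /\ N f <= b * supn f.

Definition strictly_convex_on {X : Type} (V : (X -> R) -> Prop)
  (N : (X -> R) -> R) : Prop :=
  forall f g, V f -> V g -> N f = N g ->
    N f = / 2 * N (fun x => f x + g x) -> forall x, f x = g x.

Definition MLUR_on {X : Type} (V : (X -> R) -> Prop) (N : (X -> R) -> R)
  : Prop :=
  forall (f : X -> R) (h : nat -> X -> R), V f -> (forall n, V (h n)) ->
    Un_cv (fun n => N (fun x => f x + h n x)) (N f) ->
    Un_cv (fun n => N (fun x => f x - h n x)) (N f) ->
    Un_cv (fun n => N (h n)) 0.

Definition c0 {I : Type} (x : I -> R) : Prop :=
  forall eps, 0 < eps -> exists l : list I,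
    forall i, eps <= Rabs (x i) -> In i l.

Definition bounded_linear_injection {X Y : Type}
  (V : (X -> R) -> Prop) (W : (Y -> R) -> Prop) (S : (X -> R) -> (Y -> R))
  : Prop :=
  (forall f, V f -> W (S f)) /\
  (forall f g, V f -> V g -> forall y, S (fun x => f x + g x) y = S f y + S g y) /\
  (forall f c, V f -> forall y, S (fun x => c * f x) y = c * S f y) /\
  (exists K, forall f, V f -> supn (S f) <= K * supn f) /\
  (forall f g, V f -> V g -> (forall y, S f y = S g y) -> forall x, f x = g x).

(* Main.v *)
(* (1) => (3): let [rho t] be the infimum of the norms of the [f] with [f = 1] on (0,t] and
   [f = 0] off (0,t] and [t,oo).  Averaging near-optimal functions for many successors shows
   that the infimum is attained at a bad [t] by the indicator of (0,t]; averaging along a dyadic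
   scheme shows that it is attained at the points of an ever-branching set on which [rho] is
   constant.  Strict convexity makes minimisers unique, which excludes a second bad point and
   such ever-branching sets.

   (3) => (4): the coordinates are the values of [f] at the points where [rho] jumps and, for
   good [t], [f t] minus the sum of [f] over the finitely many successors on the level of [t].
   Rational numbers separating the values of [rho] split these points into countably many
   families, in each of which at most one coordinate is nonzero on the indicator of a given
   (0,e]; since such indicators span a dense subspace, suitable weights put the coordinates
   in c_0.  If they all vanish and [f <> 0], then [f] is nonzero on an
   ever-branching set where [rho] is constant.

   (4) => (1) and (3) => (2): a Troyanski-type renorming.  For c_0-indexed seminorms [t i] and
   seminorms [psi A] attached to finite index sets [A], it makes the midpoint condition at [f]
   pass to every [t i] and to [psi A] for suitable large sets [A] of indices active at [f].
   For (2), [psi A] measures oscillation on the cells cut out by the finitely many points of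
   the tree recoverable from [A].  A bad point which is not recoverable is the top of a cone
   where [f] is nearly a multiple of one indicator, and the oscillation on that cone controls
   the perturbation.  So the perturbations are nearly constant on finitely many cells, and the
   injectivity argument of (4), run modulo null sequences, makes them tend to 0. *)

Require Import Defs.
From Stdlib Require Import Reals List Lra Lia Classical ClassicalEpsilon.
From Stdlib Require Import FunctionalExtensionality PropExtensionality ZArith Cantor.
From Coquelicot Require Import Coquelicot.
Import ListNotations.
Open Scope R_scope.

(** The convexity estimates work with squares of norms. For a quadratic seminorm [q] the defect
    [q (f + h) + q (f - h) - 2 * q f] is nonnegative, so a small defect of a sum or series is small
    for every term, and a supremum passes its defect on to a member attaining it at [f]. If [q] is
    the square of a linear functional, the defect is twice [q h]; this is all that strict convexity
    needs. For a general [q] one only gets that [q h] is at most [q f] plus half the defect, so an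
    oscillation seminorm helps only where [f] itself oscillates little. The obstacle in (3) => (2)
    is that the norm, hence the family [psi], is fixed before [f]: the cells on which [f] is nearly
    constant must be read off from the index set that the norm selects at [f]. This is why points
    have to be recoverable from indices. Bad points carry no [phi] coordinate; the uniqueness in
    (3)(ii) is what allows a bad point to be recovered from an index on its level or just after the
    end of it. *)

Ltac fun_ring := apply functional_extensionality; intros; ring.
Ltac abs_lra := unfold Rabs; repeat destruct Rcase_abs; lra.

(** * Suprema, null sequences and finite covers *)

Lemma supn_nonneg {X : Type} (f : X -> R) : 0 <= supn f.
Proof.
  unfold supn.
  destruct (Lub_Rbar_correct (fun y => y = 0 \/ exists x, y = Rabs (f x))) as [Hub _].
  specialize (Hub 0 (or_introl eq_refl)).
  destruct (Lub_Rbar _); simpl in *; lra.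
Qed.

Lemma supn_lub {X : Type} (f : X -> R) (M : R) :
  0 <= M -> (forall x, Rabs (f x) <= M) -> supn f <= M.
Proof.
  intros HM Hf; unfold supn.
  destruct (Lub_Rbar_correct (fun y => y = 0 \/ exists x, y = Rabs (f x))) as [_ Hlub].
  specialize (Hlub (Finite M)).
  destruct (Lub_Rbar _); simpl in *; try lra.
  apply Hlub; intros y [-> | [x ->]]; simpl; auto.
Qed.

(** A bound is assumed because [real] turns an infinite least upper bound into 0. *)
Lemma supn_ub {X : Type} (f : X -> R) (M : R) (x : X) :
  (forall y, Rabs (f y) <= M) -> Rabs (f x) <= supn f.
Proof.
  intros Hf; unfold supn.
  destruct (Lub_Rbar_correct (fun y => y = 0 \/ exists x, y = Rabs (f x))) as [Hub Hlub].
  specialize (Hlub (Finite (Rabs M))).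
  assert (Hx := Hub (Rabs (f x)) (or_intror (ex_intro _ x eq_refl))).
  destruct (Lub_Rbar _); simpl in *; try lra.
  exfalso; apply Hlub; intros y [-> | [z ->]]; simpl; [apply Rabs_pos |].
  apply Rle_trans with M; [auto | apply Rle_abs].
Qed.

Lemma Rabs_m1 : Rabs (-1) = 1.
Proof. rewrite Rabs_left; lra. Qed.

(** Used for finiteness claims about points of the tree: [r] attaches every point of [P] to a member
    of the finite [L], and no member serves two points. *)
Lemma finite_of_cover {A B : Type} (r : A -> B -> Prop) (L : list B) (P : A -> Prop) :
  (forall u, P u -> exists z, In z L /\ r u z) ->
  (forall u u' z, P u -> P u' -> r u z -> r u' z -> u = u') ->
  exists U, forall u, In u U <-> P u.
Proof.
  revert P; induction L as [| z L IH]; intros P Hc Hu.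
  - exists []; intros u; split; [easy |]. intros Pu. now destruct (Hc u Pu) as (z & [] & _).
  - destruct (IH (fun u => P u /\ ~ r u z)) as [U HU].
    + intros u [Pu Hn]. destruct (Hc u Pu) as (z' & [<- | Hz'] & Hr); [contradiction |].
      now exists z'.
    + intros u u' z' [Pu _] [Pu' _]. now apply Hu.
    + destruct (classic (exists u, P u /\ r u z)) as [(u & Pu & Hr) | Hn].
      * exists (u :: U). intros v; simpl; rewrite HU. split; [intros [<- | [H _]]; auto |].
        intros Pv. destruct (classic (r v z)); [left; eapply Hu; eauto | right; auto].
      * exists U. intros v; rewrite HU. split; [tauto |].
        intros Pv; split; auto. intros Hr; apply Hn; now exists v.
Qed.

Lemma half_pow_pos m : 0 < (/ 2) ^ m.
Proof. apply pow_lt; lra. Qed.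

Lemma half_pow_small d : 0 < d -> exists m, forall n, (m <= n)%nat -> (/ 2) ^ n < d.
Proof.
  intros Hd. destruct (pow_lt_1_zero (/ 2)) with (y := d) as [m Hm]; auto.
  - rewrite Rabs_pos_eq; lra.
  - exists m; intros n Hn. specialize (Hm n Hn).
    rewrite Rabs_pos_eq in Hm; auto. left; apply half_pow_pos.
Qed.

(** The extra 1 keeps the factor positive, so that tolerances can be divided by it. *)
Lemma lin_bound a b u v d : Rabs u <= d -> Rabs v <= d ->
  Rabs (a * u + b * v) <= (Rabs a + Rabs b + 1) * d.
Proof.
  intros Hu Hv. eapply Rle_trans; [apply Rabs_triang |]. rewrite !Rabs_mult.
  assert (0 <= d) by (eapply Rle_trans; [apply Rabs_pos | apply Hu]).
  generalize (Rmult_le_compat_l _ _ _ (Rabs_pos a) Hu) (Rmult_le_compat_l _ _ _ (Rabs_pos b) Hv).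
  lra.
Qed.

(** An enumeration of the rationals. The index of a rational separating two values of [rho] later
    serves as the exponent of a weight. *)
Definition rational (n : nat) : R :=
  let (a, bc) := Cantor.of_nat n in let (b, c) := Cantor.of_nat bc in
  (INR a - INR b) / (INR c + 1).

Lemma rational_dense x y : x < y -> exists n, x < rational n < y.
Proof.
  intros Hxy. destruct (INR_unbounded (/ (y - x))) as [c Hc].
  assert (Hc0 := pos_INR c).
  destruct (archimed (x * (INR c + 1))) as [H1 H2].
  set (k := up (x * (INR c + 1))) in *.
  exists (Cantor.to_nat (Z.to_nat k, Cantor.to_nat (Z.to_nat (- k), c))).
  unfold rational. rewrite !Cantor.cancel_of_to.
  assert (E : INR (Z.to_nat k) - INR (Z.to_nat (- k)) = IZR k).
  { rewrite !INR_IZR_INZ. destruct (Z_le_gt_dec 0 k).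
    - rewrite Z2Nat.id by auto. replace (Z.to_nat (- k)) with 0%nat by lia. simpl; lra.
    - replace (Z.to_nat k) with 0%nat by lia. rewrite Z2Nat.id, opp_IZR by lia. simpl; lra. }
  rewrite E.
  assert (Hinv : / (INR c + 1) < y - x).
  { rewrite <- (Rinv_inv (y - x)). apply Rinv_0_lt_contravar.
    - apply Rinv_0_lt_compat; lra.
    - lra. }
  assert (Hp : 0 < / (INR c + 1)) by (apply Rinv_0_lt_compat; lra).
  replace x with (x * (INR c + 1) * / (INR c + 1)) at 1 by (field; lra).
  unfold Rdiv; split.
  - apply Rmult_lt_compat_r; auto.
  - apply Rle_lt_trans with ((x * (INR c + 1) + 1) * / (INR c + 1)).
    + apply Rmult_le_compat_r; lra.
    + replace ((x * (INR c + 1) + 1) * / (INR c + 1)) with (x + / (INR c + 1)) by (field; lra).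
      lra.
Qed.

Definition tends0 (u : nat -> R) : Prop :=
  forall eps, 0 < eps -> exists n0, forall n, (n0 <= n)%nat -> Rabs (u n) <= eps.

Lemma tends0_lin a b u v : tends0 u -> tends0 v -> tends0 (fun n => a * u n + b * v n).
Proof.
  intros Hu Hv eps Heps. set (M := Rabs a + Rabs b + 1).
  assert (HM : 0 < M) by (unfold M; generalize (Rabs_pos a) (Rabs_pos b); lra).
  assert (He : 0 < eps / M) by now apply Rdiv_lt_0_compat.
  destruct (Hu _ He) as [n1 H1]. destruct (Hv _ He) as [n2 H2].
  exists (n1 + n2)%nat. intros n Hn. replace eps with (M * (eps / M)) by (field; lra).
  apply lin_bound; [apply H1 | apply H2]; lia.
Qed.

Lemma tends0_ext u v : (forall n, u n = v n) -> tends0 u -> tends0 v.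
Proof.
  intros H Hu eps Heps. destruct (Hu eps Heps) as [n0 Hn0].
  exists n0; intros n Hn. rewrite <- H; auto.
Qed.

Lemma tends0_const c : tends0 (fun _ => c) <-> c = 0.
Proof.
  split.
  - intros H. apply NNPP; intros Hc. assert (0 < Rabs c) by now apply Rabs_pos_lt.
    destruct (H (Rabs c / 2)) as [n0 Hn0]; [lra |]. specialize (Hn0 n0 (Nat.le_refl n0)). lra.
  - intros -> eps Heps. exists 0%nat. intros; rewrite Rabs_R0; lra.
Qed.

Lemma abs_le_of_sq w s : 0 <= s -> w ^ 2 <= s ^ 2 -> Rabs w <= s.
Proof.
  intros Hs H. apply Rnot_lt_le; intros Hlt. rewrite <- (pow2_abs w) in H. nra.
Qed.

Lemma sq_le_of_abs w s : Rabs w <= s -> w ^ 2 <= s ^ 2.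
Proof.
  intros H. rewrite <- (pow2_abs w). apply pow_incr. split; [apply Rabs_pos | auto].
Qed.

Lemma tends0_sq u : tends0 u -> tends0 (fun n => u n ^ 2).
Proof.
  intros Hu eps Heps. destruct (Hu (Rmin 1 eps)) as [n0 Hn0]; [apply Rmin_pos; lra |].
  exists n0; intros n Hn. specialize (Hn0 n Hn).
  rewrite Rabs_pos_eq by apply pow2_ge_0. rewrite <- pow2_abs.
  assert (H1 := Rmin_l 1 eps). assert (H2 := Rmin_r 1 eps). assert (H3 := Rabs_pos (u n)). nra.
Qed.

Lemma tends0_of_sq u : tends0 (fun n => u n ^ 2) -> tends0 u.
Proof.
  intros Hu eps Heps. destruct (Hu (eps ^ 2)) as [n0 Hn0]; [now apply pow_lt |].
  exists n0; intros n Hn. specialize (Hn0 n Hn). apply abs_le_of_sq; [lra |].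
  rewrite Rabs_pos_eq in Hn0 by apply pow2_ge_0. auto.
Qed.

Lemma tends0_Un_cv u l : Un_cv u l <-> tends0 (fun n => u n - l).
Proof.
  split; intros H eps Heps.
  - destruct (H eps Heps) as [n0 Hn0]. exists n0; intros n Hn. left; now apply Hn0.
  - destruct (H (eps / 2)) as [n0 Hn0]; [lra |]. exists n0; intros n Hn.
    specialize (Hn0 n Hn). unfold Rdist. lra.
Qed.


(** * A Troyanski-type renorming *)

(** Under the hypotheses of MLUR this tends to 0 for [q = N ^ 2]; for [q = L ^ 2] with [L] linear it
    equals [2 * L h ^ 2]. *)
Definition mid_defect {X : Type} (q : (X -> R) -> R) (f h : X -> R) : R :=
  q (fun x => f x + h x) + q (fun x => f x - h x) - 2 * q f.

Definition lsum {I : Type} (l : list I) (a : I -> R) : R := fold_right Rplus 0 (map a l).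

Lemma lsum_minus_const {I : Type} (l : list I) (a : I -> R) (c : R) :
  lsum l a = lsum l (fun i => a i - c) + INR (length l) * c.
Proof.
  induction l as [| i l IH]; [unfold lsum; simpl; ring |].
  change (lsum (i :: l) a) with (a i + lsum l a).
  change (lsum (i :: l) (fun i => a i - c)) with (a i - c + lsum l (fun i => a i - c)).
  cbn [length]. rewrite S_INR, IH. ring.
Qed.

Lemma lsum_incl {I : Type} (b : I -> R) (l l2 : list I) :
  NoDup l -> incl l l2 -> (forall i, In i l2 -> 0 <= b i) -> lsum l b <= lsum l2 b.
Proof.
  revert l2; induction l as [| i l IH]; intros l2 Hnd Hincl Hb.
  - clear Hincl. induction l2 as [| j l2 IH2]; [apply Rle_refl |].
    change (lsum [] b <= b j + lsum l2 b).
    assert (0 <= b j) by (apply Hb; left; auto).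
    assert (lsum [] b <= lsum l2 b) by (apply IH2; intros; apply Hb; right; auto). lra.
  - destruct (in_split i l2) as (u & v & ->); [apply Hincl; left; auto |].
    inversion Hnd; subst.
    assert (E : lsum (u ++ i :: v) b = b i + lsum (u ++ v) b).
    { clear. induction u as [| j u IH]; simpl; auto.
      change (b j + lsum (u ++ i :: v) b = b i + (b j + lsum (u ++ v) b)).
      rewrite IH; ring. }
    rewrite E. change (b i + lsum l b <= b i + lsum (u ++ v) b).
    apply Rplus_le_compat_l, IH; auto.
    + intros j Hj. assert (Hj' := Hincl j (or_intror Hj)).
      apply in_app_or in Hj' as [? | [-> | ?]]; apply in_or_app; auto; contradiction.
    + intros j Hj; apply Hb. apply in_app_or in Hj as [? | ?]; apply in_or_app; simpl; auto.
Qed.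

(** Chosen by [epsilon] from the predicate alone, so that equal predicates give the same list;
    [canon] thereby makes a list a function of its set of members. *)
Definition enum {I : Type} (P : I -> Prop) : list I :=
  epsilon (inhabits []) (fun l => NoDup l /\ forall i, In i l <-> P i).

Definition canon {I : Type} (l : list I) : list I := enum (fun i => In i l).

Lemma canon_spec {I : Type} (l : list I) :
  NoDup (canon l) /\ forall i, In i (canon l) <-> In i l.
Proof.
  unfold canon, enum. apply epsilon_spec.
  exists (nodup (fun x y => excluded_middle_informative (x = y)) l).
  split; [apply NoDup_nodup | intros; apply nodup_In].
Qed.

Lemma canon_ext {I : Type} (l l' : list I) :
  (forall i, In i l <-> In i l') -> canon l = canon l'.
Proof.
  intros H; unfold canon; f_equal.
  apply functional_extensionality; intros i; now apply propositional_extensionality.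
Qed.

(** * Quadratic seminorms, their suprema and series, and the renorming *)

Section Renorming.
Variables (X : Type) (V : (X -> R) -> Prop).
Hypothesis V_plus : forall f g, V f -> V g -> V (fun x => f x + g x).
Hypothesis V_scal : forall c f, V f -> V (fun x => c * f x).
Hypothesis V_ub : forall f x, V f -> Rabs (f x) <= supn f.

Lemma V_minus f g : V f -> V g -> V (fun x => f x - g x).
Proof.
  intros Hf Hg. replace (fun x => f x - g x) with (fun x => f x + (-1) * g x).
  - apply V_plus; auto.
  - apply functional_extensionality; intros; ring.
Qed.

(* The last clause, for all [s > 0], says that [sqrt q] is subadditive; unlike that
   inequality it is stable under sums and suprema term by term. *)
Definition qsn (q : (X -> R) -> R) : Prop :=
  (forall f, V f -> 0 <= q f) /\
  (forall c f, V f -> q (fun x => c * f x) = c ^ 2 * q f) /\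
  (forall s f g, 0 < s -> V f -> V g ->
     q (fun x => f x + g x) <= (1 + s) * q f + (1 + / s) * q g).

Definition qbd (K : R) (q : (X -> R) -> R) : Prop :=
  forall f, V f -> q f <= K * supn f ^ 2.

(** The case [s = 1] is midpoint convexity, which is all that the two defect estimates below use. *)
Lemma qsn_half_sum q f g : qsn q -> V f -> V g ->
  q (fun x => / 2 * (f x + g x)) <= / 2 * (q f + q g).
Proof.
  intros (H0 & H1 & H2) Hf Hg. rewrite (H1 (/ 2) (fun x => f x + g x)); auto.
  assert (H := H2 1 f g Rlt_0_1 Hf Hg). rewrite Rinv_1 in H. lra.
Qed.

Lemma mid_defect_nonneg q f h : qsn q -> V f -> V h -> 0 <= mid_defect q f h.
Proof.
  intros Hq Hf Hh.
  assert (H := qsn_half_sum q (fun x => f x + h x) (fun x => f x - h x) Hq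
                 (V_plus _ _ Hf Hh) (V_minus _ _ Hf Hh)).
  cbv beta in H.
  replace (fun x => / 2 * (f x + h x + (f x - h x))) with f in H
    by (apply functional_extensionality; intros; field).
  unfold mid_defect; lra.
Qed.

(** [h] is the midpoint of [f + h] and [-(f - h)]. This turns smallness of [q] at [f] into smallness
    at [h]. *)
Lemma qsn_le_mid_defect q f h : qsn q -> V f -> V h ->
  q h <= q f + / 2 * mid_defect q f h.
Proof.
  intros Hq Hf Hh.
  assert (H := qsn_half_sum q (fun x => f x + h x) (fun x => (-1) * (f x - h x)) Hq
                 (V_plus _ _ Hf Hh) (V_scal _ _ (V_minus _ _ Hf Hh))).
  cbv beta in H.
  replace (fun x => / 2 * (f x + h x + (-1) * (f x - h x))) with h in H
    by (apply functional_extensionality; intros; field).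
  destruct Hq as (_ & H1 & _). rewrite (H1 (-1) (fun x => f x - h x)) in H.
  - unfold mid_defect; lra.
  - now apply V_minus.
Qed.

Lemma qsn_square (L : (X -> R) -> R) :
  (forall f g, V f -> V g -> L (fun x => f x + g x) = L f + L g) ->
  (forall c f, V f -> L (fun x => c * f x) = c * L f) ->
  qsn (fun f => L f ^ 2).
Proof.
  intros Hp Hs; split; [| split].
  - intros; apply pow2_ge_0.
  - intros c f Hf. rewrite Hs; auto; ring.
  - intros s f g H Hf Hg. rewrite Hp; auto.
    assert (E : (1 + s) * L f ^ 2 + (1 + / s) * L g ^ 2 - (L f + L g) ^ 2
                = (s * L f - L g) ^ 2 * / s) by (field; lra).
    assert (0 <= (s * L f - L g) ^ 2 * / s).
    { apply Rmult_le_pos; [apply pow2_ge_0 | left; now apply Rinv_0_lt_compat]. }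
    lra.
Qed.

Lemma qsn_plus q r : qsn q -> qsn r -> qsn (fun f => q f + r f).
Proof.
  intros (A0 & A1 & A2) (B0 & B1 & B2); split; [| split].
  - intros f Hf; generalize (A0 f Hf) (B0 f Hf); lra.
  - intros c f Hf; rewrite A1, B1; auto; ring.
  - intros s f g Hs Hf Hg. generalize (A2 s f g Hs Hf Hg) (B2 s f g Hs Hf Hg); lra.
Qed.

Lemma qsn_scal c q : 0 <= c -> qsn q -> qsn (fun f => c * q f).
Proof.
  intros Hc (A0 & A1 & A2); split; [| split].
  - intros f Hf; apply Rmult_le_pos; auto.
  - intros d f Hf; rewrite A1; auto; ring.
  - intros s f g Hs Hf Hg.
    assert (H := Rmult_le_compat_l c _ _ Hc (A2 s f g Hs Hf Hg)). lra.
Qed.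

Lemma qsn_zero : qsn (fun _ => 0).
Proof. repeat split; intros; lra. Qed.

Lemma sup_ub {Y : Type} (q : Y -> (X -> R) -> R) K f y :
  (forall y, qsn (q y)) -> (forall y, qbd K (q y)) -> V f ->
  q y f <= supn (fun y => q y f).
Proof.
  intros Hq Hb Hf. eapply Rle_trans; [apply Rle_abs |].
  apply (supn_ub (fun y => q y f) (K * supn f ^ 2) y). intros z.
  destruct (Hq z) as (H0 & _). rewrite Rabs_pos_eq; auto. now apply Hb.
Qed.

Lemma sup_lub {Y : Type} (q : Y -> (X -> R) -> R) f M :
  (forall y, qsn (q y)) -> V f -> 0 <= M -> (forall y, q y f <= M) ->
  supn (fun y => q y f) <= M.
Proof.
  intros Hq Hf HM H. apply supn_lub; auto.
  intros y; destruct (Hq y) as (H0 & _). rewrite Rabs_pos_eq; auto.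
Qed.

Lemma supn_scal {Y : Type} (g : Y -> R) c M : 0 <= c -> (forall y, Rabs (g y) <= M) ->
  supn (fun y => c * g y) = c * supn g.
Proof.
  intros Hc HM. destruct (Req_dec c 0) as [-> | Hc0].
  { apply Rle_antisym.
    - rewrite Rmult_0_l; apply supn_lub; [lra |].
      intros y; rewrite Rmult_0_l, Rabs_R0; lra.
    - rewrite Rmult_0_l; apply supn_nonneg. }
  assert (Hb : forall y, Rabs (c * g y) <= c * M).
  { intros y; rewrite Rabs_mult, (Rabs_pos_eq c); auto. apply Rmult_le_compat_l; auto. }
  apply Rle_antisym.
  - apply supn_lub.
    + apply Rmult_le_pos; auto using supn_nonneg.
    + intros y; rewrite Rabs_mult, (Rabs_pos_eq c); auto.
      apply Rmult_le_compat_l; auto. now apply supn_ub with M.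
  - apply Rmult_le_reg_l with (/ c); [apply Rinv_0_lt_compat; lra |].
    rewrite <- Rmult_assoc, Rinv_l, Rmult_1_l; auto.
    apply supn_lub.
    + apply Rmult_le_pos; [left; apply Rinv_0_lt_compat; lra | apply supn_nonneg].
    + intros y. apply Rmult_le_reg_l with c; [lra |].
      rewrite <- Rmult_assoc, Rinv_r, Rmult_1_l; auto.
      rewrite <- (Rabs_pos_eq c) at 1; auto. rewrite <- Rabs_mult.
      apply (supn_ub (fun y => c * g y) (c * M)); auto.
Qed.

Lemma qsn_sup {Y : Type} (q : Y -> (X -> R) -> R) K :
  (forall y, qsn (q y)) -> (forall y, qbd K (q y)) -> qsn (fun f => supn (fun y => q y f)).
Proof.
  intros Hq Hb; split; [| split].
  - intros; apply supn_nonneg.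
  - intros c f Hf. rewrite <- (supn_scal _ _ (K * supn f ^ 2)); [| apply pow2_ge_0 |].
    + f_equal; apply functional_extensionality; intros y.
      destruct (Hq y) as (_ & H1 & _); auto.
    + intros y; destruct (Hq y) as (H0 & _). rewrite Rabs_pos_eq; auto. now apply Hb.
  - intros s f g Hs Hf Hg.
    assert (Hs' : 0 < / s) by now apply Rinv_0_lt_compat.
    apply sup_lub; auto.
    + apply Rplus_le_le_0_compat; apply Rmult_le_pos; try lra; apply supn_nonneg.
    + intros y. destruct (Hq y) as (_ & _ & H2).
      eapply Rle_trans; [now apply (H2 s) |].
      apply Rplus_le_compat; apply Rmult_le_compat_l; try lra;
        now apply (sup_ub q K).
Qed.

Lemma qbd_sup {Y : Type} (q : Y -> (X -> R) -> R) K : 0 <= K ->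
  (forall y, qsn (q y)) -> (forall y, qbd K (q y)) -> qbd K (fun f => supn (fun y => q y f)).
Proof.
  intros HK Hq Hb f Hf. apply sup_lub; auto.
  - apply Rmult_le_pos; auto; apply pow2_ge_0.
  - intros y; now apply Hb.
Qed.

(** The supremum equals the value at [y] for [f] and is at least the value at [y] for [f + h] and
    [f - h]. *)
Lemma mid_defect_sup {Y : Type} (q : Y -> (X -> R) -> R) K y f h :
  (forall y, qsn (q y)) -> (forall y, qbd K (q y)) -> V f -> V h ->
  (forall z, q z f <= q y f) ->
  mid_defect (q y) f h <= mid_defect (fun f => supn (fun y => q y f)) f h.
Proof.
  intros Hq Hb Hf Hh Hmax. unfold mid_defect.
  assert (H1 := sup_ub q K _ y Hq Hb (V_plus _ _ Hf Hh)).
  assert (H2 := sup_ub q K _ y Hq Hb (V_minus _ _ Hf Hh)).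
  assert (H3 : supn (fun y => q y f) <= q y f).
  { apply sup_lub; auto. now apply (Hq y). }
  simpl in *; lra.
Qed.

Lemma ex_series_halves (a : nat -> R) K : (forall j, 0 <= a j <= K) ->
  ex_series (fun j => (/ 2) ^ j * a j).
Proof.
  intros Ha. apply (@ex_series_le R_AbsRing R_CompleteNormedModule)
    with (b := fun j => K * (/ 2) ^ j).
  - intros j. change (norm ((/ 2) ^ j * a j)) with (Rabs ((/ 2) ^ j * a j)).
    assert (0 <= (/ 2) ^ j) by (apply pow_le; lra).
    rewrite Rabs_pos_eq.
    + rewrite Rmult_comm. apply Rmult_le_compat_r; auto. apply Ha.
    + apply Rmult_le_pos; auto. apply Ha.
  - apply (@ex_series_scal_l R_AbsRing R_NormedModule).
    apply ex_series_geom. rewrite Rabs_pos_eq; lra.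
Qed.

Definition halves (q : nat -> (X -> R) -> R) (f : X -> R) : R :=
  Series (fun j => (/ 2) ^ j * q j f).

Lemma ex_halves q K f : (forall j, qsn (q j)) -> (forall j, qbd K (q j)) -> V f ->
  ex_series (fun j => (/ 2) ^ j * q j f).
Proof.
  intros Hq Hb Hf. apply ex_series_halves with (K * supn f ^ 2).
  intros j; split; [now apply (Hq j) | now apply Hb].
Qed.

Lemma halves_le q r K M f g c : (forall j, qsn (q j)) -> (forall j, qbd K (q j)) ->
  V f -> V g -> 0 <= M -> 0 <= c ->
  (forall j, r j <= M * q j f + c * q j g) -> (forall j, 0 <= r j) ->
  Series (fun j => (/ 2) ^ j * r j) <= M * halves q f + c * halves q g.
Proof.
  intros Hq Hb Hf Hg HM Hc Hr Hr0. unfold halves.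
  assert (Ef := ex_halves q K f Hq Hb Hf). assert (Eg := ex_halves q K g Hq Hb Hg).
  rewrite <- !Series_scal_l, <- Series_plus.
  - apply Series_le.
    + intros j. assert (0 <= (/ 2) ^ j) by (apply pow_le; lra). split.
      * apply Rmult_le_pos; auto.
      * replace (M * ((/ 2) ^ j * q j f) + c * ((/ 2) ^ j * q j g))
          with ((/ 2) ^ j * (M * q j f + c * q j g)) by ring.
        apply Rmult_le_compat_l; auto.
    + apply (@ex_series_plus R_AbsRing R_NormedModule);
      now apply (@ex_series_scal_l R_AbsRing R_NormedModule).
  - now apply (@ex_series_scal_l R_AbsRing R_NormedModule).
  - now apply (@ex_series_scal_l R_AbsRing R_NormedModule).
Qed.

Lemma qsn_halves q K : (forall j, qsn (q j)) -> (forall j, qbd K (q j)) -> qsn (halves q).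
Proof.
  intros Hq Hb; split; [| split].
  - intros f Hf. unfold halves.
    replace 0 with (Series (fun j => (/ 2) ^ j * 0)).
    + apply Series_le; [| now apply ex_halves with K].
      intros j; assert (0 <= (/ 2) ^ j) by (apply pow_le; lra).
      split; [lra |]. rewrite Rmult_0_r. apply Rmult_le_pos; auto. now apply (Hq j).
    + rewrite (Series_ext _ (fun j => 0 * (/ 2) ^ j)) by (intros; ring).
      rewrite Series_scal_l; ring.
  - intros c f Hf. unfold halves. rewrite <- Series_scal_l. apply Series_ext; intros j.
    destruct (Hq j) as (_ & H1 & _). rewrite H1; auto; ring.
  - intros s f g Hs Hf Hg. assert (0 < / s) by now apply Rinv_0_lt_compat.
    apply (halves_le q _ K); auto; try lra.
    + intros j; destruct (Hq j) as (_ & _ & H2); auto.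
    + intros j; destruct (Hq j) as (H0 & _); auto.
Qed.

Lemma qbd_halves q K : (forall j, qsn (q j)) -> (forall j, qbd K (q j)) ->
  qbd (2 * K) (halves q).
Proof.
  intros Hq Hb f Hf. unfold halves.
  assert (E : ex_series (fun j => (/ 2) ^ j)) by (apply ex_series_geom; rewrite Rabs_pos_eq; lra).
  replace (2 * K * supn f ^ 2) with (Series (fun j => K * supn f ^ 2 * (/ 2) ^ j)).
  - apply Series_le.
    + intros j; assert (0 <= (/ 2) ^ j) by (apply pow_le; lra). split.
      * apply Rmult_le_pos; auto; now apply (Hq j).
      * rewrite Rmult_comm; apply Rmult_le_compat_r; auto; now apply Hb.
    + now apply (@ex_series_scal_l R_AbsRing R_NormedModule).
  - rewrite Series_scal_l, Series_geom by (rewrite Rabs_pos_eq; lra). field.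
Qed.

(** The defect of the series is the series of the defects, whose terms are nonnegative; one term is
    at most the sum. *)
Lemma mid_defect_halves q K j f h :
  (forall j, qsn (q j)) -> (forall j, qbd K (q j)) -> V f -> V h ->
  (/ 2) ^ j * mid_defect (q j) f h <= mid_defect (halves q) f h.
Proof.
  intros Hq Hb Hf Hh.
  assert (E1 := ex_halves q K _ Hq Hb (V_plus _ _ Hf Hh)).
  assert (E2 := ex_halves q K _ Hq Hb (V_minus _ _ Hf Hh)).
  assert (E3 := ex_halves q K _ Hq Hb Hf).
  assert (E : mid_defect (halves q) f h
              = Series (fun j => (/ 2) ^ j * mid_defect (q j) f h)).
  { unfold mid_defect, halves. rewrite <- Series_scal_l, <- Series_plus, <- Series_minus; auto.
    - apply Series_ext; intros; ring.
    - now apply (@ex_series_plus R_AbsRing R_NormedModule).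
    - now apply (@ex_series_scal_l R_AbsRing R_NormedModule). }
  rewrite E.
  assert (Epos : forall i, 0 <= (/ 2) ^ i * mid_defect (q i) f h).
  { intros i; apply Rmult_le_pos; [apply pow_le; lra | now apply mid_defect_nonneg]. }
  assert (Ex : ex_series (fun j => (/ 2) ^ j * mid_defect (q j) f h)).
  { unfold mid_defect.
    replace (fun j => (/ 2) ^ j * (q j (fun x => f x + h x) + q j (fun x => f x - h x)
                                   - 2 * q j f))
      with (fun j => (/ 2) ^ j * q j (fun x => f x + h x)
       + (/ 2) ^ j * q j (fun x => f x - h x) - 2 * ((/ 2) ^ j * q j f)) by fun_ring.
    - apply (@ex_series_minus R_AbsRing R_NormedModule).
      + now apply (@ex_series_plus R_AbsRing R_NormedModule).
      + now apply (@ex_series_scal_l R_AbsRing R_NormedModule). }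
  set (a := fun i => (/ 2) ^ i * mid_defect (q i) f h) in *.
  change (a j <= Series a).
  rewrite (Series_incr_n a (S j)); auto with arith.
  assert (Hs : forall n, 0 <= sum_f_R0 a n).
  { intros n; induction n as [| n IH]; simpl; [apply Epos |].
    apply Rplus_le_le_0_compat; auto. apply Epos. }
  assert (Htail : 0 <= Series (fun k => a (S j + k)%nat)).
  { replace 0 with (Series (fun k => 0 * a (S j + k)%nat)).
    - apply Series_le; [intros k; specialize (Epos (S j + k)%nat); unfold a in *; lra |].
      now apply (ex_series_incr_n a (S j)).
    - rewrite Series_scal_l; ring. }
  simpl pred. assert (a j <= sum_f_R0 a j); [| lra].
  destruct j as [| j]; simpl; [lra |]. specialize (Hs j). lra.
Qed.

(** The best [s] in [qsn] is the ratio of the two roots; the shift by [d] keeps it defined when a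
    root vanishes. *)
Lemma qsn_sqrt q f g : qsn q -> V f -> V g ->
  sqrt (q (fun x => f x + g x)) <= sqrt (q f) + sqrt (q g).
Proof.
  intros (H0 & _ & H2) Hf Hg.
  assert (A := H0 f Hf). assert (B := H0 g Hg).
  set (a := sqrt (q f)). set (b := sqrt (q g)).
  assert (Ha : 0 <= a) by apply sqrt_pos. assert (Hb : 0 <= b) by apply sqrt_pos.
  assert (Ea : q f = a ^ 2) by (unfold a; now rewrite pow2_sqrt).
  assert (Eb : q g = b ^ 2) by (unfold b; now rewrite pow2_sqrt).
  assert (Hs : forall d, 0 < d -> q (fun x => f x + g x) <= (a + b + 2 * d) ^ 2).
  { intros d Hd.
    assert (Hbd : 0 < (b + d) / (a + d)) by (apply Rdiv_lt_0_compat; lra).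
    eapply Rle_trans; [apply (H2 _ _ _ Hbd Hf Hg) |]. rewrite Ea, Eb.
    replace ((a + b + 2 * d) ^ 2)
      with ((1 + (b + d) / (a + d)) * (a + d) ^ 2 + (1 + / ((b + d) / (a + d))) * (b + d) ^ 2)
      by (field; lra).
    assert (0 < / ((b + d) / (a + d))) by now apply Rinv_0_lt_compat.
    apply Rplus_le_compat; apply Rmult_le_compat_l; try lra; apply pow_incr; lra. }
  assert (Hsq : forall d, 0 < d -> sqrt (q (fun x => f x + g x)) <= a + b + 2 * d).
  { intros d Hd. rewrite <- (sqrt_pow2 (a + b + 2 * d)) by lra.
    apply sqrt_le_1_alt, Hs; auto. }
  apply Rnot_lt_le; intros Hlt.
  specialize (Hsq ((sqrt (q (fun x => f x + g x)) - (a + b)) / 4)). lra.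
Qed.

Variables (I : Type) (t : I -> (X -> R) -> R) (psi : list I -> list I -> (X -> R) -> R).
Variable K : R.
Hypothesis K_pos : 0 <= K.
Hypothesis t_qsn : forall i, qsn (t i).
Hypothesis t_qbd : forall i, qbd K (t i).
Hypothesis t_c0 : forall f, V f -> forall eps, 0 < eps ->
  exists l, forall i, eps <= t i f -> In i l.
Hypothesis psi_qsn : forall A B, qsn (psi A B).
Hypothesis psi_qbd : forall A B, qbd K (psi A B).

(* Averages [psi A] over all sublists of [A], so that each of them is controlled. *)
Fixpoint psi_mean (A l B : list I) (f : X -> R) : R :=
  match l with
  | [] => psi A B f
  | i :: l' => / 2 * psi_mean A l' B f + / 2 * psi_mean A l' (i :: B) f
  end.

Definition t_off (l : list I) (i : I) (f : X -> R) : R :=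
  if excluded_middle_informative (In i l) then 0 else t i f.

Definition outer (l : list I) (f : X -> R) : R := supn (fun i => t_off l i f).

Definition inner (l : list I) (f : X -> R) : R := lsum l (fun i => t i f).

Definition total (m : nat) (l : list I) (f : X -> R) : R :=
  inner l f + (/ 2) ^ m * (outer l f + psi_mean l l [] f).

(** The value 0 for long lists turns the supremum over all lists into one over sets of at most [k]
    indices, which keeps it bounded. *)
Definition capped (k m : nat) (l : list I) (f : X -> R) : R :=
  if le_lt_dec (length (canon l)) k then total m (canon l) f else 0.

(* For large [m] the supremum is attained at the set of the [k] largest values [t i f]
   whenever these are separated from the others. *)
Definition theta (j : nat) (f : X -> R) : R :=
  let (k, m) := Cantor.of_nat j in / (INR k + 2) * supn (fun l => capped k m l f).

(** The first summand gives the lower bound for equivalence; the series carries the convexity. *)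
Definition norm_sq (f : X -> R) : R := supn (fun x => f x ^ 2) + halves theta f.

Lemma half_pow_le m : (/ 2) ^ m <= 1.
Proof. rewrite <- (pow1 m). apply pow_incr; lra. Qed.

Lemma psi_mean_qsn A l B : qsn (psi_mean A l B).
Proof.
  revert B; induction l as [| i l IH]; intros B; [apply psi_qsn |].
  simpl. apply (qsn_plus (fun f => / 2 * psi_mean A l B f)); apply qsn_scal; auto; lra.
Qed.

Lemma psi_mean_qbd A l B : qbd K (psi_mean A l B).
Proof.
  revert B; induction l as [| i l IH]; intros B; [apply psi_qbd |].
  intros f Hf.
  change (psi_mean A (i :: l) B f)
    with (/ 2 * psi_mean A l B f + / 2 * psi_mean A l (i :: B) f).
  generalize (IH B f Hf) (IH (i :: B) f Hf). lra.
Qed.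

(** The leaf of the averaging tree that keeps exactly the indices in [b] has weight
    [(/ 2) ^ length l], and all other leaves have nonnegative defect. *)
Lemma psi_mean_defect A l B0 (b : I -> Prop) : exists B,
  (forall i, In i B <-> (In i l /\ b i) \/ In i B0) /\
  forall f h, V f -> V h ->
    mid_defect (psi A B) f h <= 2 ^ length l * mid_defect (psi_mean A l B0) f h.
Proof.
  revert B0; induction l as [| j l IH]; intros B0.
  - exists B0; split; [simpl; tauto |].
    intros; simpl length; rewrite pow_O, Rmult_1_l; apply Rle_refl.
  - destruct (IH (if excluded_middle_informative (b j) then j :: B0 else B0)) as (B & HB & Hd).
    exists B; split.
    + intros i; rewrite HB. destruct excluded_middle_informative; simpl.
      * intuition (subst; tauto).
      * intuition (subst; tauto).
    + intros f h Hf Hh. specialize (Hd f h Hf Hh).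
      assert (D1 := mid_defect_nonneg _ f h (psi_mean_qsn A l B0) Hf Hh).
      assert (D2 := mid_defect_nonneg _ f h (psi_mean_qsn A l (j :: B0)) Hf Hh).
      assert (E : mid_defect (psi_mean A (j :: l) B0) f h
                = / 2 * mid_defect (psi_mean A l B0) f h
                  + / 2 * mid_defect (psi_mean A l (j :: B0)) f h).
      { unfold mid_defect; simpl; ring. }
      rewrite E. simpl length. assert (0 < 2 ^ length l) by (apply pow_lt; lra).
      eapply Rle_trans; [apply Hd |].
      replace (2 ^ S (length l) * (/ 2 * mid_defect (psi_mean A l B0) f h
                  + / 2 * mid_defect (psi_mean A l (j :: B0)) f h))
        with (2 ^ length l * (mid_defect (psi_mean A l B0) f h
                  + mid_defect (psi_mean A l (j :: B0)) f h)) by (simpl; field).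
      apply Rmult_le_compat_l; [lra |]. destruct excluded_middle_informative; lra.
Qed.

Lemma t_off_qsn l i : qsn (t_off l i).
Proof.
  unfold t_off; destruct excluded_middle_informative; [apply qsn_zero | apply t_qsn].
Qed.

Lemma t_off_qbd l i : qbd K (t_off l i).
Proof.
  intros f Hf; unfold t_off; destruct excluded_middle_informative; [| now apply t_qbd].
  apply Rmult_le_pos; auto; apply pow2_ge_0.
Qed.

Lemma outer_qsn l : qsn (outer l).
Proof. apply (qsn_sup (t_off l) K); auto using t_off_qsn, t_off_qbd. Qed.

Lemma outer_qbd l : qbd K (outer l).
Proof. apply (qbd_sup (t_off l) K); auto using t_off_qsn, t_off_qbd. Qed.

Lemma inner_qsn l : qsn (inner l).
Proof.
  induction l as [| i l IH]; [apply qsn_zero |].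
  apply (qsn_plus (t i) (inner l)); auto.
Qed.

Lemma inner_qbd l : qbd (INR (length l) * K) (inner l).
Proof.
  intros f Hf. induction l as [| i l IH].
  - unfold inner, lsum; simpl; rewrite !Rmult_0_l; apply Rle_refl.
  - change (t i f + inner l f <= INR (length (i :: l)) * K * supn f ^ 2).
    cbn [length]. rewrite S_INR. generalize (t_qbd i f Hf); lra.
Qed.

Lemma total_qsn m l : qsn (total m l).
Proof.
  apply (qsn_plus (inner l) (fun f => (/ 2) ^ m * (outer l f + psi_mean l l [] f))).
  - apply inner_qsn.
  - apply (qsn_scal ((/ 2) ^ m) (fun f => outer l f + psi_mean l l [] f)).
    + left; apply half_pow_pos.
    + apply qsn_plus; auto using outer_qsn, psi_mean_qsn.
Qed.

Lemma total_outer_le m l f : V f ->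
  (/ 2) ^ m * (outer l f + psi_mean l l [] f) <= (/ 2) ^ m * (2 * K * supn f ^ 2).
Proof.
  intros Hf. apply Rmult_le_compat_l; [left; apply half_pow_pos |].
  generalize (outer_qbd l f Hf) (psi_mean_qbd l l [] f Hf); lra.
Qed.

Lemma capped_qsn k m l : qsn (capped k m l).
Proof.
  unfold capped; destruct le_lt_dec; [apply total_qsn | apply qsn_zero].
Qed.

Lemma capped_qbd k m l : qbd ((INR k + 2) * K) (capped k m l).
Proof.
  intros f Hf. unfold capped. assert (Hk := pos_INR k).
  assert (0 <= K * supn f ^ 2) by (apply Rmult_le_pos; auto; apply pow2_ge_0).
  destruct le_lt_dec as [Hl | Hl].
  - unfold total. assert (H1 := inner_qbd (canon l) f Hf).
    assert (H2 := total_outer_le m (canon l) f Hf).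
    assert (H3 := half_pow_le m). apply le_INR in Hl.
    assert ((/ 2) ^ m * (2 * K * supn f ^ 2) <= 1 * (2 * K * supn f ^ 2))
      by (apply Rmult_le_compat_r; lra).
    assert (INR (length (canon l)) * (K * supn f ^ 2) <= INR k * (K * supn f ^ 2))
      by (apply Rmult_le_compat_r; lra).
    lra.
  - rewrite Rmult_assoc. apply Rmult_le_pos; lra.
Qed.

Lemma theta_qsn j : qsn (theta j).
Proof.
  unfold theta; destruct (Cantor.of_nat j) as [k m].
  apply qsn_scal; [left; apply Rinv_0_lt_compat; generalize (pos_INR k); lra |].
  apply (qsn_sup (capped k m) ((INR k + 2) * K)); auto using capped_qsn, capped_qbd.
Qed.

Lemma theta_qbd j : qbd K (theta j).
Proof.
  intros f Hf. unfold theta; destruct (Cantor.of_nat j) as [k m]. assert (Hk := pos_INR k).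
  assert (H : supn (fun l => capped k m l f) <= (INR k + 2) * K * supn f ^ 2).
  { apply (qbd_sup (capped k m) ((INR k + 2) * K)); auto using capped_qsn, capped_qbd.
    apply Rmult_le_pos; lra. }
  apply Rmult_le_reg_l with (INR k + 2); [lra |].
  rewrite <- Rmult_assoc, Rinv_r, Rmult_1_l by lra. lra.
Qed.

Lemma sq_qsn x : qsn (fun f => f x ^ 2).
Proof. apply (qsn_square (fun f => f x)); auto. Qed.

Lemma sq_qbd x : qbd 1 (fun f => f x ^ 2).
Proof.
  intros f Hf. rewrite Rmult_1_l, <- (pow2_abs (f x)). apply pow_incr.
  split; [apply Rabs_pos | auto].
Qed.

Lemma norm_sq_qsn : qsn norm_sq.
Proof.
  apply (qsn_plus (fun f => supn (fun x => f x ^ 2)) (halves theta)).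
  - apply (qsn_sup (fun x f => f x ^ 2) 1); auto using sq_qsn, sq_qbd.
  - apply qsn_halves with K; auto using theta_qsn, theta_qbd.
Qed.

Lemma norm_sq_equiv f : V f ->
  supn f ^ 2 <= norm_sq f /\ norm_sq f <= (1 + 2 * K) * supn f ^ 2.
Proof.
  intros Hf. unfold norm_sq.
  assert (H1 := proj1 (qsn_halves theta K theta_qsn theta_qbd) f Hf).
  assert (H2 := qbd_halves theta K theta_qsn theta_qbd f Hf).
  assert (H3 := qbd_sup (fun x f => f x ^ 2) 1 ltac:(lra) sq_qsn sq_qbd f Hf).
  assert (H4 : supn f ^ 2 <= supn (fun x => f x ^ 2)).
  { assert (Hs := supn_nonneg (fun x => f x ^ 2)).
    rewrite <- (pow2_sqrt (supn (fun x => f x ^ 2))) by auto.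
    apply pow_incr. split; [apply supn_nonneg |].
    apply supn_lub; [apply sqrt_pos |]. intros x.
    rewrite <- (sqrt_pow2 (Rabs (f x))) by apply Rabs_pos. apply sqrt_le_1_alt.
    rewrite pow2_abs. apply (sup_ub (fun x f => f x ^ 2) 1); auto using sq_qsn, sq_qbd. }
  lra.
Qed.

(** Only finitely many values [t i f] reach [eta / 2], so those below [eta] stay below some
    [mu < eta]. The gap [eta - mu] is what makes the level set a strict maximiser in [inner_gap]. *)
Lemma level_set f eta : V f -> 0 < eta -> exists l mu, NoDup l /\
  (forall i, In i l <-> eta <= t i f) /\ 0 <= mu /\ mu < eta /\
  (forall i, ~ In i l -> t i f <= mu).
Proof.
  intros Hf Heta. destruct (t_c0 f Hf (eta / 2)) as [l Hl]; [lra |].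
  assert (Hmu : exists mu, eta / 2 <= mu /\ mu < eta /\
            forall i, In i l -> t i f < eta -> t i f <= mu).
  { clear Hl. induction l as [| j l (mu & H1 & H2 & H3)].
    - exists (eta / 2). repeat split; try lra. intros i [].
    - destruct (Rlt_or_le (t j f) eta) as [Hj | Hj].
      + exists (Rmax mu (t j f)). repeat split.
        * eapply Rle_trans; [apply H1 | apply Rmax_l].
        * apply Rmax_lub_lt; auto.
        * intros i [<- | Hi] Hlt; [apply Rmax_r |].
          eapply Rle_trans; [now apply H3 | apply Rmax_l].
      + exists mu; repeat split; auto. intros i [<- | Hi] Hlt; [lra | auto]. }
  destruct Hmu as (mu & H1 & H2 & H3).
  set (l1 := filter (fun i => if Rle_dec eta (t i f) then true else false) l).
  destruct (canon_spec l1) as [Hnd Hc].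
  assert (Hin : forall i, In i (canon l1) <-> eta <= t i f).
  { intros i; rewrite Hc. unfold l1; rewrite filter_In. split.
    - intros [_ H]. destruct (Rle_dec eta (t i f)); auto; discriminate.
    - intros H. split; [apply Hl; lra |]. destruct (Rle_dec eta (t i f)); auto. }
  exists (canon l1), mu. repeat split; try lra; auto; try apply Hin.
  intros i Hi. rewrite Hin in Hi. apply Rnot_le_lt in Hi.
  destruct (Rle_or_lt (eta / 2) (t i f)) as [H | H]; [auto | lra].
Qed.

(** After [mu] is subtracted from every value, indices outside [l] contribute at most 0 and those of
    [l] at least [eta - mu]. A different set that is no larger misses some index of [l] and loses
    that much. *)
Lemma inner_gap f l l' eta mu : V f -> NoDup l -> NoDup l' ->
  (forall i, In i l <-> eta <= t i f) -> 0 <= mu -> mu < eta ->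
  (forall i, ~ In i l -> t i f <= mu) ->
  (length l' <= length l)%nat -> ~ (forall i, In i l' <-> In i l) ->
  inner l' f <= inner l f - (eta - mu).
Proof.
  intros Hf Hnd Hnd' Hl Hmu0 Hmu Hout Hlen Hne.
  assert (Hi0 : exists i0, In i0 l /\ ~ In i0 l').
  { apply NNPP; intros Hn. apply Hne.
    assert (Hincl : incl l l').
    { intros i Hi; apply NNPP; intros Hi'; apply Hn; now exists i. }
    intros i; split; auto. apply (NoDup_length_incl Hnd Hlen Hincl). }
  destruct Hi0 as (i0 & Hi0 & Hi0').
  unfold inner. rewrite (lsum_minus_const l' _ mu), (lsum_minus_const l _ mu).
  set (b := fun i => t i f - mu).
  apply le_INR in Hlen.
  assert (INR (length l') * mu <= INR (length l) * mu) by (apply Rmult_le_compat_r; auto).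
  set (inl := fun i => if excluded_middle_informative (In i l) then true else false).
  set (l1 := filter inl l').
  assert (H1 : lsum l' b <= lsum l1 b).
  { unfold l1. clear - Hout. induction l' as [| j l' IH]; [apply Rle_refl |].
    assert (E : forall m, lsum (j :: m) b = b j + lsum m b) by reflexivity.
    rewrite E. simpl. unfold inl at 1.
    destruct excluded_middle_informative as [Hj | Hj]; [rewrite E; lra |].
    assert (b j <= 0) by (unfold b; specialize (Hout j Hj); lra). lra. }
  assert (H2 : lsum (i0 :: l1) b <= lsum l b).
  { apply lsum_incl.
    - constructor; [| now apply NoDup_filter].
      unfold l1; rewrite filter_In; tauto.
    - intros i [<- | Hi]; auto. unfold l1, inl in Hi; rewrite filter_In in Hi.
      destruct (excluded_middle_informative (In i l)); auto. now destruct Hi.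
    - intros i Hi; unfold b. apply Hl in Hi; lra. }
  change (b i0 + lsum l1 b <= lsum l b) in H2.
  assert (eta - mu <= b i0) by (unfold b; apply Hl in Hi0; lra). lra.
Qed.

(** The level set attains the supremum in the matching [theta] at [f], so its [total] inherits the
    defect of the norm; the summands of [total] have nonnegative defects and inherit it in turn. *)
Lemma selection f eta : V f -> 0 < eta -> exists l,
  (forall i, In i l <-> eta <= t i f) /\
  exists C, 0 <= C /\ forall h, V h ->
    (forall i, In i l -> mid_defect (t i) f h <= C * mid_defect norm_sq f h) /\
    mid_defect (outer l) f h <= C * mid_defect norm_sq f h /\
    mid_defect (psi_mean l l []) f h <= C * mid_defect norm_sq f h.
Proof.
  intros Hf Heta.
  destruct (level_set f eta Hf Heta) as (l' & mu & Hnd' & Hl' & Hmu0 & Hmu & Hout').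
  destruct (canon_spec l') as [Hnd Hc].
  set (l := canon l').
  assert (Hl : forall i, In i l <-> eta <= t i f).
  { intros i; unfold l; now rewrite Hc. }
  assert (Hout : forall i, ~ In i l -> t i f <= mu).
  { intros i Hi; apply Hout'. rewrite <- Hc; auto. }
  clear Hout' Hnd'. exists l; split; auto.
  set (k := length l).
  (* [m] is so large that the terms scaled by [(/ 2) ^ m] cannot make up for the gap [eta - mu]. *)
  assert (Hm : exists m, (/ 2) ^ m * (2 * K * supn f ^ 2) <= eta - mu).
  { assert (Hs : 0 <= 2 * K * supn f ^ 2) by (apply Rmult_le_pos; [lra | apply pow2_ge_0]).
    destruct (half_pow_small ((eta - mu) / (2 * K * supn f ^ 2 + 1))) as [m Hm].
    { apply Rdiv_lt_0_compat; lra. }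
    exists m. specialize (Hm m (Nat.le_refl m)). assert (Hp := half_pow_pos m).
    apply Rle_trans with ((eta - mu) / (2 * K * supn f ^ 2 + 1) * (2 * K * supn f ^ 2 + 1)).
    - apply Rmult_le_compat; lra.
    - right; field; lra. }
  destruct Hm as [m Hm].
  assert (Hmax : forall y, capped k m y f <= capped k m l' f).
  { intros y.
    assert (E : capped k m l' f = total m l f).
    { unfold capped. fold l. destruct le_lt_dec as [_ | H]; auto.
      unfold k in H; exfalso; lia. }
    rewrite E. unfold capped. destruct le_lt_dec as [Hy | Hy].
    2: { now apply (total_qsn m l). }
    destruct (classic (forall i, In i (canon y) <-> In i l)) as [Hsame | Hdiff].
    - replace (canon y) with l; [apply Rle_refl |].
      unfold l; apply canon_ext. intros i. destruct (canon_spec y) as [_ Hcy].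
      rewrite <- Hcy, Hsame. unfold l; now rewrite Hc.
    - destruct (canon_spec y) as [Hndy _].
      assert (H1 := inner_gap f l (canon y) eta mu Hf Hnd Hndy Hl Hmu0 Hmu Hout Hy Hdiff).
      assert (H2 := total_outer_le m (canon y) f Hf).
      assert (0 <= (/ 2) ^ m * (outer l f + psi_mean l l [] f)).
      { apply Rmult_le_pos; [left; apply half_pow_pos |].
        apply Rplus_le_le_0_compat; [now apply outer_qsn | now apply psi_mean_qsn]. }
      unfold total. lra. }
  assert (Hk2 : 0 < INR k + 2) by (generalize (pos_INR k); lra).
  set (j := Cantor.to_nat (k, m)).
  (* [Cj] undoes the weight [/ (INR k + 2)] in [theta] and [(/ 2) ^ j] in the series; the factor
     [2 ^ m] below undoes the scaling inside [total]. *)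
  set (Cj := (INR k + 2) * 2 ^ j).
  assert (H2j : 0 < 2 ^ j) by (apply pow_lt; lra).
  assert (HCj : 0 < Cj) by now apply Rmult_lt_0_compat.
  assert (H2m : 1 <= 2 ^ m) by (apply pow_R1_Rle; lra).
  exists (Cj * 2 ^ m); split; [left; apply Rmult_lt_0_compat; lra |].
  intros h Hh.
  assert (Htot : mid_defect (total m l) f h <= Cj * mid_defect norm_sq f h).
  { assert (H1 := mid_defect_sup (capped k m) _ l' f h (capped_qsn k m) (capped_qbd k m)
                    Hf Hh Hmax).
    assert (E : mid_defect (capped k m l') f h = mid_defect (total m l) f h).
    { unfold mid_defect, capped. fold l. destruct le_lt_dec as [_ | H]; auto.
      unfold k in H; exfalso; lia. }
    rewrite E in H1.
    assert (H2 := mid_defect_halves theta K j f h theta_qsn theta_qbd Hf Hh).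
    assert (E2 : mid_defect (theta j) f h
       = / (INR k + 2) * mid_defect (fun f => supn (fun y => capped k m y f)) f h).
    { unfold mid_defect, theta, j. rewrite Cantor.cancel_of_to. ring. }
    assert (H3 : mid_defect (halves theta) f h <= mid_defect norm_sq f h).
    { assert (E3 : mid_defect norm_sq f h = mid_defect (fun f => supn (fun x => f x ^ 2)) f h
                 + mid_defect (halves theta) f h) by (unfold mid_defect, norm_sq; ring).
      assert (0 <= mid_defect (fun f => supn (fun x => f x ^ 2)) f h).
      { apply mid_defect_nonneg; auto.
        apply (qsn_sup (fun x f => f x ^ 2) 1); auto using sq_qsn, sq_qbd. }
      lra. }
    eapply Rle_trans; [apply H1 |].
    replace (mid_defect (fun f => supn (fun y => capped k m y f)) f h)
      with (Cj * ((/ 2) ^ j * mid_defect (theta j) f h)).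
    - apply Rmult_le_compat_l; lra.
    - rewrite E2. unfold Cj. rewrite pow_inv. field; lra. }
  assert (Hin := mid_defect_nonneg _ f h (inner_qsn l) Hf Hh).
  assert (Ho := mid_defect_nonneg _ f h (outer_qsn l) Hf Hh).
  assert (Hp := mid_defect_nonneg _ f h (psi_mean_qsn l l []) Hf Hh).
  assert (E : mid_defect (total m l) f h = mid_defect (inner l) f h + (/ 2) ^ m *
     (mid_defect (outer l) f h + mid_defect (psi_mean l l []) f h))
    by (unfold mid_defect, total; ring).
  rewrite E in Htot.
  assert (Hhp := half_pow_pos m).
  assert (Hd : 0 <= mid_defect norm_sq f h)
    by (apply mid_defect_nonneg; auto using norm_sq_qsn).
  assert (Hscale : forall r, (/ 2) ^ m * r <= Cj * mid_defect norm_sq f h ->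
            r <= Cj * 2 ^ m * mid_defect norm_sq f h).
  { intros r Hr. apply Rmult_le_reg_l with ((/ 2) ^ m); auto.
    replace ((/ 2) ^ m * (Cj * 2 ^ m * mid_defect norm_sq f h))
      with (Cj * mid_defect norm_sq f h); auto.
    rewrite pow_inv. field. lra. }
  assert (Ho' : 0 <= (/ 2) ^ m * mid_defect (outer l) f h) by (apply Rmult_le_pos; lra).
  assert (Hp' : 0 <= (/ 2) ^ m * mid_defect (psi_mean l l []) f h)
    by (apply Rmult_le_pos; lra).
  repeat split; [| apply Hscale; lra | apply Hscale; lra].
  intros i Hi.
  assert (Hti : mid_defect (t i) f h <= mid_defect (inner l) f h).
  { clear - Hi Hf Hh V_plus V_scal t_qsn. induction l as [| i' l IH]; [easy |].
    assert (E : mid_defect (inner (i' :: l)) f h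
                = mid_defect (t i') f h + mid_defect (inner l) f h)
      by (unfold mid_defect, inner, lsum; simpl; ring).
    rewrite E. assert (H1 := mid_defect_nonneg _ f h (t_qsn i') Hf Hh).
    assert (H2 := mid_defect_nonneg _ f h (inner_qsn l) Hf Hh).
    destruct Hi as [-> | Hi]; [lra | specialize (IH Hi); lra]. }
  assert (Cj * mid_defect norm_sq f h <= Cj * 2 ^ m * mid_defect norm_sq f h).
  { apply Rmult_le_compat_r; auto. rewrite <- (Rmult_1_r Cj) at 1.
    apply Rmult_le_compat_l; lra. }
  lra.
Qed.

(** The set [A] in the last clause cannot be prescribed, since the norm selects whole level sets of
    [f]; it can only be made to contain [J]. Its subset [B] is free, thanks to the averaging in
    [psi_mean]. *)
Theorem renorming : exists N, equiv_norm_on V N /\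
  (forall f i eps, V f -> 0 < eps -> exists C, 0 <= C /\ forall h, V h ->
     mid_defect (t i) f h <= eps + C * mid_defect (fun g => N g ^ 2) f h) /\
  (forall f J B, V f -> (forall i, In i J -> 0 < t i f) -> incl B J ->
     exists A B', incl J A /\ (forall i, In i B' <-> In i B) /\
     exists C, 0 <= C /\ forall h, V h ->
       mid_defect (psi A B') f h <= C * mid_defect (fun g => N g ^ 2) f h).
Proof.
  assert (Hsq : forall f, V f -> sqrt (norm_sq f) ^ 2 = norm_sq f).
  { intros f Hf. apply pow2_sqrt. now apply norm_sq_qsn. }
  assert (Hdef : forall f h, V f -> V h ->
    mid_defect (fun g => sqrt (norm_sq g) ^ 2) f h = mid_defect norm_sq f h).
  { intros f h Hf Hh. unfold mid_defect. rewrite !Hsq; auto using V_minus. }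
  exists (fun f => sqrt (norm_sq f)). split; [split; [repeat split |] | split].
  - intros; apply sqrt_pos.
  - intros f Hf H0 x. destruct (norm_sq_equiv f Hf) as [H1 _].
    apply sqrt_eq_0 in H0; [| now apply norm_sq_qsn]. rewrite H0 in H1.
    assert (Hs : supn f = 0).
    { assert (Hp := supn_nonneg f). apply Rle_antisym; auto. apply Rnot_lt_le; intros Hlt.
      assert (0 < supn f ^ 2) by now apply pow_lt. lra. }
    assert (Hx := V_ub f x Hf). rewrite Hs in Hx.
    revert Hx; unfold Rabs; destruct Rcase_abs; lra.
  - intros f c Hf. destruct norm_sq_qsn as (H0 & H1 & _). rewrite H1; auto.
    rewrite sqrt_mult; auto using pow2_ge_0. f_equal.
    rewrite <- pow2_abs. apply sqrt_pow2, Rabs_pos.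
  - intros f g Hf Hg. apply qsn_sqrt; auto using norm_sq_qsn.
  - exists 1, (sqrt (1 + 2 * K)). split; [lra |]. split; [apply sqrt_lt_R0; lra |].
    intros f Hf. destruct (norm_sq_equiv f Hf) as [H1 H2]. split.
    + rewrite Rmult_1_l, <- (sqrt_pow2 (supn f)) by apply supn_nonneg.
      now apply sqrt_le_1_alt.
    + rewrite <- (sqrt_pow2 (supn f)) by apply supn_nonneg.
      rewrite <- sqrt_mult; [| lra | apply pow2_ge_0]. now apply sqrt_le_1_alt.
  - intros f i eps Hf Heps.
    destruct (selection f (eps / 2) Hf) as (l & Hl & C & HC & H); [lra |].
    exists C; split; auto. intros h Hh. rewrite Hdef; auto.
    destruct (H h Hh) as (H1 & H2 & _).
    destruct (classic (In i l)) as [Hi | Hi]; [specialize (H1 i Hi); lra |].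
    (* Off the level set, [outer l] dominates [t i] and is at most [eps / 2] at [f], so its defect
       plus [eps] bounds the defect of [t i]. *)
    assert (Ht : forall g, V g -> t i g <= outer l g).
    { intros g Hg.
      assert (Hu := sup_ub (t_off l) K g i (t_off_qsn l) (t_off_qbd l) Hg).
      unfold t_off at 1 in Hu. destruct excluded_middle_informative; [contradiction | auto]. }
    assert (Ho : outer l f <= eps / 2).
    { apply (sup_lub (t_off l)); auto using t_off_qsn; [lra |].
      intros i'. unfold t_off. destruct excluded_middle_informative as [Hi' | Hi']; [lra |].
      rewrite Hl in Hi'. lra. }
    assert (A1 := Ht _ (V_plus _ _ Hf Hh)). assert (A2 := Ht _ (V_minus _ _ Hf Hh)).
    assert (A3 : 0 <= t i f) by now apply (t_qsn i).
    unfold mid_defect in *. lra.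
  - intros f J B Hf HJ HB.
    (* A height below all values on the finite set [J]; the level set at this height contains
       [J]. *)
    assert (Heta : exists eta, 0 < eta /\ forall i, In i J -> eta <= t i f).
    { clear HB. induction J as [| j J IH].
      - exists 1; split; [lra |]. intros i [].
      - destruct IH as (eta & He & H); [intros; apply HJ; right; auto |].
        assert (Hj := HJ j (or_introl eq_refl)).
        exists (Rmin eta (t j f)); split; [now apply Rmin_pos |].
        intros i [<- | Hi]; [apply Rmin_r |].
        eapply Rle_trans; [apply Rmin_l | auto]. }
    destruct Heta as (eta & He & HJe).
    destruct (selection f eta Hf He) as (l & Hl & C & HC & H).
    destruct (psi_mean_defect l l [] (fun i => In i B)) as (B' & HB' & Hd).
    exists l, B'. split; [intros i Hi; apply Hl; auto |]. split.
    + intros i; rewrite HB'. simpl. split; [tauto |].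
      intros Hi; left; split; auto. apply Hl; auto.
    + exists (2 ^ length l * C). assert (0 < 2 ^ length l) by (apply pow_lt; lra).
      split; [apply Rmult_le_pos; lra |]. intros h Hh. rewrite Hdef; auto.
      destruct (H h Hh) as (_ & _ & H3).
      eapply Rle_trans; [now apply Hd |]. rewrite Rmult_assoc.
      apply Rmult_le_compat_l; lra.
Qed.
End Renorming.
(** * Trees and their continuous functions *)

Section Tree.
Variable T : Type.
Variable le : T -> T -> Prop.
Hypothesis Htree : is_tree T le.
Hypothesis Hhaus : hausdorff_tree T le.

Local Notation lt := (tree_lt T le).
Local Notation limit := (rank_limit T le).
Local Notation succ := (tree_succ T le).

Lemma tle_refl t : le t t.
Proof. apply Htree. Qed.

Lemma tle_antisym s t : le s t -> le t s -> s = t.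
Proof. apply Htree. Qed.

Lemma tle_trans s t u : le s t -> le t u -> le s u.
Proof. apply Htree. Qed.

Lemma comparable s u t : le s t -> le u t -> le s u \/ le u s.
Proof.
  intros Hs Hu.
  destruct Htree as (_ & _ & _ & Hwo).
  destruct (Hwo t (fun x => x = s \/ x = u)) as (m & [-> | ->] & Hm); auto.
  - intros x [-> | ->]; auto.
  - exists s; auto.
Qed.

Lemma lt_le s t : lt s t -> le s t.
Proof. now intros []. Qed.

Lemma lt_irrefl s : ~ lt s s.
Proof. now intros []. Qed.

Lemma lt_le_trans s t u : lt s t -> le t u -> lt s u.
Proof.
  intros [H1 H2] H3; split; [eapply tle_trans; eauto |].
  intros ->; apply H2; now apply tle_antisym.
Qed.

Lemma le_lt_trans s t u : le s t -> lt t u -> lt s u.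
Proof.
  intros H1 [H2 H3]; split; [eapply tle_trans; eauto |].
  intros ->; apply H3; now apply tle_antisym.
Qed.

Lemma le_not_lt s t : le s t -> ~ lt t s.
Proof. intros H1 H2; apply (lt_irrefl s); now apply le_lt_trans with t. Qed.

Lemma le_cases s t : le s t -> s = t \/ lt s t.
Proof. intros H; destruct (classic (s = t)); [left | right]; auto; now split. Qed.

Lemma comparable_lt s u t : le s t -> le u t -> le s u \/ lt u s.
Proof.
  intros Hs Hu; destruct (comparable s u t Hs Hu) as [H | H]; auto.
  destruct (le_cases _ _ H) as [-> | H']; auto.
Qed.

Lemma least (A : T -> Prop) x :
  A x -> exists m, A m /\ le m x /\ forall s, lt s m -> ~ A s.
Proof.
  intros Hx. destruct Htree as (_ & _ & _ & Hwo).
  destruct (Hwo x (fun y => A y /\ le y x)) as (m & [Hm1 Hm2] & Hm3).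
  - now intros s [].
  - exists x; split; [auto | apply tle_refl].
  - exists m; repeat split; auto.
    intros s Hs HA. apply (le_not_lt m s); auto.
    apply Hm3; split; auto. apply tle_trans with m; auto. now apply lt_le.
Qed.

Lemma succ_lt t u : succ t u -> lt t u.
Proof. intros H; apply H, tle_refl. Qed.

Lemma succ_le_lt t u s : succ t u -> lt s u -> le s t.
Proof. intros H; apply H. Qed.

Lemma rank_cases x :
  (forall s, ~ lt s x) \/ (exists t, succ t x) \/ limit x.
Proof.
  destruct (classic (exists s, lt s x)) as [H | H];
    [| left; intros s Hs; apply H; now exists s].
  right. destruct (classic (limit x)) as [Hl | Hl]; auto.
  left. assert (H' : ~ forall s, lt s x -> exists s', lt s s' /\ lt s' x).
  { intros H'; apply Hl; now split. }
  apply not_all_ex_not in H' as [t Ht].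
  apply imply_to_and in Ht as [Ht1 Ht2].
  exists t; intros s; split; intros Hs.
  - destruct (comparable_lt s t x) as [? | ?]; auto using lt_le.
    exfalso; apply Ht2; now exists s.
  - now apply le_lt_trans with t.
Qed.

Lemma succ_exists s x : lt s x -> exists u, succ s u /\ le u x.
Proof.
  intros H.
  destruct (least (fun y => le y x /\ lt s y) x) as (u & [Hu1 Hu2] & _ & Hu3).
  { split; auto using tle_refl. }
  exists u; split; auto.
  intros w; split; intros Hw.
  - assert (Hwx : le w x) by (apply tle_trans with u; auto using lt_le).
    destruct (comparable_lt w s x); auto using lt_le.
    exfalso; now apply (Hu3 w).
  - now apply le_lt_trans with s.
Qed.

Lemma succ_le_ge t u x : succ t u -> lt t x -> le x u -> x = u.
Proof.
  intros H1 H2 H3. destruct (le_cases _ _ H3) as [? | H4]; auto.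
  exfalso; apply (le_not_lt x t); auto. now apply (succ_le_lt t u).
Qed.

Lemma succ_comparable t u v x : succ t u -> succ t v -> le u x -> le v x -> u = v.
Proof.
  intros Hu Hv H1 H2. destruct (comparable u v x) as [H | H]; auto.
  - apply (succ_le_ge t); auto using succ_lt.
  - symmetry; apply (succ_le_ge t); auto using succ_lt.
Qed.

(** The Hausdorff condition enters here: the least point below [t] that is not strictly below [x]
    has the same predecessors as [x], hence is [x]. *)
Lemma limit_le x t : limit x -> (forall y, lt y x -> le y t) -> le x t.
Proof.
  intros Hx H.
  destruct (classic (exists m, le m t /\ ~ lt m x)) as [[m0 Hm0] | Hn].
  - destruct (least (fun y => le y t /\ ~ lt y x) m0 Hm0) as (m & [Hm1 Hm2] & _ & Hm3).
    assert (E : x = m); [| now subst].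
    apply Hhaus; auto. intros s; split; intros Hs.
    + destruct (comparable_lt m s t) as [Hms | ?]; auto.
      exfalso; apply Hm2; now apply le_lt_trans with s.
    + apply NNPP; intros Hn; apply (Hm3 s Hs); split; auto.
      apply tle_trans with m; auto using lt_le.
  - assert (Htx : lt t x).
    { apply NNPP; intros Hn'; apply Hn; exists t; split; auto using tle_refl. }
    destruct Hx as [_ Hx]. destruct (Hx t Htx) as (s & Hs1 & Hs2).
    exfalso; apply (le_not_lt s t); auto.
Qed.

Lemma limit_not_le x t :
  limit x -> ~ le x t -> exists y0, lt y0 x /\ forall y, le y0 y -> ~ le y t.
Proof.
  intros Hx Hn. apply NNPP; intros H; apply Hn; apply limit_le; auto.
  intros y Hy; apply NNPP; intros Hyt; apply H; exists y; split; auto.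
  intros z Hz Hzt; apply Hyt; now apply tle_trans with z.
Qed.

Lemma lt_max x y z : lt y x -> lt z x -> exists w, lt w x /\ le y w /\ le z w.
Proof.
  intros Hy Hz. destruct (comparable y z x) as [H | H]; auto using lt_le.
  - exists z; auto using tle_refl.
  - exists y; auto using tle_refl.
Qed.

Lemma limit_not_le_list x (L : list T) :
  limit x ->
  exists y0, lt y0 x /\ forall y t, In t L -> ~ le x t -> le y0 y -> ~ le y t.
Proof.
  intros Hx. induction L as [| t L (y0 & Hy0 & IH)].
  - destruct Hx as [[s Hs] _]. exists s; split; auto.
  - destruct (classic (le x t)) as [Ht | Ht].
    + exists y0; split; auto. intros y t' [<- | Ht'] Hn; [contradiction |].
      now apply IH.
    + destruct (limit_not_le x t Hx Ht) as (y1 & Hy1 & H1).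
      destruct (lt_max x y0 y1) as (w & Hw & Hw0 & Hw1); auto.
      exists w; split; auto. intros y t' [<- | Ht'] Hn Hy.
      * apply H1; now apply tle_trans with w.
      * apply IH; auto. now apply tle_trans with w.
Qed.

(** With [tree_open_of_left], a set is open exactly when it contains a left interval at each of its
    limit points. Minimal points and successors are isolated. *)
Lemma tree_open_left U x :
  tree_open T le U -> U x -> limit x ->
  exists y0, lt y0 x /\ forall y, le y0 y -> le y x -> U y.
Proof.
  intros HU Ux Hx. destruct (HU x Ux) as (l & Hl1 & Hl2).
  destruct (limit_not_le_list x (map fst l) Hx) as (y0 & Hy0 & H).
  exists y0; split; auto. intros y Hy1 Hy2. apply Hl2.
  intros [t b] Hp. specialize (Hl1 _ Hp). unfold subbasic in *; simpl in *.
  destruct b.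
  - now apply tle_trans with x.
  - apply H; auto. now apply (in_map fst l (t, false)).
Qed.

Lemma tree_open_of_left U :
  (forall x, U x -> limit x ->
     exists y0, lt y0 x /\ forall y, le y0 y -> le y x -> U y) ->
  tree_open T le U.
Proof.
  intros H x Ux. destruct (rank_cases x) as [Hm | [[t Ht] | Hl]].
  - exists [(x, true)]; split.
    + intros p [<- | []]; apply tle_refl.
    + intros y Hy. specialize (Hy _ (or_introl eq_refl)).
      unfold subbasic in Hy; simpl in Hy.
      destruct (le_cases _ _ Hy) as [-> | Hy']; auto. exfalso; now apply (Hm y).
  (* For [x] a successor of [t], the singleton of [x] is (0,x] minus (0,t]. *)
  - exists [(x, true); (t, false)]; split.
    + intros p [<- | [<- | []]]; [apply tle_refl |].
      unfold subbasic; simpl; intros Hxt. apply (le_not_lt x t); auto using succ_lt.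
    + intros y Hy. assert (Hy1 := Hy _ (or_introl eq_refl)).
      assert (Hy2 := Hy _ (or_intror (or_introl eq_refl))).
      unfold subbasic in *; simpl in *.
      destruct (le_cases _ _ Hy1) as [-> | Hy']; auto.
      exfalso; apply Hy2; now apply (succ_le_lt t x).
  - destruct (H x Ux Hl) as (y0 & Hy0 & H0).
    exists [(x, true); (y0, false)]; split.
    + intros p [<- | [<- | []]]; [apply tle_refl |].
      unfold subbasic; simpl; intros Hxt. apply (le_not_lt x y0); auto.
    + intros y Hy. assert (Hy1 := Hy _ (or_introl eq_refl)).
      assert (Hy2 := Hy _ (or_intror (or_introl eq_refl))).
      unfold subbasic in *; simpl in *. apply H0; auto.
      destruct (comparable y0 y x); auto using lt_le. contradiction.
Qed.

(** * Membership in C_0 in terms of the order *)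

Definition left_cont (f : T -> R) : Prop :=
  forall x, limit x -> forall eps, 0 < eps ->
    exists y0, lt y0 x /\ forall y, le y0 y -> le y x -> Rabs (f x - f y) <= eps.

Definition vanishing (f : T -> R) : Prop :=
  forall eps, 0 < eps -> exists L : list T,
    forall x, eps <= Rabs (f x) -> exists z, In z L /\ le x z.

Lemma left_cont_nbhd f V x :
  left_cont f -> open_set V -> V (f x) -> limit x ->
  exists y0, lt y0 x /\ forall y, le y0 y -> le y x -> V (f y).
Proof.
  intros Hf HV Vx Hx. destruct (HV _ Vx) as [d Hd].
  destruct (Hf x Hx (d / 2)) as (y0 & Hy0 & H0).
  { apply Rlt_gt, Rdiv_lt_0_compat; [apply d | lra]. }
  exists y0; split; auto. intros y H1 H2. apply Hd. unfold disc.
  rewrite Rabs_minus_sym. specialize (H0 y H1 H2). assert (H := cond_pos d). lra.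
Qed.

(** Compactness on one chain (0,z], by considering the least [z] without a finite subcover. *)
Lemma initial_cover f eps (J : Type) (U : J -> T -> Prop) :
  left_cont f -> (forall j, tree_open T le (U j)) ->
  (forall x, eps <= Rabs (f x) -> exists j, U j x) ->
  forall z, exists l : list J,
    forall x, eps <= Rabs (f x) -> le x z -> exists j, In j l /\ U j x.
Proof.
  intros Hf HU Hcov z. apply NNPP; intros Hz.
  destruct (least (fun z => ~ exists l : list J,
    forall x, eps <= Rabs (f x) -> le x z -> exists j, In j l /\ U j x) z Hz)
    as (m & Hm & _ & Hmin).
  assert (Hbelow : forall s, lt s m -> exists l : list J,
    forall x, eps <= Rabs (f x) -> le x s -> exists j, In j l /\ U j x).
  { intros s Hs; apply NNPP; apply (Hmin s Hs). }
  clear Hmin Hz z. apply Hm.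
  assert (Hloc : exists l0 : list J, forall y, eps <= Rabs (f y) -> y = m ->
            exists j, In j l0 /\ U j y).
  { destruct (classic (eps <= Rabs (f m))) as [H | H].
    - destruct (Hcov m H) as [j Hj]. exists [j]; intros y _ ->; exists j; simpl; auto.
    - exists []; intros y Hy ->; contradiction. }
  destruct Hloc as [l0 Hl0].
  destruct (rank_cases m) as [Hmin | [[t Ht] | Hl]].
  - exists l0; intros x Hx1 Hx2. apply Hl0; auto.
    destruct (le_cases _ _ Hx2) as [? | Hx3]; auto. exfalso; now apply (Hmin x).
  - destruct (Hbelow t) as [l Hl]; [now apply succ_lt |].
    exists (l0 ++ l); intros x Hx1 Hx2.
    destruct (le_cases _ _ Hx2) as [-> | Hx3].
    + destruct (Hl0 m Hx1 eq_refl) as (j & H1 & H2). exists j; split; auto.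
      apply in_or_app; auto.
    + destruct (Hl x Hx1) as (j & H1 & H2); [now apply (succ_le_lt t m) |].
      exists j; split; auto. apply in_or_app; auto.
  - assert (Hloc : exists l1 : list J, exists y0, lt y0 m /\
      forall y, le y0 y -> le y m -> eps <= Rabs (f y) -> exists j, In j l1 /\ U j y).
    { destruct (classic (eps <= Rabs (f m))) as [H | H].
      - destruct (Hcov m H) as [j Hj].
        destruct (tree_open_left (U j) m (HU j) Hj Hl) as (y0 & Hy0 & H0).
        exists [j], y0; split; auto. intros y H1 H2 _. exists j; simpl; auto.
      (* If the limit point is not in the set to be covered, neither is some left interval at it,
         and nothing new has to be covered. *)
      - destruct (Hf m Hl ((eps - Rabs (f m)) / 2)) as (y0 & Hy0 & H0); [lra |].
        exists [], y0; split; auto. intros y H1 H2 H3; exfalso.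
        specialize (H0 y H1 H2).
        assert (Rabs (f y) <= Rabs (f m) + Rabs (f m - f y)).
        { replace (f y) with (f m - (f m - f y)) at 1 by ring.
          eapply Rle_trans; [apply Rabs_triang |]. rewrite Rabs_Ropp. lra. }
        lra. }
    destruct Hloc as (l1 & y0 & Hy0 & H1).
    destruct (Hbelow y0 Hy0) as [l Hl2].
    exists (l1 ++ l); intros x Hx1 Hx2.
    destruct (comparable y0 x m) as [Hc | Hc]; auto using lt_le.
    + destruct (H1 x Hc Hx2 Hx1) as (j & Hj1 & Hj2). exists j; split; auto.
      apply in_or_app; auto.
    + destruct (Hl2 x Hx1 Hc) as (j & Hj1 & Hj2). exists j; split; auto.
      apply in_or_app; auto.
Qed.

Lemma C0_iff f : C0 T le f <-> left_cont f /\ vanishing f.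
Proof.
  split.
  - intros [Hc Hk]; split.
    + intros x Hx eps Heps.
      destruct (tree_open_left (fun y => disc (f x) (mkposreal eps Heps) (f y)) x)
        as (y0 & Hy0 & H0); auto.
      * apply (Hc (disc (f x) (mkposreal eps Heps))). apply disc_P1.
      * unfold disc. rewrite Rminus_eq_0, Rabs_R0; auto.
      * exists y0; split; auto. intros y H1 H2.
        specialize (H0 y H1 H2); unfold disc in H0; simpl in H0.
        rewrite Rabs_minus_sym; lra.
    + intros eps Heps. destruct (Hk eps Heps T (fun z x => le x z)) as [L HL].
      * intros z; apply tree_open_of_left. intros x Hx [[s Hs] _].
        exists s; split; auto. intros y _ Hy; now apply tle_trans with x.
      * intros x _; exists x; apply tle_refl.
      * exists L; auto.
  - intros [Hc Hv]; split.
    + intros V HV. apply tree_open_of_left. intros x Vx Hx.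
      now apply left_cont_nbhd.
    + intros eps Heps J U HU Hcov.
      destruct (Hv eps Heps) as [L HL].
      assert (HLc : exists l : list J, forall x z, In z L -> eps <= Rabs (f x) ->
                 le x z -> exists j, In j l /\ U j x).
      { clear HL. induction L as [| z L [l Hl]].
        - exists []; intros x z [].
        - destruct (initial_cover f eps J U Hc HU Hcov z) as [l' Hl'].
          exists (l' ++ l). intros x z' [<- | Hz] Hx Hxz.
          + destruct (Hl' x Hx Hxz) as (j & ? & ?). exists j; split; auto.
            apply in_or_app; auto.
          + destruct (Hl x z' Hz Hx Hxz) as (j & ? & ?). exists j; split; auto.
            apply in_or_app; auto. }
      destruct HLc as [l Hl]. exists l; intros x Hx.
      destruct (HL x Hx) as (z & Hz1 & Hz2). eauto.
Qed.

Lemma C0_approx f :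
  (forall eps, 0 < eps -> exists g, C0 T le g /\ forall x, Rabs (f x - g x) <= eps) ->
  C0 T le f.
Proof.
  intros H. apply C0_iff; split.
  - intros x Hx eps Heps.
    destruct (H (eps / 3)) as (g & Hg & Hfg); [lra |].
    apply C0_iff in Hg as [Hg _].
    destruct (Hg x Hx (eps / 3)) as (y0 & Hy0 & H0); [lra |].
    exists y0; split; auto. intros y H1 H2. specialize (H0 y H1 H2).
    assert (Hfx := Hfg x); assert (Hfy := Hfg y).
    revert H0 Hfx Hfy; abs_lra.
  - intros eps Heps.
    destruct (H (eps / 2)) as (g & Hg & Hfg); [lra |].
    apply C0_iff in Hg as [_ Hg].
    destruct (Hg (eps / 2)) as [L HL]; [lra |].
    exists L; intros x Hx; apply HL. specialize (Hfg x).
    revert Hx Hfg; abs_lra.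
Qed.

Lemma C0_lin a b f g : C0 T le f -> C0 T le g -> C0 T le (fun x => a * f x + b * g x).
Proof.
  intros Hf Hg. apply C0_iff in Hf as [Hf1 Hf2]; apply C0_iff in Hg as [Hg1 Hg2].
  set (M := Rabs a + Rabs b + 1).
  assert (HM : 0 < M) by (unfold M; generalize (Rabs_pos a) (Rabs_pos b); lra).
  assert (Hsmall : forall d u v, Rabs u <= d -> Rabs v <= d -> Rabs (a * u + b * v) <= M * d)
    by (intros; now apply lin_bound).
  apply C0_iff; split.
  - intros x Hx eps Heps.
    assert (Hd : 0 < eps / M) by now apply Rdiv_lt_0_compat.
    destruct (Hf1 x Hx _ Hd) as (y1 & Hy1 & H1).
    destruct (Hg1 x Hx _ Hd) as (y2 & Hy2 & H2).
    destruct (lt_max x y1 y2) as (y0 & Hy0 & Hy01 & Hy02); auto.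
    exists y0; split; auto. intros y Hy Hyx.
    replace (a * f x + b * g x - (a * f y + b * g y))
      with (a * (f x - f y) + b * (g x - g y)) by ring.
    replace eps with (M * (eps / M)) by (field; lra).
    apply Hsmall; [apply H1 | apply H2]; auto; eapply tle_trans; eauto.
  - intros eps Heps.
    assert (Hd : 0 < eps / (2 * M)) by (apply Rdiv_lt_0_compat; lra).
    destruct (Hf2 _ Hd) as (L1 & H1).
    destruct (Hg2 _ Hd) as (L2 & H2).
    exists (L1 ++ L2). intros x Hx.
    destruct (Rle_or_lt (eps / (2 * M)) (Rabs (f x))) as [H | H].
    { destruct (H1 x H) as (z & ? & ?). exists z; split; auto. apply in_or_app; auto. }
    destruct (Rle_or_lt (eps / (2 * M)) (Rabs (g x))) as [H' | H'].
    { destruct (H2 x H') as (z & ? & ?). exists z; split; auto. apply in_or_app; auto. }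
    exfalso. assert (Hs := Hsmall (eps / (2 * M)) (f x) (g x) ltac:(lra) ltac:(lra)).
    replace (M * (eps / (2 * M))) with (eps / 2) in Hs by (field; lra). lra.
Qed.

Lemma C0_plus f g : C0 T le f -> C0 T le g -> C0 T le (fun x => f x + g x).
Proof.
  intros Hf Hg.
  replace (fun x => f x + g x) with (fun x => 1 * f x + 1 * g x) by fun_ring.
  now apply C0_lin.
Qed.

Lemma C0_scal c f : C0 T le f -> C0 T le (fun x => c * f x).
Proof.
  intros Hf.
  replace (fun x => c * f x) with (fun x => c * f x + 0 * f x) by fun_ring.
  now apply C0_lin.
Qed.

Lemma C0_minus f g : C0 T le f -> C0 T le g -> C0 T le (fun x => f x - g x).
Proof.
  intros Hf Hg.
  replace (fun x => f x - g x) with (fun x => 1 * f x + (-1) * g x) by fun_ring.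
  now apply C0_lin.
Qed.

Definition ind (t x : T) : R := if excluded_middle_informative (le x t) then 1 else 0.

Lemma ind_in t x : le x t -> ind t x = 1.
Proof. intros H; unfold ind; destruct excluded_middle_informative; tauto. Qed.

Lemma ind_out t x : ~ le x t -> ind t x = 0.
Proof. intros H; unfold ind; destruct excluded_middle_informative; tauto. Qed.

Lemma C0_ind t : C0 T le (ind t).
Proof.
  apply C0_iff; split.
  - intros x Hx eps Heps. destruct (limit_not_le_list x [t] Hx) as (y0 & Hy0 & H0).
    exists y0; split; auto. intros y H1 H2.
    assert (E : ind t x = ind t y); [| rewrite E, Rminus_eq_0, Rabs_R0; lra].
    destruct (classic (le x t)) as [Hxt | Hxt].
    + rewrite !ind_in; auto. now apply tle_trans with x.
    + rewrite !ind_out; auto. apply H0; simpl; auto.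
  - intros eps Heps. exists [t]; intros x Hx. exists t; simpl; split; auto.
    apply NNPP; intros Hn. rewrite ind_out, Rabs_R0 in Hx; auto; lra.
Qed.

Lemma C0_zero : C0 T le (fun _ => 0).
Proof.
  apply C0_iff; split.
  - intros x [[s Hs] _] eps Heps. exists s; split; auto.
    intros; rewrite Rminus_eq_0, Rabs_R0; lra.
  - intros eps Heps. exists []; intros x; rewrite Rabs_R0; lra.
Qed.

(** * Approximation by step functions *)

(* Induction from the tops of the tree downwards, as for a compact set covered by the chains
   below the members of [L]: the base cases are the points below no member of [L]. *)
Lemma compact_induction (P : T -> Prop) (L : list T) :
  (forall t, (forall u, succ t u -> P u) -> P t) ->
  (forall x, limit x -> P x -> exists y0, lt y0 x /\ forall y, le y0 y -> lt y x -> P y) ->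
  forall t, (forall v, le t v -> (forall z, In z L -> ~ le v z) -> P v) -> P t.
Proof.
  intros Hstep Hlim. induction L as [| z L IH]; intros t Hbase.
  - apply Hbase; auto using tle_refl.
  - assert (Hout : forall v, le t v -> ~ le v z -> P v).
    { intros v Htv Hvz. apply IH. intros w Hvw Hw. apply Hbase.
      - now apply tle_trans with v.
      - intros z' [<- | Hz']; auto. intros Hwz; apply Hvz; now apply tle_trans with w. }
    destruct (classic (le t z)) as [Htz | Htz].
    2: { apply Hout; auto using tle_refl. }
    assert (Pz : P z).
    { apply Hstep. intros u Hu. apply succ_lt in Hu. apply Hout.
      - apply tle_trans with z; auto using lt_le.
      - intros Hn. now apply (le_not_lt u z). }
    destruct (least (fun y => le t y /\ P y) z (conj Htz Pz)) as (m & [Hm1 Hm2] & Hm3 & Hm4).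
    destruct (le_cases _ _ Hm1) as [-> | Htm]; auto. exfalso.
    destruct (rank_cases m) as [Hmin | [[s Hs] | Hl]].
    + now apply (Hmin t).
    + assert (Hts : le t s) by now apply (succ_le_lt s m).
      apply (Hm4 s); [now apply succ_lt |]. split; auto.
      apply Hstep. intros u Hu. destruct (classic (le u z)) as [Huz | Huz].
      * now rewrite (succ_comparable s u m z).
      * apply Hout; auto. apply tle_trans with s; auto. now apply lt_le, succ_lt.
    + destruct (Hlim m Hl Hm2) as (y0 & Hy0 & H0).
      destruct (lt_max m y0 t) as (w & Hw & Hw0 & Hw1); auto.
      apply (Hm4 w); auto.
Qed.

Definition stepf (l : list (R * T)) (x : T) : R := lsum l (fun p => fst p * ind (snd p) x).

Lemma stepf_cons c e l x : stepf ((c, e) :: l) x = c * ind e x + stepf l x.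
Proof. reflexivity. Qed.

Lemma stepf_app l l' x : stepf (l ++ l') x = stepf l x + stepf l' x.
Proof.
  induction l as [| [c e] l IH]; [unfold stepf at 2; simpl; unfold lsum; simpl; ring |].
  simpl app. rewrite !stepf_cons, IH. ring.
Qed.

Lemma stepf_zero l x : (forall p, In p l -> ~ le x (snd p)) -> stepf l x = 0.
Proof.
  induction l as [| [c e] l IH]; intros H; [reflexivity |].
  rewrite stepf_cons, IH, ind_out; [ring | |].
  - apply (H (c, e)); left; auto.
  - intros p Hp; apply H; right; auto.
Qed.

Lemma stepf_eq l x y : (forall p, In p l -> le x (snd p) <-> le y (snd p)) ->
  stepf l x = stepf l y.
Proof.
  induction l as [| [c e] l IH]; intros H; [reflexivity |].
  rewrite !stepf_cons, IH by (intros p Hp; apply H; right; auto).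
  assert (He := H (c, e) (or_introl eq_refl)). simpl in He.
  destruct (classic (le x e)); [rewrite !ind_in | rewrite !ind_out]; tauto.
Qed.

Section Steps.
Variable f : T -> R.
Variable E : T -> Prop.
Hypothesis f_C0 : C0 T le f.
(* Away from [E], [f] does not jump: it passes its value to one successor at most. *)
Hypothesis f_no_jump : forall t, ~ E t ->
  (forall v, le t v -> f v = 0) \/
  exists u, succ t u /\ f u = f t /\ forall v, lt t v -> ~ le u v -> f v = 0.
Variable eps : R.
Hypothesis eps_pos : 0 < eps.

Definition steps_above (t : T) (l : list (R * T)) : Prop :=
  (forall p, In p l -> E (snd p) /\ le t (snd p)) /\
  forall v, le t v -> Rabs (f v - stepf l v) <= eps.

Definition small_above (t : T) : Prop := forall v, le t v -> Rabs (f v) < eps.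

(** Exactness at [t] lets the same steps serve below [t]: their ends lie above [t], so the step
    function keeps the value [f t] at every point below. *)
Definition stepped (t : T) : Prop :=
  small_above t \/ exists l, steps_above t l /\ stepf l t = f t.

(** The nonzero value at [v] forces the one successor inheriting the value to lie on the path to
    [z]; limit points are passed by continuity. *)
Lemma constant_below y z v : (forall w, le y w -> lt w z -> ~ E w) -> le z v -> f v <> 0 ->
  forall w, le y w -> le w z -> f w = f y.
Proof.
  intros HE Hzv Hfv w0 H1 H2. apply NNPP; intros Hne.
  destruct (least (fun w => le y w /\ le w z /\ f w <> f y) w0) as (w & (A & B & C) & _ & Hmin);
    auto.
  assert (Hb : forall s, le y s -> lt s w -> f s = f y).
  { intros s Hs1 Hs2. apply NNPP; intros Hn. apply (Hmin s Hs2). repeat split; auto.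
    apply tle_trans with w; auto using lt_le. }
  destruct (le_cases _ _ A) as [-> | Hyw]; [now apply C |].
  destruct (rank_cases w) as [Hm | [[s Hs] | Hl]].
  - now apply (Hm y).
  - assert (Hys : le y s) by now apply (succ_le_lt s w).
    assert (Hsz : lt s z) by (apply lt_le_trans with w; auto using succ_lt).
    apply C. rewrite <- (Hb s); auto using succ_lt.
    destruct (f_no_jump s) as [H0 | (u & Hu1 & Hu2 & Hu3)]; auto.
    + rewrite !H0; auto using tle_refl. now apply lt_le, succ_lt.
    + destruct (classic (le u v)) as [Huv | Huv].
      * rewrite (succ_comparable s w u v); auto. now apply tle_trans with z.
      * exfalso; apply Hfv. apply Hu3; auto. now apply lt_le_trans with z.
  - apply C. apply C0_iff in f_C0 as [Hc _].
    assert (Hd : forall d, 0 < d -> Rabs (f w - f y) <= d).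
    { intros d Hd. destruct (Hc w Hl d Hd) as (y0 & Hy0 & H0).
      destruct (lt_max w y0 y) as (s & Hs & Hs0 & Hs1); auto.
      rewrite <- (Hb s); auto. apply H0; auto using lt_le. }
    apply NNPP; intros Hne'. assert (Hp : 0 < Rabs (f w - f y)) by (apply Rabs_pos_lt; lra).
    specialize (Hd (Rabs (f w - f y) / 2)). lra.
Qed.

(** The cones above the members of [U] are disjoint, and steps ending in one cone vanish on the
    others, so the lists can be concatenated. *)
Lemma steps_combine (U : list T) :
  NoDup U -> (forall u u' x, In u U -> In u' U -> le u x -> le u' x -> u = u') ->
  (forall u, In u U -> exists l, steps_above u l) ->
  exists l, (forall p, In p l -> E (snd p) /\ exists u, In u U /\ le u (snd p)) /\
    forall u v, In u U -> le u v -> Rabs (f v - stepf l v) <= eps.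
Proof.
  induction U as [| u U IH]; intros Hnd Hdis Hl.
  - exists []; split; [intros p [] | intros u v []].
  - inversion Hnd; subst.
    destruct IH as (l' & A & B); auto.
    { intros; eapply Hdis; eauto; right; auto. }
    { intros; apply Hl; right; auto. }
    destruct (Hl u (or_introl eq_refl)) as (l & C & D).
    exists (l ++ l'); split.
    + intros p Hp. apply in_app_or in Hp as [Hp | Hp].
      * destruct (C p Hp); split; auto. exists u; split; auto; left; auto.
      * destruct (A p Hp) as (? & w & ? & ?); split; auto. exists w; split; auto; right; auto.
    + intros w v [<- | Hw] Hv; rewrite stepf_app.
      * rewrite (stepf_zero l'), Rplus_0_r; auto.
        intros p Hp Hvp. destruct (A p Hp) as (_ & w & Hw & Hwp).
        assert (Euw : u = w); [| subst; contradiction].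
        apply (Hdis u w (snd p)); auto; [left | right |]; auto. now apply tle_trans with v.
      * rewrite (stepf_zero l), Rplus_0_l; auto. { now apply (B w). }
        intros p Hp Hvp. destruct (C p Hp) as (_ & Hup).
        assert (Euw : u = w); [| subst; contradiction].
        apply (Hdis u w (snd p)); auto; [left | right |]; auto. now apply tle_trans with v.
Qed.

Lemma large_finite L (P : T -> Prop) :
  (forall x, eps <= Rabs (f x) -> exists z, In z L /\ le x z) ->
  (forall u u' z, P u -> P u' -> le u z -> le u' z -> u = u') ->
  (forall u, P u -> ~ small_above u) ->
  exists U, NoDup U /\ forall u, In u U <-> P u.
Proof.
  intros HL Hdis Hns.
  destruct (finite_of_cover le L P) as [U HU]; auto.
  - intros u Pu. apply NNPP; intros Hn. apply (Hns u Pu). intros v Hv.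
    apply Rnot_le_lt; intros Hlarge. destruct (HL v Hlarge) as (z & Hz & Hvz).
    apply Hn; exists z; split; auto. now apply tle_trans with v.
  - destruct (canon_spec U) as [H1 H2]. exists (canon U); split; auto.
    intros u; now rewrite H2.
Qed.

Lemma stepped_succ L t :
  (forall x, eps <= Rabs (f x) -> exists z, In z L /\ le x z) ->
  (forall u, succ t u -> stepped u) -> stepped t.
Proof.
  intros HL Hs. destruct (classic (E t)) as [Et | Et].
  - destruct (large_finite L (fun u => succ t u /\ ~ small_above u)) as (U & HU1 & HU2); auto.
    { intros u u' z [H1 _] [H2 _]. now apply succ_comparable with t. }
    { tauto. }
    destruct (steps_combine U) as (l & A & B); auto.
    { intros u u' x Hu Hu'. apply HU2 in Hu as [H1 _]. apply HU2 in Hu' as [H2 _].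
      now apply succ_comparable with t. }
    { intros u Hu. apply HU2 in Hu as [H1 H2].
      destruct (Hs u H1) as [H | (l & H & _)]; [contradiction | now exists l]. }
    (* The steps of the successors add up to some value at [t]. The new step corrects it to [f t]
       and vanishes strictly above [t]. *)
    right; exists ((f t - stepf l t, t) :: l). split; [split |].
    + intros p [<- | Hp]; simpl; auto using tle_refl.
      destruct (A p Hp) as (H1 & u & Hu & Hup); split; auto.
      apply tle_trans with u; auto. apply HU2 in Hu as [Hu _]. now apply lt_le, succ_lt.
    + intros v Hv. rewrite stepf_cons.
      destruct (le_cases _ _ Hv) as [<- | Hv'].
      * rewrite ind_in by apply tle_refl.
        replace (f t - _) with 0 by ring. rewrite Rabs_R0; lra.
      * rewrite ind_out by (intros H; now apply (le_not_lt v t)).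
        rewrite Rmult_0_r, Rplus_0_l.
        destruct (succ_exists t v Hv') as (u & Hu & Huv).
        destruct (classic (small_above u)) as [Hsm | Hsm].
        -- rewrite stepf_zero, Rminus_0_r; [left; now apply Hsm |].
           intros p Hp Hvp. destruct (A p Hp) as (_ & w & Hw & Hwp).
           apply HU2 in Hw as [Hw1 Hw2]. apply Hw2.
           rewrite (succ_comparable t w u (snd p)); auto. now apply tle_trans with v.
        -- apply (B u); auto. apply HU2; auto.
    + rewrite stepf_cons, ind_in by apply tle_refl. ring.
  - destruct (f_no_jump t Et) as [H0 | (u & Hu1 & Hu2 & Hu3)].
    { left. intros v Hv. rewrite H0, Rabs_R0; auto. }
    assert (Hz : forall v, le t v -> v <> t -> ~ le u v -> f v = 0).
    { intros v H1 H2 H3. apply Hu3; auto. split; auto. }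
    destruct (Hs u Hu1) as [Hsm | (l & [A B] & C)].
    + left. intros v Hv. destruct (classic (v = t)) as [-> | Hn].
      * rewrite <- Hu2. apply Hsm, tle_refl.
      * destruct (classic (le u v)) as [Huv | Huv]; auto.
        rewrite Hz, Rabs_R0; auto.
    + assert (Ht : stepf l t = f t).
      { rewrite <- Hu2, <- C. apply stepf_eq. intros p Hp.
        destruct (A p Hp) as [_ H]. split; auto. intros _.
        apply tle_trans with u; auto. now apply lt_le, succ_lt. }
      right; exists l. split; [split |]; auto.
      * intros p Hp. destruct (A p Hp); split; auto.
        apply tle_trans with u; auto. now apply lt_le, succ_lt.
      * intros v Hv. destruct (classic (v = t)) as [-> | Hn].
        { rewrite Ht, Rminus_eq_0, Rabs_R0; lra. }
        destruct (classic (le u v)) as [Huv | Huv]; auto.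
        rewrite Hz, stepf_zero, Rminus_0_r, Rabs_R0; auto; try lra.
        intros p Hp Hvp. destruct (A p Hp) as [_ Hup].
        destruct (comparable u v (snd p)) as [? | Hvu]; auto.
        apply Huv. rewrite (succ_le_ge t u v); auto using tle_refl. split; auto.
Qed.

Lemma stepped_limit L x :
  (forall x, eps <= Rabs (f x) -> exists z, In z L /\ le x z) ->
  limit x -> stepped x ->
  exists y0, lt y0 x /\ forall y, le y0 y -> lt y x -> stepped y.
Proof.
  intros HL Hx Hst.
  destruct (limit_not_le_list x L Hx) as (y1 & Hy1 & H1).
  (* Past [y1] no member of [L] lies above a branch leaving the path to [x], so [f] is small on
     those branches. *)
  assert (Hside : forall v, le y1 v -> ~ le x v -> ~ le v x -> Rabs (f v) < eps).
  { intros v Hv Hxv Hvx. apply Rnot_le_lt; intros Hlarge.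
    destruct (HL v Hlarge) as (z & Hz & Hvz).
    destruct (classic (le x z)) as [Hxz | Hxz].
    - destruct (comparable x v z); auto.
    - now apply (H1 v z). }
  assert (Hc := f_C0). apply C0_iff in Hc as [Hc _].
  destruct (classic (small_above x)) as [Hsm | Hsm].
  - assert (Hfx := Hsm x (tle_refl x)).
    destruct (Hc x Hx ((eps - Rabs (f x)) / 2)) as (y2 & Hy2 & H2); [lra |].
    destruct (lt_max x y1 y2) as (y0 & Hy0 & H01 & H02); auto.
    exists y0; split; auto. intros y Hy Hyx. left. intros v Hv.
    destruct (classic (le x v)) as [Hxv | Hxv]; auto.
    destruct (classic (le v x)) as [Hvx | Hvx].
    + assert (H := H2 v ltac:(eauto using tle_trans) Hvx).
      revert H Hfx; abs_lra.
    + apply Hside; auto. eauto using tle_trans.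
  - destruct Hst as [H | (l & [A B] & C)]; [contradiction |].
    assert (Hlarge : exists v, le x v /\ f v <> 0).
    { apply NNPP; intros Hn; apply Hsm. intros v Hv.
      destruct (Req_dec (f v) 0) as [-> | Hf]; [rewrite Rabs_R0; auto |].
      exfalso; apply Hn; now exists v. }
    destruct Hlarge as (v0 & Hv0 & Hfv0).
    destruct (Hc x Hx eps eps_pos) as (y2 & Hy2 & H2).
    destruct (lt_max x y1 y2) as (y0 & Hy0 & H01 & H02); auto.
    exists y0; split; auto. intros y Hy Hyx. right.
    assert (Hg : forall v, le v x -> stepf l v = f x).
    { intros v Hv. rewrite <- C. apply stepf_eq. intros p Hp. destruct (A p Hp) as [_ H].
      split; auto. intros _; now apply tle_trans with x. }
    assert (Hg0 : forall v, ~ le x v -> ~ le v x -> stepf l v = 0).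
    { intros v Hxv Hvx. apply stepf_zero. intros p Hp Hvp. destruct (A p Hp) as [_ H].
      destruct (comparable x v (snd p)); auto. }
    assert (Hl : forall p, In p l -> E (snd p) /\ le y (snd p)).
    { intros p Hp. destruct (A p Hp); split; auto.
      apply tle_trans with x; auto using lt_le. }
    (* Steps may end only in [E]. If [E] meets the interval from [y] to [x], the change from [f x]
       to [f y] is made at its least such point [y']: up to [y'] the function is constant, and
       beyond it within [eps] of [f x]. Otherwise [f] is constant on the interval and no step is
       added. *)
    destruct (classic (exists e, E e /\ le y e /\ lt e x)) as [(e & He) | Hn].
    + destruct (least (fun e => E e /\ le y e /\ lt e x) e He)
        as (y' & (Ey' & Hyy' & Hy'x) & _ & Hmin).
      assert (Hconst : forall w, le y w -> le w y' -> f w = f y).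
      { apply (constant_below y y' v0); auto.
        - intros w Hw1 Hw2 Ew. apply (Hmin w Hw2). split; [| split]; auto.
          apply (lt_le_trans w y' x); auto using lt_le.
        - apply tle_trans with x; auto using lt_le. }
      exists ((f y' - f x, y') :: l). split; [split |].
      * intros p [<- | Hp]; simpl; auto.
      * intros v Hv. rewrite stepf_cons.
        destruct (classic (le v x)) as [Hvx | Hvx].
        -- rewrite Hg by auto. destruct (classic (le v y')) as [Hvy | Hvy].
           ++ rewrite ind_in, (Hconst v), (Hconst y') by auto using tle_refl.
              replace (f y - _) with 0 by ring. rewrite Rabs_R0; lra.
           ++ rewrite ind_out by auto. rewrite Rmult_0_r, Rplus_0_l, Rabs_minus_sym.
              apply H2; auto. eauto using tle_trans.
        -- rewrite ind_out, Rmult_0_r, Rplus_0_l.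
           2: { intros H; apply Hvx; apply tle_trans with y'; auto using lt_le. }
           destruct (classic (le x v)) as [Hxv | Hxv]; auto.
           rewrite Hg0, Rminus_0_r; auto. left. apply Hside; auto. eauto using tle_trans.
      * rewrite stepf_cons, ind_in, Hg by auto using lt_le.
        rewrite (Hconst y') by auto using tle_refl. ring.
    + assert (Hconst : forall w, le y w -> le w x -> f w = f y).
      { apply (constant_below y x v0); auto.
        intros w Hw1 Hw2 Ew. apply Hn; now exists w. }
      exists l. split; [split |]; auto.
      * intros v Hv. destruct (classic (le v x)) as [Hvx | Hvx].
        -- rewrite Hg by auto. rewrite (Hconst v), (Hconst x), Rminus_eq_0, Rabs_R0
             by auto using tle_refl, lt_le. lra.
        -- destruct (classic (le x v)) as [Hxv | Hxv]; auto.
           rewrite Hg0, Rminus_0_r; auto. left. apply Hside; auto. eauto using tle_trans.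
      * rewrite Hg by auto using lt_le. apply Hconst; auto using lt_le, tle_refl.
Qed.

Lemma step_approximation :
  exists l, (forall p, In p l -> E (snd p)) /\ forall x, Rabs (f x - stepf l x) <= eps.
Proof.
  assert (Hv := f_C0). apply C0_iff in Hv as [_ Hv]. destruct (Hv eps eps_pos) as [L HL].
  assert (Hall : forall t, stepped t).
  { intros t. apply (compact_induction stepped L).
    - intros s. now apply stepped_succ with L.
    - intros x. now apply stepped_limit with L.
    - intros v _ Hv'. left. intros w Hw. apply Rnot_le_lt; intros H.
      destruct (HL w H) as (z & Hz & Hwz). apply (Hv' z Hz). now apply tle_trans with w. }
  set (minimal := fun r => forall s, ~ lt s r).
  assert (Hmin : forall r r' x, minimal r -> minimal r' -> le r x -> le r' x -> r = r').
  { intros r r' x Hr Hr' H1 H2. destruct (comparable r r' x H1 H2) as [H | H];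
      destruct (le_cases _ _ H) as [? | H']; auto; exfalso; [eapply Hr' | eapply Hr]; eauto. }
  destruct (large_finite L (fun r => minimal r /\ ~ small_above r)) as (U & HU1 & HU2); auto.
  { intros u u' z [H1 _] [H2 _]. now apply Hmin. }
  { tauto. }
  destruct (steps_combine U) as (l & A & B); auto.
  { intros u u' x Hu Hu'. apply HU2 in Hu as [H1 _]. apply HU2 in Hu' as [H2 _].
    now apply Hmin. }
  { intros u Hu. apply HU2 in Hu as [_ H2].
    destruct (Hall u) as [H | (l & H & _)]; [contradiction | now exists l]. }
  exists l; split; [intros p Hp; apply (A p Hp) |].
  intros x. destruct (least (fun _ => True) x Logic.I) as (r & _ & Hrx & Hr).
  assert (Hmr : minimal r) by (intros s Hs; now apply (Hr s Hs)).
  destruct (classic (small_above r)) as [Hsm | Hsm].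
  - rewrite stepf_zero, Rminus_0_r; [left; now apply Hsm |].
    intros p Hp Hxp. destruct (A p Hp) as (_ & w & Hw & Hwp).
    apply HU2 in Hw as [Hw1 Hw2]. apply Hw2.
    rewrite (Hmin w r (snd p)); auto. now apply tle_trans with x.
  - apply (B r); auto. apply HU2; auto.
Qed.
End Steps.

(** A step function is bounded and lies within 1 of [f]. The slack in [M - 1] makes [M] also bound
    approximations of [f] within 1. *)
Lemma C0_bounded f : C0 T le f -> exists M, 1 <= M /\ forall x, Rabs (f x) <= M - 1.
Proof.
  intros Hf.
  destruct (step_approximation f (fun _ => True) Hf ltac:(tauto) 1 Rlt_0_1) as (l & _ & Hl).
  assert (HM : exists M, forall x, Rabs (stepf l x) <= M).
  { clear Hl. induction l as [| [c e] l [M HM]].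
    - exists 0; intros x. unfold stepf, lsum; simpl. rewrite Rabs_R0; lra.
    - exists (Rabs c + M). intros x. rewrite stepf_cons.
      eapply Rle_trans; [apply Rabs_triang | apply Rplus_le_compat; auto].
      rewrite Rabs_mult, <- (Rmult_1_r (Rabs c)).
      rewrite Rmult_1_r at 1. apply Rmult_le_compat_l; [apply Rabs_pos |].
      unfold ind; destruct excluded_middle_informative; rewrite Rabs_pos_eq; lra. }
  destruct HM as [M HM]. exists (Rmax 0 M + 2). split; [generalize (Rmax_l 0 M); lra |].
  intros x. specialize (Hl x). specialize (HM x). assert (H := Rmax_r 0 M).
  revert Hl HM; abs_lra.
Qed.

Lemma C0_le_supn f x : C0 T le f -> Rabs (f x) <= supn f.
Proof. intros Hf; destruct (C0_bounded f Hf) as (M & _ & HM). now apply supn_ub with (M - 1). Qed.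

(** * Strict convexity *)

Lemma strictly_convex_of_midpoint N : is_norm_on (C0 T le) N ->
  (forall m h, C0 T le m -> C0 T le h ->
     N (fun x => m x + h x) = N m -> N (fun x => m x - h x) = N m -> forall x, h x = 0) ->
  strictly_convex_on (C0 T le) N.
Proof.
  intros (_ & _ & Hscal & _) Hmh f g Hf Hg Hfg Hmid x.
  set (m := fun x => / 2 * f x + / 2 * g x).
  set (h := fun x => / 2 * f x + - / 2 * g x).
  assert (Em : N m = N f).
  { rewrite Hmid. unfold m.
    replace (fun x => / 2 * f x + / 2 * g x) with (fun x => / 2 * (f x + g x)) by fun_ring.
    rewrite (Hscal (fun x => f x + g x)), Rabs_pos_eq; [auto | lra | now apply C0_plus]. }
  assert (E1 : (fun x => m x + h x) = f)
    by (apply functional_extensionality; intros; unfold m, h; field).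
  assert (E2 : (fun x => m x - h x) = g)
    by (apply functional_extensionality; intros; unfold m, h; field).
  assert (Hx : h x = 0).
  { apply (Hmh m h); [now apply C0_lin | now apply C0_lin | |]; congruence. }
  unfold h in Hx. lra.
Qed.

Lemma strictly_convex_of_MLUR N : equiv_norm_on (C0 T le) N -> MLUR_on (C0 T le) N ->
  strictly_convex_on (C0 T le) N.
Proof.
  intros [HN _] Hm. apply strictly_convex_of_midpoint; auto.
  intros m h Cm Ch Hp Hq. destruct HN as (_ & Hdef & _). apply Hdef; auto.
  assert (Hcst : forall u l, u = l -> Un_cv (fun _ => u) l).
  { intros u l -> eps Heps. exists 0%nat; intros. unfold Rdist.
    rewrite Rminus_eq_0, Rabs_R0; auto. }
  assert (H := Hm m (fun _ => h) Cm (fun _ => Ch) (Hcst _ _ Hp) (Hcst _ _ Hq)).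
  apply tends0_Un_cv in H. apply (proj1 (tends0_const _)) in H. lra.
Qed.

(** The renorming is applied to the squared coordinates of [S], with [psi = 0]. *)
Lemma strictly_convex_of_injection (I : Type) (S : (T -> R) -> I -> R) :
  bounded_linear_injection (C0 T le) (@c0 I) S ->
  exists N, equiv_norm_on (C0 T le) N /\ strictly_convex_on (C0 T le) N.
Proof.
  intros (Hc0 & Hplus & Hscal & [K HK] & Hinj).
  assert (Hub : forall f i, C0 T le f -> Rabs (S f i) <= supn (S f)).
  { intros f i Hf. destruct (Hc0 f Hf 1 Rlt_0_1) as [l Hl].
    assert (HM : exists M, 1 <= M /\ forall j, In j l -> Rabs (S f j) <= M).
    { clear Hl. induction l as [| j l (M & H1 & H2)].
      - exists 1; split; [lra | intros j []].
      - exists (Rmax M (Rabs (S f j))). split; [eapply Rle_trans; [apply H1 | apply Rmax_l] |].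
        intros j' [<- | Hj']; [apply Rmax_r |].
        eapply Rle_trans; [now apply H2 | apply Rmax_l]. }
    destruct HM as (M & H1 & H2). apply supn_ub with M. intros j.
    destruct (Rle_or_lt 1 (Rabs (S f j))) as [H | H]; [auto | lra]. }
  assert (HtK : forall i, qbd T (C0 T le) (K ^ 2) (fun f => S f i ^ 2)).
  { intros i f Hf. replace (K ^ 2 * supn f ^ 2) with ((K * supn f) ^ 2) by ring.
    apply sq_le_of_abs. eapply Rle_trans; [now apply Hub | now apply HK]. }
  destruct (renorming T (C0 T le) C0_plus (fun c g Hg => C0_scal c g Hg)
    (fun g x Hg => C0_le_supn g x Hg) I (fun i f => S f i ^ 2) (fun _ _ _ => 0) (K ^ 2)
    (pow2_ge_0 K)) as (N & HN & Hdef & _); auto.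
  - intros i. apply (qsn_square T (C0 T le) (fun f => S f i)); auto.
  - intros f Hf eps Heps. destruct (Hc0 f Hf (Rmin 1 eps)) as [l Hl].
    { apply Rmin_pos; lra. }
    exists l. intros i Hi. apply Hl. rewrite <- pow2_abs in Hi.
    assert (H1 := Rmin_l 1 eps). assert (H2 := Rmin_r 1 eps).
    assert (H3 := Rabs_pos (S f i)). apply Rnot_lt_le; intros H4. nra.
  - intros; apply qsn_zero.
  - intros A B f Hf. apply Rmult_le_pos; apply pow2_ge_0.
  - exists N; split; auto. apply strictly_convex_of_midpoint; [apply HN |].
    intros m h Cm Ch Hp Hq.
    assert (Ei : forall f, C0 T le f -> forall i, S (fun x => 0 * f x) i = 0).
    { intros f Hf i. rewrite Hscal; auto; ring. }
    assert (H0 : forall x, h x = 0 * h x); [| intros x; rewrite H0; ring].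
    apply Hinj; auto using C0_scal. intros i. rewrite Ei by auto.
    apply NNPP; intros Hne.
    assert (Hpos : 0 < S h i ^ 2) by now apply pow2_gt_0.
    (* The defect of the squared coordinate is [2 * S h i ^ 2] while that of [N ^ 2] is 0, so half
       of the former as tolerance gives a contradiction. *)
    destruct (Hdef m i (S h i ^ 2) Cm Hpos) as (C & HC & H).
    specialize (H h Ch). unfold mid_defect in H.
    replace (fun x => m x - h x) with (fun x => m x + (-1) * h x) in * by fun_ring.
    rewrite Hp, Hq, Hplus, (Hplus m (fun x => -1 * h x)), (Hscal h (-1)) in H;
      auto using C0_scal.
    replace (N m ^ 2 + N m ^ 2 - 2 * N m ^ 2) with 0 in H by ring. nra.
Qed.

(** * The increasing function of a strictly convex norm *)

Lemma le_zero_of_halves r M : (forall k, r <= M * (/ 2) ^ k) -> r <= 0.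
Proof.
  intros H. apply Rnot_lt_le; intros Hr.
  assert (HM : 0 < M) by (specialize (H 0%nat); rewrite pow_O in H; lra).
  destruct (half_pow_small (r / M)) as [k Hk]; [now apply Rdiv_lt_0_compat |].
  specialize (Hk k (Nat.le_refl k)). specialize (H k).
  assert (E : M * (/ 2) ^ k < M * (r / M)) by now apply Rmult_lt_compat_l.
  replace (M * (r / M)) with r in E by (field; lra). lra.
Qed.

(** The intervals around [u k] whose radius is the sum of all remaining steps are nested. *)
Lemma halves_limit (u : nat -> R) :
  (forall k, Rabs (u (S k) - u k) <= (/ 2) ^ k) ->
  exists l, forall k, Rabs (u k - l) <= 2 * (/ 2) ^ k.
Proof.
  intros H.
  assert (Hv : forall k, u k - 2 * (/ 2) ^ k <= u (S k) - 2 * (/ 2) ^ S k).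
  { intros k; specialize (H k). apply Rabs_le_between in H. simpl. lra. }
  assert (Hw : forall k, u (S k) + 2 * (/ 2) ^ S k <= u k + 2 * (/ 2) ^ k).
  { intros k; specialize (H k). apply Rabs_le_between in H. simpl. lra. }
  assert (Hp : forall k, 0 < (/ 2) ^ k) by (intros; apply pow_lt; lra).
  assert (Hvd : forall k d, u k - 2 * (/ 2) ^ k <= u (d + k)%nat - 2 * (/ 2) ^ (d + k)).
  { intros k; induction d as [| d IH]; [simpl; lra |].
    eapply Rle_trans; [apply IH | apply Hv]. }
  assert (Hwd : forall k d, u (d + k)%nat + 2 * (/ 2) ^ (d + k) <= u k + 2 * (/ 2) ^ k).
  { intros k; induction d as [| d IH]; [simpl; lra |].
    eapply Rle_trans; [apply Hw | apply IH]. }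
  assert (Hvw : forall j k, u j - 2 * (/ 2) ^ j <= u k + 2 * (/ 2) ^ k).
  { intros j k. destruct (Nat.le_ge_cases j k) as [E | E].
    - specialize (Hvd j (k - j)%nat). rewrite Nat.sub_add in Hvd by auto.
      specialize (Hp k). lra.
    - specialize (Hwd k (j - k)%nat). rewrite Nat.sub_add in Hwd by auto.
      specialize (Hp j). lra. }
  destruct (completeness (fun r => exists k, r = u k - 2 * (/ 2) ^ k)) as [l [Hl1 Hl2]].
  - exists (u 0%nat + 2 * (/ 2) ^ 0). intros r [k ->]. apply Hvw.
  - exists (u 0%nat - 2 * (/ 2) ^ 0). now exists 0%nat.
  - exists l; intros k. apply Rabs_le_between'.
    assert (A := Hl1 _ (ex_intro _ k eq_refl)).
    assert (B : l <= u k + 2 * (/ 2) ^ k) by (apply Hl2; intros r [j ->]; apply Hvw).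
    lra.
Qed.

Section FromNorm.
Variable N : (T -> R) -> R.
Hypothesis N_norm : is_norm_on (C0 T le) N.
Variables a b : R.
Hypothesis a_pos : 0 < a.
Hypothesis b_pos : 0 < b.
Hypothesis N_equiv : forall f, C0 T le f -> a * supn f <= N f /\ N f <= b * supn f.
Hypothesis N_sc : strictly_convex_on (C0 T le) N.

Definition peaked (t : T) (f : T -> R) : Prop :=
  C0 T le f /\ (forall x, le x t -> f x = 1) /\
  (forall x, ~ le x t -> ~ le t x -> f x = 0).

Definition peak_norm (t : T) : R :=
  real (Glb_Rbar (fun r => exists f, peaked t f /\ r = N f)).

Lemma N_pos f : C0 T le f -> 0 <= N f.
Proof. destruct N_norm as (H & _); auto. Qed.

Lemma N_scal c f : C0 T le f -> N (fun x => c * f x) = Rabs c * N f.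
Proof. destruct N_norm as (_ & _ & H & _); auto. Qed.

Lemma N_triangle f g : C0 T le f -> C0 T le g -> N (fun x => f x + g x) <= N f + N g.
Proof. destruct N_norm as (_ & _ & _ & H); auto. Qed.

Lemma N_mean_le f g c : C0 T le f -> C0 T le g -> N f <= c -> N g <= c ->
  N (fun x => / 2 * f x + / 2 * g x) <= c.
Proof.
  intros Hf Hg H1 H2.
  eapply Rle_trans; [apply N_triangle; now apply C0_scal |].
  rewrite !N_scal, Rabs_pos_eq; auto; lra.
Qed.

Lemma N_le_bound f M : C0 T le f -> 0 <= M -> (forall x, Rabs (f x) <= M) -> N f <= b * M.
Proof.
  intros Hf HM H. destruct (N_equiv f Hf) as [_ H2].
  eapply Rle_trans; [apply H2 |]. apply Rmult_le_compat_l; [lra |]. now apply supn_lub.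
Qed.

Lemma bound_le_N f x : C0 T le f -> Rabs (f x) <= N f / a.
Proof.
  intros Hf. destruct (N_equiv f Hf) as [H1 _].
  assert (H := C0_le_supn f x Hf).
  apply Rmult_le_reg_l with a; auto. replace (a * (N f / a)) with (N f) by (field; lra).
  eapply Rle_trans; [| apply H1]. apply Rmult_le_compat_l; lra.
Qed.

Lemma peaked_ind t : peaked t (ind t).
Proof.
  split; [apply C0_ind | split]; intros; [now apply ind_in | now apply ind_out].
Qed.

Lemma peak_norm_le t f : peaked t f -> peak_norm t <= N f.
Proof.
  intros Hf. unfold peak_norm.
  destruct (Glb_Rbar_correct (fun r => exists f, peaked t f /\ r = N f)) as [H1 H2].
  assert (Hf1 := H1 (N f) (ex_intro _ f (conj Hf eq_refl))).
  assert (H0 := H2 (Finite 0)).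
  destruct (Glb_Rbar _); simpl in *; auto; try easy.
  exfalso; apply H0. intros r (g & Hg & ->). simpl. apply N_pos, Hg.
Qed.

Lemma peak_norm_approx t eps : 0 < eps -> exists f, peaked t f /\ N f < peak_norm t + eps.
Proof.
  intros Heps. apply NNPP; intros Hn.
  assert (Hlow : forall f, peaked t f -> peak_norm t + eps <= N f).
  { intros f Hf. apply Rnot_lt_le; intros H; apply Hn; now exists f. }
  assert (Hpos := peak_norm_le t _ (peaked_ind t)).
  unfold peak_norm in *.
  destruct (Glb_Rbar_correct (fun r => exists f, peaked t f /\ r = N f)) as [H1 H2].
  assert (Hf1 := H1 _ (ex_intro _ _ (conj (peaked_ind t) eq_refl))).
  specialize (H2 (Finite (real (Glb_Rbar (fun r => exists f, peaked t f /\ r = N f)) + eps))).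
  destruct (Glb_Rbar _) as [g | |]; simpl in *; auto; try easy.
  - assert (g + eps <= g); [| lra]. apply H2. intros r (f & Hf & ->). simpl; auto.
  - apply H2. intros r (f & Hf & ->). simpl; auto.
Qed.

Lemma peaked_below s t f : le s t -> peaked t f -> peaked s f.
Proof.
  intros Hst (H1 & H2 & H3). split; [auto | split].
  - intros x Hx. apply H2. now apply tle_trans with s.
  - intros x Hx1 Hx2. apply H3.
    + intros Hx. destruct (comparable x s t Hx Hst); contradiction.
    + intros Hx. apply Hx2. now apply tle_trans with t.
Qed.

Lemma peak_norm_increasing : tree_increasing T le peak_norm.
Proof.
  intros s t Hst. apply Rnot_lt_le; intros H.
  destruct (peak_norm_approx t (peak_norm s - peak_norm t)) as (f & Hf & Hlt); [lra |].
  assert (H' := peak_norm_le s f (peaked_below s t f Hst Hf)). lra.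
Qed.

Lemma peaked_mean t f g : peaked t f -> peaked t g -> peaked t (fun x => / 2 * f x + / 2 * g x).
Proof.
  intros (F1 & F2 & F3) (G1 & G2 & G3). split; [now apply C0_lin | split].
  - intros x Hx; rewrite F2, G2; auto; lra.
  - intros x Hx Hx'; rewrite F3, G3; auto; lra.
Qed.

Lemma peaked_unique s f g : peaked s f -> peaked s g ->
  N f <= peak_norm s -> N g <= peak_norm s -> forall x, f x = g x.
Proof.
  intros Hf Hg H1 H2.
  assert (E1 := peak_norm_le s f Hf). assert (E2 := peak_norm_le s g Hg).
  assert (E3 := peak_norm_le s _ (peaked_mean s f g Hf Hg)).
  assert (E4 : N (fun x => / 2 * f x + / 2 * g x) = / 2 * N (fun x => f x + g x)).
  { replace (fun x => / 2 * f x + / 2 * g x) with (fun x => / 2 * (f x + g x)) by fun_ring.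
    rewrite N_scal, Rabs_pos_eq; [auto | lra |]. apply C0_plus; [apply Hf | apply Hg]. }
  assert (E5 := N_mean_le f g (peak_norm s) (proj1 Hf) (proj1 Hg) H1 H2).
  apply N_sc; [apply Hf | apply Hg | lra | lra].
Qed.

(** At a bad point no finite set exhausts the successors of almost the same level; this supplies as
    many distinct ones as wanted. *)
Lemma bad_succ rho t F eps : tree_bad T le rho t -> (forall u, In u F -> succ t u) ->
  0 < eps -> exists u, succ t u /\ ~ In u F /\ rho u < rho t + eps.
Proof.
  intros Hbad HF Heps. apply NNPP; intros Hn. apply Hbad. exists F; split; auto.
  destruct (Glb_Rbar_correct (fun y => exists u, succ t u /\ ~ In u F /\ y = rho u)) as [_ H2].
  specialize (H2 (Finite (rho t + eps))).
  apply Rbar_lt_le_trans with (Finite (rho t + eps)); [simpl; lra |].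
  apply H2. intros y (u & Hu1 & Hu2 & ->). simpl.
  apply Rnot_lt_le; intros H; apply Hn; now exists u.
Qed.

(** Near-optimal functions for [m] distinct successors add up to [m] times the indicator plus a
    remainder [H]. The summands of [H] live on disjoint cones, so [H] is bounded independently of
    [m] and disappears after division by [m]. *)
Lemma bad_ind_norm t : tree_bad T le peak_norm t -> N (ind t) <= peak_norm t.
Proof.
  intros Hbad.
  assert (Hr0 : 0 <= peak_norm t).
  { apply Rnot_lt_le; intros H.
    destruct (peak_norm_approx t (- peak_norm t)) as (f & Hf & Hlt); [lra |].
    assert (Hp := N_pos f (proj1 Hf)). lra. }
  apply Rnot_lt_le; intros Hlt.
  (* Half of the supposed excess. [C] below bounds pointwise every function of norm at most
     [peak_norm t + eps]. *)
  set (eps := (N (ind t) - peak_norm t) / 2). assert (Heps : 0 < eps) by (unfold eps; lra).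
  set (C := (peak_norm t + eps) / a).
  assert (HC : 0 < C) by (apply Rdiv_lt_0_compat; lra).
  assert (Hm : forall m, exists U H, (forall u, In u U -> succ t u) /\ C0 T le H /\
    (forall x, Rabs (H x) <= C) /\ (forall x, H x <> 0 -> exists u, In u U /\ le u x) /\
    N (fun x => INR m * ind t x + H x) <= INR m * (peak_norm t + eps)).
  { induction m as [| m (U & H & HU & HC0 & HHC & Hsupp & HN)].
    - exists [], (fun _ => 0). split; [intros u [] |]. split; [apply C0_zero |].
      split; [intros; rewrite Rabs_R0; lra |]. split; [intros x Hx; exfalso; now apply Hx |].
      simpl. replace (fun x => 0 * ind t x + 0) with (fun x : T => 0 * ind t x) by fun_ring.
      rewrite N_scal, Rabs_R0 by apply C0_ind. lra.
    - destruct (bad_succ peak_norm t U (eps / 2) Hbad HU) as (u & Hu & HuU & Hur); [lra |].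
      destruct (peak_norm_approx u (eps / 2)) as (f & Hf & Hfn); [lra |].
      assert (Hfs : forall x, f x - ind t x <> 0 -> le u x).
      { intros x Hx. apply NNPP; intros Hux. apply Hx.
        destruct (classic (le x u)) as [Hxu | Hxu].
        - destruct (le_cases _ _ Hxu) as [-> | Hlt']; [exfalso; apply Hux, tle_refl |].
          destruct Hf as (_ & F2 & _). rewrite F2, ind_in; auto; [lra |].
          now apply (succ_le_lt t u).
        - destruct Hf as (_ & _ & F3). rewrite F3, ind_out; auto; [lra |].
          intros Hxt. apply Hxu. apply tle_trans with t; auto. now apply lt_le, succ_lt. }
      exists (u :: U), (fun x => H x + (f x - ind t x)).
      refine (conj _ (conj _ (conj _ (conj _ _)))).
      + intros v [<- | Hv]; auto.
      + apply C0_plus; auto.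
        apply C0_minus; [apply Hf | apply C0_ind].
      + intros x. destruct (Req_dec (f x - ind t x) 0) as [E | E].
        * rewrite E, Rplus_0_r; auto.
        * assert (Hux := Hfs x E).
          assert (EH : H x = 0).
          { apply NNPP; intros Hx. destruct (Hsupp x Hx) as (v & Hv & Hvx).
            apply HuU. now rewrite (succ_comparable t u v x); auto. }
          assert (Ei : ind t x = 0).
          { apply ind_out; intros Hxt. apply (le_not_lt u t).
            - now apply tle_trans with x.
            - now apply succ_lt. }
          rewrite EH, Ei. replace (0 + (f x - 0)) with (f x) by ring.
          eapply Rle_trans; [apply bound_le_N, Hf |].
          unfold C, Rdiv. apply Rmult_le_compat_r; [left; now apply Rinv_0_lt_compat | lra].
      + intros x Hx. destruct (Req_dec (f x - ind t x) 0) as [E | E].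
        * rewrite E, Rplus_0_r in Hx. destruct (Hsupp x Hx) as (v & Hv & Hvx).
          exists v; simpl; auto.
        * exists u; simpl; auto.
      + rewrite S_INR.
        replace (fun x => (INR m + 1) * ind t x + (H x + (f x - ind t x)))
          with (fun x => (INR m * ind t x + H x) + f x) by fun_ring.
        eapply Rle_trans; [apply N_triangle |].
        * apply C0_plus; auto. apply C0_scal, C0_ind.
        * apply Hf.
        * lra. }
  assert (Hall : forall m, INR m * eps <= b * C).
  { intros m. destruct (Hm m) as (U & H & HU & HC0 & HHC & Hsupp & HN).
    assert (HNH := N_le_bound _ C (C0_scal (-1) H HC0) ltac:(lra)).
    assert (Hle : N (fun x => INR m * ind t x) <= INR m * (peak_norm t + eps) + b * C).
    { replace (fun x => INR m * ind t x)
        with (fun x => (INR m * ind t x + H x) + (-1) * H x) by fun_ring.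
      eapply Rle_trans; [apply N_triangle |].
      - apply C0_plus; auto. apply C0_scal, C0_ind.
      - now apply C0_scal.
      - apply Rplus_le_compat; auto. apply HNH. intros x.
        rewrite Rabs_mult, Rabs_m1, Rmult_1_l; auto. }
    rewrite N_scal, Rabs_pos_eq in Hle by (apply C0_ind || apply pos_INR).
    replace (N (ind t)) with (peak_norm t + 2 * eps) in Hle by (unfold eps; field). lra. }
  destruct (INR_unbounded (b * C / eps)) as [m Hmb].
  specialize (Hall m). apply (Rmult_gt_compat_r eps) in Hmb; auto.
  replace (b * C / eps * eps) with (b * C) in Hmb by (field; lra). lra.
Qed.

Lemma peak_norm_bad_unique s u1 u2 :
  tree_bad T le peak_norm u1 -> le s u1 -> peak_norm u1 = peak_norm s ->
  tree_bad T le peak_norm u2 -> le s u2 -> peak_norm u2 = peak_norm s -> u1 = u2.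
Proof.
  intros B1 L1 E1 B2 L2 E2.
  assert (H : forall x, ind u1 x = ind u2 x).
  { apply (peaked_unique s).
    - apply (peaked_below s u1); auto using peaked_ind.
    - apply (peaked_below s u2); auto using peaked_ind.
    - rewrite <- E1; now apply bad_ind_norm.
    - rewrite <- E2; now apply bad_ind_norm. }
  apply tle_antisym.
  - apply NNPP; intros Hn. specialize (H u1).
    rewrite ind_in, ind_out in H; auto using tle_refl; lra.
  - apply NNPP; intros Hn. specialize (H u2).
    rewrite ind_out, ind_in in H; auto using tle_refl; lra.
Qed.

(** * Dyadic averages on an ever-branching set of constant level *)

Section EverBranching.
Variable G : T -> Prop.
Variable c : R.
Hypothesis G_rho : forall t, G t -> peak_norm t = c.
Variables lf rt : T -> T.
Hypothesis G_branch : forall t, G t ->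
  G (lf t) /\ G (rt t) /\ le t (lf t) /\ le t (rt t) /\ ~ le (lf t) (rt t) /\ ~ le (rt t) (lf t).

Fixpoint mean (k : nat) (t : T) (x : T) : R :=
  match k with
  | O => ind t x
  | S k => / 2 * mean k (lf t) x + / 2 * mean k (rt t) x
  end.

Lemma mean_peaked k t : G t -> peaked t (mean k t).
Proof.
  revert t; induction k as [| k IH]; intros t Ht; [apply peaked_ind |].
  destruct (G_branch t Ht) as (G1 & G2 & L1 & L2 & _).
  apply (peaked_mean t (mean k (lf t)) (mean k (rt t))).
  - apply (peaked_below t (lf t)); auto.
  - apply (peaked_below t (rt t)); auto.
Qed.

Lemma branch_disjoint t x : G t -> le (lf t) x -> le (rt t) x -> False.
Proof.
  intros Ht H1 H2. destruct (G_branch t Ht) as (_ & _ & _ & _ & N1 & N2).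
  destruct (comparable (lf t) (rt t) x); auto.
Qed.

(** The changes in the two halves live on the disjoint cones above [lf t] and [rt t], so averaging
    halves their size. *)
Lemma mean_step k t x : G t -> Rabs (mean (S k) t x - mean k t x) <= (/ 2) ^ k.
Proof.
  revert t; induction k as [| k IH]; intros t Ht;
    destruct (G_branch t Ht) as (G1 & G2 & L1 & L2 & _).
  - simpl. destruct (classic (le x t)) as [Hx | Hx].
    + rewrite !ind_in; auto; try (eapply tle_trans; eauto).
      replace (/ 2 * 1 + / 2 * 1 - 1) with 0 by field. rewrite Rabs_R0; lra.
    + rewrite (ind_out t); auto. unfold ind.
      repeat destruct excluded_middle_informative; rewrite Rabs_pos_eq; lra.
  - assert (Hz : forall s, G s -> mean (S k) s x - mean k s x <> 0 -> le s x).
    { intros s Hs Hne. apply NNPP; intros Hsx. apply Hne.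
      destruct (mean_peaked (S k) s Hs) as (_ & A1 & A2).
      destruct (mean_peaked k s Hs) as (_ & B1 & B2).
      destruct (classic (le x s)); [rewrite A1, B1 | rewrite A2, B2]; auto; lra. }
    change (Rabs ((/ 2 * mean (S k) (lf t) x + / 2 * mean (S k) (rt t) x)
                  - (/ 2 * mean k (lf t) x + / 2 * mean k (rt t) x)) <= (/ 2) ^ S k).
    assert (I1 := IH _ G1). assert (I2 := IH _ G2).
    set (d1 := mean (S k) (lf t) x - mean k (lf t) x) in *.
    set (d2 := mean (S k) (rt t) x - mean k (rt t) x) in *.
    replace (/ 2 * mean (S k) (lf t) x + / 2 * mean (S k) (rt t) x
                  - (/ 2 * mean k (lf t) x + / 2 * mean k (rt t) x))
      with (/ 2 * (d1 + d2)) by (unfold d1, d2; ring).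
    rewrite Rabs_mult, (Rabs_pos_eq (/ 2)) by lra.
    change ((/ 2) ^ S k) with (/ 2 * (/ 2) ^ k). apply Rmult_le_compat_l; [lra |].
    destruct (Req_dec d1 0) as [E | E]; [rewrite E, Rplus_0_l; auto |].
    destruct (Req_dec d2 0) as [E' | E']; [rewrite E', Rplus_0_r; auto |].
    exfalso. apply (branch_disjoint t x); auto.
Qed.

(** Replace the indicators at the ends of the scheme by near-optimal functions: the average keeps
    norm at most [c + eps], while the corrections, on disjoint cones, shrink by half at each level.
    The restriction [eps <= 1] makes their bound independent of [eps]. *)
Lemma mean_correction k t eps : G t -> 0 < eps <= 1 -> exists h, C0 T le h /\
  (forall x, Rabs (h x) <= (/ 2) ^ k * ((c + 1) / a)) /\ (forall x, h x <> 0 -> le t x) /\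
  N (fun x => mean k t x + h x) <= c + eps.
Proof.
  intros Ht Heps. revert t Ht; induction k as [| k IH]; intros t Ht.
  - destruct (peak_norm_approx t eps) as (f & Hf & Hn); [lra |].
    rewrite (G_rho t Ht) in Hn. destruct Hf as (F1 & F2 & F3).
    exists (fun x => f x - ind t x). split; [| split; [| split]].
    + apply C0_minus; auto using C0_ind.
    + intros x. rewrite pow_O, Rmult_1_l.
      assert (Hb := bound_le_N f x F1).
      assert (Hc : N f / a <= (c + 1) / a).
      { apply Rmult_le_compat_r; [left; now apply Rinv_0_lt_compat | lra]. }
      destruct (classic (le x t)) as [Hx | Hx].
      * rewrite F2, ind_in, Rminus_eq_0, Rabs_R0; auto.
        generalize (Rabs_pos (f x)); lra.
      * rewrite ind_out, Rminus_0_r; auto; lra.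
    + intros x Hx. apply NNPP; intros Htx. apply Hx.
      destruct (classic (le x t)); [rewrite F2, ind_in | rewrite F3, ind_out]; auto; lra.
    + simpl. replace (fun x => ind t x + (f x - ind t x)) with f by fun_ring. lra.
  - destruct (G_branch t Ht) as (G1 & G2 & L1 & L2 & _).
    destruct (IH _ G1) as (h1 & A1 & B1 & S1 & N1).
    destruct (IH _ G2) as (h2 & A2 & B2 & S2 & N2).
    exists (fun x => / 2 * h1 x + / 2 * h2 x). split; [| split; [| split]].
    + now apply C0_lin.
    + intros x. replace (/ 2 * h1 x + / 2 * h2 x) with (/ 2 * (h1 x + h2 x)) by ring.
      rewrite Rabs_mult, (Rabs_pos_eq (/ 2)) by lra.
      change ((/ 2) ^ S k) with (/ 2 * (/ 2) ^ k). rewrite Rmult_assoc.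
      apply Rmult_le_compat_l; [lra |].
      destruct (Req_dec (h1 x) 0) as [E | E]; [rewrite E, Rplus_0_l; auto |].
      destruct (Req_dec (h2 x) 0) as [E' | E']; [rewrite E', Rplus_0_r; auto |].
      exfalso. apply (branch_disjoint t x); auto.
    + intros x Hx. destruct (Req_dec (h1 x) 0) as [E | E].
      * destruct (Req_dec (h2 x) 0) as [E' | E'].
        -- exfalso; apply Hx; rewrite E, E'; ring.
        -- apply tle_trans with (rt t); auto.
      * apply tle_trans with (lf t); auto.
    + simpl.
      replace (fun x => / 2 * mean k (lf t) x + / 2 * mean k (rt t) x
                        + (/ 2 * h1 x + / 2 * h2 x))
        with (fun x => / 2 * (mean k (lf t) x + h1 x) + / 2 * (mean k (rt t) x + h2 x)) by fun_ring.
      apply N_mean_le; auto; apply C0_plus; auto; now apply mean_peaked.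
Qed.

Lemma mean_norm k t : G t -> N (mean k t) <= c + b * ((c + 1) / a) * (/ 2) ^ k.
Proof.
  intros Ht.
  assert (Hc : 0 <= (c + 1) / a).
  { destruct (mean_correction 0 t 1 Ht) as (h & _ & H & _); [lra |].
    specialize (H t). rewrite pow_O, Rmult_1_l in H. generalize (Rabs_pos (h t)); lra. }
  apply Rnot_lt_le; intros Hlt.
  set (d := N (mean k t) - (c + b * ((c + 1) / a) * (/ 2) ^ k)) in *.
  assert (Hd : 0 < d) by (unfold d; lra).
  destruct (mean_correction k t (Rmin 1 (d / 2)) Ht) as (h & H1 & H2 & _ & H4).
  { split; [apply Rmin_pos; lra | apply Rmin_l]. }
  assert (Hm := Rmin_r 1 (d / 2)).
  assert (Hle : N (mean k t) <= N (fun x => mean k t x + h x) + b * ((/ 2) ^ k * ((c + 1) / a))).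
  { replace (mean k t) with (fun x => (mean k t x + h x) + (-1) * h x) at 1 by fun_ring.
    eapply Rle_trans; [apply N_triangle |].
    - apply C0_plus; auto. now apply mean_peaked.
    - now apply C0_scal.
    - apply Rplus_le_compat_l, N_le_bound; [now apply C0_scal | |].
      + apply Rmult_le_pos; auto. apply pow_le; lra.
      + intros x. rewrite Rabs_mult, Rabs_m1, Rmult_1_l; auto. }
  unfold d in *; lra.
Qed.

Lemma peak_attained t : G t -> exists f, peaked t f /\ N f <= c.
Proof.
  intros Ht.
  destruct (choice (fun x l => forall k, Rabs (mean k t x - l) <= 2 * (/ 2) ^ k)) as [f Hf].
  { intros x. apply halves_limit. intros k; now apply mean_step. }
  assert (Hc : C0 T le f).
  { apply C0_approx. intros eps Heps.
    destruct (half_pow_small (eps / 2)) as [k Hk]; [lra |].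
    exists (mean k t). split; [now apply mean_peaked |].
    intros x. rewrite Rabs_minus_sym. eapply Rle_trans; [apply Hf |].
    specialize (Hk k (Nat.le_refl k)). lra. }
  assert (Heq : forall x v, (forall k, mean k t x = v) -> f x = v).
  { intros x v Hv.
    assert (Rabs (v - f x) <= 0).
    { apply le_zero_of_halves with 2. intros k. rewrite <- (Hv k). apply Hf. }
    revert H; unfold Rabs; destruct Rcase_abs; lra. }
  exists f; split; [split; [auto | split] |].
  - intros x Hx. apply Heq; intros k. now apply mean_peaked.
  - intros x Hx Hx'. apply Heq; intros k. now apply (mean_peaked k t Ht).
  - apply Rminus_le. apply le_zero_of_halves with (b * ((c + 1) / a) + b * 2). intros k.
    assert (Hm := mean_norm k t Ht).
    assert (Hd : C0 T le (fun x => f x - mean k t x)).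
    { apply C0_minus; auto. now apply mean_peaked. }
    assert (Hn : N f <= N (mean k t) + b * (2 * (/ 2) ^ k)).
    { replace f with (fun x => mean k t x + (f x - mean k t x)) at 1 by fun_ring.
      eapply Rle_trans; [apply N_triangle; auto; now apply mean_peaked |].
      apply Rplus_le_compat_l, N_le_bound; auto.
      - generalize (pow_le (/ 2) k); lra.
      - intros x. rewrite Rabs_minus_sym. apply Hf. }
    lra.
Qed.

(** The minimisers for [lf t] and [rt t] are both minimisers for [t], hence equal; but at [lf t] one
    is 1 and the other 0. *)
Lemma ever_branching_empty t : G t -> False.
Proof.
  intros Ht. destruct (G_branch t Ht) as (G1 & G2 & L1 & L2 & N1 & N2).
  destruct (peak_attained _ G1) as (f & Hf & Hfn).
  destruct (peak_attained _ G2) as (g & Hg & Hgn).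
  assert (H : f (lf t) = g (lf t)).
  { apply (peaked_unique t); try (rewrite (G_rho t Ht); auto).
    - now apply (peaked_below t (lf t)).
    - now apply (peaked_below t (rt t)). }
  destruct Hf as (_ & F & _). destruct Hg as (_ & _ & H').
  rewrite F, H' in H; auto using tle_refl; lra.
Qed.
End EverBranching.

Lemma peak_norm_not_constant G : ever_branching T le G ->
  ~ exists c, forall t, G t -> peak_norm t = c.
Proof.
  intros [[t Ht] HG] [c Hc].
  destruct (choice (fun t p => G t -> G (fst p) /\ G (snd p) /\ le t (fst p) /\ le t (snd p)
     /\ ~ le (fst p) (snd p) /\ ~ le (snd p) (fst p))) as [br Hbr].
  { intros s. destruct (classic (G s)) as [Hs | Hs].
    - destruct (HG s Hs) as (u & v & Huv). exists (u, v). simpl; tauto.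
    - exists (s, s); tauto. }
  apply (ever_branching_empty G c Hc (fun t => fst (br t)) (fun t => snd (br t)) Hbr t Ht).
Qed.
End FromNorm.

(** * Levels of an increasing function *)

Section Rho.
Variable rho : T -> R.
Hypothesis rho_incr : tree_increasing T le rho.
Hypothesis rho_branch : forall G : T -> Prop, ever_branching T le G ->
  ~ exists c, forall t, G t -> rho t = c.
Hypothesis rho_bad : forall s u1 u2,
  tree_bad T le rho u1 -> le s u1 -> rho u1 = rho s ->
  tree_bad T le rho u2 -> le s u2 -> rho u2 = rho s -> u1 = u2.

Local Notation bad := (tree_bad T le rho).

(** On a path a given rational is jumped over at most once, so the jumps over one rational form an
    antichain. *)
Definition jumps_over (n : nat) (y : T) : Prop :=
  (forall s, lt s y -> rho s <= rational n) /\ rational n < rho y.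

Definition jump (y : T) : Prop := exists n, jumps_over n y.

Definition level_succ (t u : T) : Prop := succ t u /\ rho u = rho t.

(** A path that leaves the level of [t] directly after [t] passes the rational there, so it contains
    at most one such [t] for each [n]. *)
Definition exits_over (n : nat) (t : T) : Prop :=
  rho t <= rational n /\ forall u, succ t u -> rho u <> rho t -> rational n < rho u.

Definition level_succs (t : T) : list T := enum (level_succ t).

Definition phi (t : T) (f : T -> R) : R := f t - lsum (level_succs t) f.

Lemma rho_lt s t : lt s t -> rho s <= rho t.
Proof. intros H; apply rho_incr; now apply lt_le. Qed.

Lemma jump_of_gap y r : (forall s, lt s y -> rho s <= r) -> r < rho y -> jump y.
Proof.
  intros H1 H2. destruct (rational_dense r (rho y) H2) as (n & Hn1 & Hn2).
  exists n; split; auto. intros s Hs; specialize (H1 s Hs); lra.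
Qed.

Lemma jump_or_level t u : succ t u -> jump u \/ rho u = rho t.
Proof.
  intros H. assert (Hle := rho_lt _ _ (succ_lt _ _ H)).
  destruct (Rle_lt_or_eq_dec _ _ Hle) as [Hlt | ->]; auto.
  left. apply (jump_of_gap u (rho t)); auto.
  intros s Hs. apply rho_incr. now apply (succ_le_lt t u).
Qed.

(** Outside [F] the successors have values above some [c > rho t], so all successors on the level of
    [t] lie in [F]; lowering [c] past the finitely many other values on [F] leaves room for a
    rational. *)
Lemma not_bad_spec t : ~ bad t ->
  (NoDup (level_succs t) /\ forall u, In u (level_succs t) <-> level_succ t u) /\
  exists n, exits_over n t.
Proof.
  intros Hb. apply NNPP in Hb. destruct Hb as (F & HF & Hglb).
  set (P := fun y => exists u, succ t u /\ ~ In u F /\ y = rho u) in *.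
  destruct (Glb_Rbar_correct P) as [Hlb _].
  assert (Hout : exists c, rho t < c /\ forall u, succ t u -> ~ In u F -> c <= rho u).
  { assert (Hu : forall u, succ t u -> ~ In u F -> Rbar_le (Glb_Rbar P) (Finite (rho u))).
    { intros u H1 H2. apply Hlb. now exists u. }
    destruct (Glb_Rbar P) as [g | |]; simpl in *; [now exists g | | easy].
    (* An infinite infimum means that [F] contains all successors, so any number above [rho t]
       serves. *)
    exists (rho t + 1); split; [lra |]. intros u H1 H2. now destruct (Hu u H1 H2). }
  destruct Hout as (c & Hc & Hout). split.
  - unfold level_succs, enum. apply epsilon_spec.
    exists (canon (filter (fun u => if Req_EM_T (rho u) (rho t) then true else false) F)).
    destruct (canon_spec (filter (fun u => if Req_EM_T (rho u) (rho t) then true else false) F))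
      as [H1 H2].
    split; auto. intros u. rewrite H2, filter_In. unfold level_succ.
    destruct (Req_EM_T (rho u) (rho t)) as [Eu | Eu]; split; intros [A B]; try easy; auto.
    split; auto. apply NNPP; intros Hn. specialize (Hout u A Hn). lra.
  - assert (Hc' : exists c', rho t < c' /\ c' <= c /\
        forall u, In u F -> rho t < rho u -> c' <= rho u).
    { clear - Hc. induction F as [| v F (c' & A & B & C)].
      - exists c; repeat split; auto; [lra | intros u []].
      - destruct (Rlt_or_le (rho t) (rho v)) as [Hv | Hv].
        + exists (Rmin c' (rho v)). split; [now apply Rmin_glb_lt |]. split.
          * eapply Rle_trans; [apply Rmin_l | auto].
          * intros u [<- | Hu] Hlt; [apply Rmin_r |].
            eapply Rle_trans; [apply Rmin_l | auto].
        + exists c'; repeat split; auto. intros u [<- | Hu] Hlt; [lra | auto]. }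
    destruct Hc' as (c' & A & B & C).
    destruct (rational_dense _ _ A) as (n & Hn1 & Hn2). exists n; split; [lra |].
    intros u Hu Hne. assert (Hlt := rho_lt _ _ (succ_lt _ _ Hu)).
    destruct (classic (In u F)) as [Hin | Hin].
    + specialize (C u Hin). lra.
    + specialize (Hout u Hu Hin). lra.
Qed.

Lemma in_level_succs t u : ~ bad t -> In u (level_succs t) <-> level_succ t u.
Proof. intros H; apply (not_bad_spec t H). Qed.

(* Functions are replaced by sequences of functions modulo null sequences; constant sequences
   give the statements about a single function. *)
Section Vanishing.
Variable h : nat -> T -> R.
(** The coordinates are assumed null only on this region, so that the results also apply to a single
    cone, as in [quiet]. *)
Variable Reg : T -> Prop.

Definition nul (x : T) : Prop := tends0 (fun n => h n x).
Definition close (x y : T) : Prop := tends0 (fun n => h n x - h n y).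

Hypothesis Reg_up : forall x y, Reg x -> le x y -> Reg y.
Hypothesis h_jump : forall y, Reg y -> jump y -> nul y.
Hypothesis h_phi : forall t, Reg t -> ~ bad t -> tends0 (fun n => phi t (h n)).
Hypothesis h_limit : forall x, limit x -> forall eps, 0 < eps ->
  exists y0, lt y0 x /\ forall y, le y0 y -> le y x ->
    exists n0, forall n, (n0 <= n)%nat -> Rabs (h n x - h n y) <= eps.
Hypothesis h_vanish : forall eps, 0 < eps -> exists L : list T, forall x,
  (exists n0, forall n, (n0 <= n)%nat -> Rabs (h n x) <= eps) \/ exists z, In z L /\ le x z.

Lemma close_refl x : close x x.
Proof.
  intros eps Heps; exists 0%nat; intros; rewrite Rminus_eq_0, Rabs_R0; lra.
Qed.

Lemma close_trans x y z : close x y -> close y z -> close x z.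
Proof.
  intros H1 H2. eapply tends0_ext; [| apply (tends0_lin 1 1 _ _ H1 H2)].
  intros n; simpl; ring.
Qed.

Lemma close_sym x y : close x y -> close y x.
Proof.
  intros H. eapply tends0_ext; [| apply (tends0_lin (-1) 0 _ _ H H)].
  intros n; simpl; ring.
Qed.

Lemma close_nul x y : close x y -> nul y -> nul x.
Proof.
  intros H1 H2. eapply tends0_ext; [| apply (tends0_lin 1 1 _ _ H1 H2)].
  intros n; simpl; ring.
Qed.

Lemma sum_nul l : (forall u, In u l -> nul u) -> tends0 (fun n => lsum l (h n)).
Proof.
  induction l as [| u l IH]; intros H.
  - unfold lsum; simpl. now apply tends0_const.
  - eapply tends0_ext; [| apply (tends0_lin 1 1 (fun n => h n u) (fun n => lsum l (h n)))].
    + intros n; unfold lsum; simpl; ring.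
    + apply H; left; auto.
    + apply IH; intros; apply H; right; auto.
Qed.

Lemma sum_single l u0 : NoDup l -> In u0 l -> (forall u, In u l -> u <> u0 -> nul u) ->
  tends0 (fun n => lsum l (h n) - h n u0).
Proof.
  induction l as [| u l IH]; intros Hnd Hin H; [easy |]. inversion Hnd; subst.
  destruct (classic (u = u0)) as [-> | Hne].
  - eapply tends0_ext; [| apply (sum_nul l)].
    + intros n; unfold lsum; simpl; ring.
    + intros v Hv. apply H; [right; auto |]. intros ->; contradiction.
  - destruct Hin as [| Hin]; [contradiction |].
    eapply tends0_ext; [| apply (tends0_lin 1 1 (fun n => h n u)
                                   (fun n => lsum l (h n) - h n u0))].
    + intros n; unfold lsum; simpl; ring.
    + apply H; [left |]; auto.
    + apply IH; auto. intros; apply H; [right |]; auto.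
Qed.

Lemma phi_single t u0 : Reg t -> ~ bad t -> level_succ t u0 ->
  (forall u, level_succ t u -> u <> u0 -> nul u) -> close u0 t.
Proof.
  intros Hr Hb Hu0 Hu. destruct (not_bad_spec t Hb) as [[Hnd Hin] _].
  assert (H1 := sum_single (level_succs t) u0 Hnd (proj2 (Hin u0) Hu0)
                  (fun u Hu' => Hu u (proj1 (Hin u) Hu'))).
  eapply tends0_ext; [| apply (tends0_lin (-1) (-1) _ _ (h_phi t Hr Hb) H1)].
  intros n; unfold phi; simpl; ring.
Qed.

Lemma phi_none t : Reg t -> ~ bad t -> (forall u, level_succ t u -> nul u) -> nul t.
Proof.
  intros Hr Hb Hu. destruct (not_bad_spec t Hb) as [[Hnd Hin] _].
  assert (H1 := sum_nul (level_succs t) (fun u Hu' => Hu u (proj1 (Hin u) Hu'))).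
  eapply tends0_ext; [| apply (tends0_lin 1 1 _ _ (h_phi t Hr Hb) H1)].
  intros n; unfold phi; simpl; ring.
Qed.

Lemma close_limit m t : limit m ->
  (forall y0, lt y0 m -> exists y, le y0 y /\ le y m /\ close y t) -> close m t.
Proof.
  intros Hm H eps Heps. destruct (h_limit m Hm (eps / 2)) as (y0 & Hy0 & H0); [lra |].
  destruct (H y0 Hy0) as (y & H1 & H2 & H3).
  destruct (H0 y H1 H2) as [n1 Hn1]. destruct (H3 (eps / 2)) as [n2 Hn2]; [lra |].
  exists (n1 + n2)%nat. intros n Hn. specialize (Hn1 n ltac:(lia)).
  specialize (Hn2 n ltac:(lia)).
  replace (h n m - h n t) with ((h n m - h n y) + (h n y - h n t)) by ring.
  eapply Rle_trans; [apply Rabs_triang | lra].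
Qed.

Lemma chain_cover (C : T -> Prop) (L : list T) t : C t ->
  (forall x y, C x -> C y -> le x y \/ le y x) ->
  (forall x, C x -> exists z, In z L /\ le x z) -> exists e, forall x, C x -> le x e.
Proof.
  intros Ht Hch. induction L as [| z L IH]; intros H.
  - now destruct (H t Ht) as (z & [] & _).
  - destruct (classic (forall x, C x -> le x z)) as [Hz | Hz]; [now exists z |].
    apply not_all_ex_not in Hz as [x0 Hx0]. apply imply_to_and in Hx0 as [Cx0 Hx0].
    apply IH. intros x Cx.
    assert (Hmax : exists w, C w /\ le x w /\ le x0 w).
    { destruct (Hch x x0 Cx Cx0); [exists x0 | exists x]; auto using tle_refl. }
    destruct Hmax as (w & Cw & Hxw & Hx0w).
    destruct (H w Cw) as (z' & [<- | Hz'] & Hwz).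
    + exfalso; apply Hx0; now apply tle_trans with w.
    + exists z'; split; auto. now apply tle_trans with w.
Qed.

(** The points close to [t] on its level form a chain in which each has a successor, and vanishing
    at infinity bounds the chain. The first point beyond it can only be a limit; by continuity it is
    close to [t], so it has left the level and is a jump, where [h] is null. *)
Lemma nonnul_chain_absurd t : Reg t -> ~ nul t ->
  (forall b, bad b -> le t b -> rho b <> rho t) ->
  (forall u v, le t u -> rho u = rho t -> ~ nul u -> le t v -> rho v = rho t -> ~ nul v ->
     le u v \/ le v u) -> False.
Proof.
  intros Hr Hn Hb Hchain.
  set (C := fun x => le t x /\ rho x = rho t /\ close x t).
  assert (Cnn : forall x, C x -> ~ nul x).
  { intros x (_ & _ & Hx) Hx'. apply Hn. apply (close_nul t x); auto using close_sym. }
  assert (Ct : C t) by (repeat split; auto using tle_refl, close_refl).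
  assert (Cchain : forall x y, C x -> C y -> le x y \/ le y x).
  { intros x y Cx Cy. assert (Nx := Cnn x Cx). assert (Ny := Cnn y Cy).
    destruct Cx as (? & ? & _), Cy as (? & ? & _); auto. }
  assert (Csucc : forall x, C x -> exists u, succ x u /\ C u).
  { intros x Cx. assert (Nx := Cnn x Cx). destruct Cx as (Hx1 & Hx2 & Hx3).
    assert (Rx : Reg x) by now apply Reg_up with t.
    assert (Bx : ~ bad x) by (intros Hbx; now apply (Hb x)).
    destruct (classic (exists u, level_succ x u /\ ~ nul u)) as [(u & [Hu1 Hu2] & Hu3) | Hno].
    2: { exfalso; apply Nx. apply phi_none; auto. intros u Hu. apply NNPP; intros Hu'.
         apply Hno; now exists u. }
    assert (Htu : forall v, level_succ x v -> le t v /\ rho v = rho t).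
    { intros v [Hv1 Hv2]; split; [| congruence].
      apply tle_trans with x; auto. now apply lt_le, succ_lt. }
    exists u; split; auto. destruct (Htu u) as [A B]; [now split |]. repeat split; auto.
    apply close_trans with x; auto. apply phi_single; auto; [now split |].
    intros v Hv Hvu. apply NNPP; intros Nv. apply Hvu. destruct (Htu v Hv) as [A' B'].
    destruct Hv as [Hv1 Hv2]. destruct (Hchain u v) as [H | H]; auto.
    - symmetry; apply (succ_comparable x u v v); auto using tle_refl.
    - apply (succ_comparable x v u u); auto using tle_refl. }
  (* A size exceeded by [h n t] for infinitely many [n]; points close to [t] then exceed [d / 2]
     infinitely often. *)
  assert (Hd : exists d, 0 < d /\ forall n0, exists n, (n0 <= n)%nat /\ d < Rabs (h n t)).
  { apply NNPP; intros Hno. apply Hn. intros eps Heps. apply NNPP; intros Hne.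
    apply Hno. exists eps; split; auto. intros n0. apply NNPP; intros Hno'.
    apply Hne. exists n0; intros n Hn0. apply Rnot_lt_le; intros Hlt. apply Hno'; now exists n. }
  destruct Hd as (d & Hd & Hfreq).
  destruct (h_vanish (d / 2)) as [L HL]; [lra |].
  destruct (chain_cover C L t Ct Cchain) as [e He].
  { intros x Cx. destruct (HL x) as [[n1 Hn1] | Hz]; auto. exfalso.
    destruct Cx as (_ & _ & Hx). destruct (Hx (d / 2)) as [n2 Hn2]; [lra |].
    destruct (Hfreq (n1 + n2)%nat) as (n & Hn0 & Hlt).
    specialize (Hn1 n ltac:(lia)). specialize (Hn2 n ltac:(lia)).
    replace (h n t) with (h n x - (h n x - h n t)) in Hlt by ring.
    revert Hn1 Hn2 Hlt; abs_lra. }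
  assert (Ce : ~ C e).
  { intros Ce. destruct (Csucc e Ce) as (u & Hu & Cu).
    apply (le_not_lt u e); auto. now apply succ_lt. }
  destruct (least (fun x => le t x /\ le x e /\ ~ C x) e) as (m & (A & B & Cm) & _ & Hmin).
  { repeat split; auto using tle_refl. }
  assert (Hbelow : forall s, le t s -> lt s m -> C s).
  { intros s H1 H2. apply NNPP; intros Hs. apply (Hmin s H2). repeat split; auto.
    apply tle_trans with m; auto using lt_le. }
  destruct (le_cases _ _ A) as [-> | Htm]; [contradiction |].
  destruct (rank_cases m) as [Hm | [[w Hw] | Hl]].
  - now apply (Hm t).
  - assert (Cw : C w) by (apply Hbelow; [now apply (succ_le_lt w m) | now apply succ_lt]).
    destruct (Csucc w Cw) as (u & Hu & Cu). apply Cm.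
    now rewrite (succ_comparable w m u e); auto.
  - assert (Hcl : close m t).
    { apply close_limit; auto. intros y0 Hy0.
      destruct (lt_max m y0 t) as (w & Hw & Hw0 & Hwt); auto.
      exists w; repeat split; auto using lt_le. now apply Hbelow. }
    apply Cm; repeat split; auto.
    assert (Hle := rho_incr _ _ A).
    destruct (Rle_lt_or_eq_dec _ _ Hle) as [Hlt | Heq]; auto. exfalso.
    apply Hn. apply (close_nul t m); auto using close_sym. apply h_jump; [eauto |].
    apply (jump_of_gap m (rho t)); auto. intros s Hs.
    destruct (comparable s t m) as [H | H]; auto using lt_le.
    destruct (Hbelow s H Hs) as (_ & -> & _). lra.
Qed.

(** The non-null points above [s] on its level cannot be ever-branching, so above one of them they
    form a chain, which is impossible without a bad point. *)
Lemma nonnul_below_bad s : Reg s -> ~ nul s -> exists b, bad b /\ le s b /\ rho b = rho s.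
Proof.
  intros Hr Hn. apply NNPP; intros Hno.
  set (G := fun y => le s y /\ rho y = rho s /\ ~ nul y).
  destruct (classic (forall t, G t -> exists u v, G u /\ G v /\ le t u /\ le t v /\
     ~ le u v /\ ~ le v u)) as [Hbr | Hbr].
  - apply (rho_branch G); [split; auto |].
    + exists s; repeat split; auto using tle_refl.
    + exists (rho s); intros t Ht; apply Ht.
  - apply not_all_ex_not in Hbr as [t Ht]. apply imply_to_and in Ht as [(A & B & C) Ht].
    apply (nonnul_chain_absurd t); auto; [now apply Reg_up with s | |].
    + intros b Hb Hle Heq. apply Hno. exists b; repeat split; auto; [| congruence].
      now apply tle_trans with t.
    + intros u v Hu1 Hu2 Hu3 Hv1 Hv2 Hv3. apply NNPP; intros Hinc. apply Ht.
      exists u, v. unfold G. repeat split; auto; try congruence;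
        now apply tle_trans with t.
Qed.

(** Above each non-null successor on the level of [t] lies a bad point of that level. There is only
    one such bad point, so there is only one such successor, and the [phi] coordinate compares it
    with [t]. *)
Lemma nonnul_succ_close t m : Reg t -> level_succ t m -> ~ nul m -> close m t.
Proof.
  intros Hr Hm Hn. assert (Hlt := succ_lt _ _ (proj1 Hm)).
  destruct (nonnul_below_bad m) as (b & Hb1 & Hb2 & Hb3); auto.
  { apply Reg_up with t; auto using lt_le. }
  assert (Hrb : rho b = rho t) by (rewrite Hb3; apply Hm).
  assert (Htb : lt t b) by now apply lt_le_trans with m.
  apply phi_single; auto.
  - intros Hbt. assert (t = b).
    { apply (rho_bad t); auto using tle_refl, lt_le. }
    subst; now apply (lt_irrefl b).
  - intros u Hu Hum. apply NNPP; intros Hnu. apply Hum.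
    assert (Hltu := succ_lt _ _ (proj1 Hu)).
    destruct (nonnul_below_bad u) as (b' & Hb1' & Hb2' & Hb3'); auto.
    { apply Reg_up with t; auto using lt_le. }
    assert (b' = b).
    { apply (rho_bad t); auto using lt_le.
      - apply tle_trans with u; auto using lt_le.
      - rewrite Hb3'; apply Hu. }
    subst b'. apply (succ_comparable t u m b); auto; [apply Hu | apply Hm].
Qed.

(** Along a path from [s] the sequence keeps its values as long as it is not null. A first failure
    would be non-null, hence no jump, and is excluded at successors by [nonnul_succ_close] and at
    limits by continuity. *)
Lemma nul_or_close s x : Reg s -> le s x -> nul x \/ (rho x = rho s /\ close x s).
Proof.
  intros Hr Hsx. apply NNPP; intros Hx.
  destruct (least (fun y => le s y /\ ~ (nul y \/ (rho y = rho s /\ close y s))) x)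
    as (m & [A B] & _ & Hmin); auto.
  assert (Hbelow : forall w, le s w -> lt w m -> nul w \/ (rho w = rho s /\ close w s)).
  { intros w H1 H2. apply NNPP; intros Hw. now apply (Hmin w H2). }
  assert (Nm : ~ nul m) by tauto. apply B; right; clear B Hmin Hx Hsx x.
  assert (Jm : ~ jump m) by (intros Jm; apply Nm; eauto).
  destruct (le_cases _ _ A) as [-> | Hsm]; [split; auto using close_refl |].
  destruct (rank_cases m) as [Hm | [[w Hw] | Hl]].
  - exfalso; now apply (Hm s).
  - assert (Hsw : le s w) by now apply (succ_le_lt w m).
    destruct (jump_or_level w m Hw) as [? | Hlev]; [contradiction |].
    assert (Hc : close m w) by (apply nonnul_succ_close; auto; [eauto | now split]).
    destruct (Hbelow w Hsw (succ_lt _ _ Hw)) as [Nw | [H1 H2]].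
    + exfalso; apply Nm; now apply close_nul with w.
    + split; [congruence |]. now apply close_trans with w.
  (* Null points cofinal below [m] would make [m] null by continuity, so from some point on all are
     close to [s]. *)
  - assert (Hnn : exists y0, lt y0 m /\ le s y0 /\
              forall y, le y0 y -> lt y m -> rho y = rho s /\ close y s).
    { apply NNPP; intros Hno. apply Nm. intros eps Heps.
      destruct (h_limit m Hl (eps / 2)) as (y0 & Hy0 & H0); [lra |].
      destruct (lt_max m y0 s) as (w & Hw & Hw0 & Hws); auto.
      assert (Hnul : exists y, le w y /\ lt y m /\ nul y).
      { apply NNPP; intros Hno'. apply Hno. exists w; split; [auto | split; auto].
        intros y Hwy Hym. destruct (Hbelow y) as [Ny | ?]; auto; [now apply tle_trans with w |].
        exfalso; apply Hno'; now exists y. }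
      destruct Hnul as (y & Hy1 & Hy2 & Hy3).
      destruct (H0 y) as [n1 Hn1]; [now apply tle_trans with w | auto using lt_le |].
      destruct (Hy3 (eps / 2)) as [n2 Hn2]; [lra |].
      exists (n1 + n2)%nat; intros n Hn. specialize (Hn1 n ltac:(lia)).
      specialize (Hn2 n ltac:(lia)).
      replace (h n m) with ((h n m - h n y) + h n y) by ring.
      eapply Rle_trans; [apply Rabs_triang | lra]. }
    destruct Hnn as (y0 & Hy0 & Hsy0 & H0). split.
    + assert (Hle := rho_incr _ _ A).
      destruct (Rle_lt_or_eq_dec _ _ Hle) as [Hlt | Heq]; auto. exfalso. apply Jm.
      apply (jump_of_gap m (rho s)); auto. intros w Hw.
      destruct (comparable w y0 m) as [H | H]; auto using lt_le.
      * apply Rle_trans with (rho y0); [now apply rho_incr |].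
        destruct (H0 y0) as [-> _]; auto using tle_refl; lra.
      * destruct (H0 w H Hw) as [-> _]; lra.
    + apply close_limit; auto. intros y1 Hy1.
      destruct (lt_max m y0 y1) as (w & Hw & Hw0 & Hw1); auto.
      exists w; repeat split; auto using lt_le. now apply H0.
Qed.

(** A least non-null point is no jump, so it is not minimal; as a successor it would be close to its
    null predecessor, and as a limit it would be null by continuity. *)
Lemma all_nul : (forall x, Reg x) -> forall x, nul x.
Proof.
  intros Hr x. apply NNPP; intros Hx.
  destruct (least (fun y => ~ nul y) x Hx) as (m & Nm & _ & Hmin).
  assert (Hb : forall s, lt s m -> nul s).
  { intros s Hs; apply NNPP; now apply Hmin. }
  assert (Jm : ~ jump m) by (intros Jm; apply Nm; auto).
  destruct (rank_cases m) as [Hm | [[w Hw] | Hl]].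
  - apply Jm. apply (jump_of_gap m (rho m - 1)); [| lra].
    intros s Hs; exfalso; now apply (Hm s).
  - destruct (jump_or_level w m Hw) as [? | Hlev]; [contradiction |].
    apply Nm. apply close_nul with w; auto using succ_lt.
    apply nonnul_succ_close; auto. now split.
  - apply Nm. intros eps Heps. destruct (h_limit m Hl (eps / 2)) as (y0 & Hy0 & H0); [lra |].
    destruct (H0 y0) as [n1 Hn1]; auto using lt_le, tle_refl.
    destruct (Hb y0 Hy0 (eps / 2)) as [n2 Hn2]; [lra |].
    exists (n1 + n2)%nat; intros n Hn. specialize (Hn1 n ltac:(lia)).
    specialize (Hn2 n ltac:(lia)).
    replace (h n m) with ((h n m - h n y0) + h n y0) by ring.
    eapply Rle_trans; [apply Rabs_triang | lra].
Qed.
End Vanishing.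

(** * The injection into c_0 *)

Lemma nul_const f x : nul (fun _ => f) x <-> f x = 0.
Proof. apply (tends0_const (f x)). Qed.

Lemma const_h_limit f : C0 T le f -> forall x, limit x -> forall eps, 0 < eps ->
  exists y0, lt y0 x /\ forall y, le y0 y -> le y x ->
    exists n0, forall n, (n0 <= n)%nat -> Rabs (f x - f y) <= eps.
Proof.
  intros Hf x Hx eps Heps. apply C0_iff in Hf as [Hf _].
  destruct (Hf x Hx eps Heps) as (y0 & Hy0 & H0). exists y0; split; auto.
  intros y H1 H2. exists 0%nat; auto.
Qed.

Lemma const_h_vanish f : C0 T le f -> forall eps, 0 < eps -> exists L : list T, forall x,
  (exists n0, forall n, (n0 <= n)%nat -> Rabs (f x) <= eps) \/ exists z, In z L /\ le x z.
Proof.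
  intros Hf eps Heps. apply C0_iff in Hf as [_ Hf]. destruct (Hf eps Heps) as [L HL].
  exists L; intros x. destruct (Rle_or_lt eps (Rabs (f x))) as [H | H]; auto.
  left; exists 0%nat; intros; lra.
Qed.

Definition jump_label (y : T) : nat := epsilon (inhabits 0%nat) (fun n => jumps_over n y).
Definition exit_label (t : T) : nat := epsilon (inhabits 0%nat) (fun n => exits_over n t).

Definition jump_weight (y : T) : R := (/ 2) ^ jump_label y.
(** The power leaves finitely many labels above any given size; the other factor compensates for the
    [1 + length] values that enter [phi]. *)
Definition exit_weight (t : T) : R :=
  (/ 2) ^ exit_label t * / (1 + INR (length (level_succs t))).

Definition coord (i : T + T) (f : T -> R) : R :=
  match i with
  | inl y => if excluded_middle_informative (jump y) then jump_weight y * f y else 0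
  | inr t => if excluded_middle_informative (bad t) then 0 else exit_weight t * phi t f
  end.

Lemma jump_label_spec y : jump y -> jumps_over (jump_label y) y.
Proof. intros H; unfold jump_label; now apply epsilon_spec. Qed.

Lemma exit_label_spec t : ~ bad t -> exits_over (exit_label t) t.
Proof. intros H; unfold exit_label; apply epsilon_spec, not_bad_spec; auto. Qed.

Lemma jump_weight_bounds y : 0 < jump_weight y <= 1.
Proof. split; [apply half_pow_pos | apply half_pow_le]. Qed.

Lemma exit_weight_pos t : 0 < exit_weight t.
Proof.
  apply Rmult_lt_0_compat; [apply half_pow_pos |]. apply Rinv_0_lt_compat.
  generalize (pos_INR (length (level_succs t))); lra.
Qed.

Lemma lsum_lin {A : Type} (l : list A) a b (f g : A -> R) :
  lsum l (fun x => a * f x + b * g x) = a * lsum l f + b * lsum l g.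
Proof.
  induction l as [| x l IH]; [unfold lsum; simpl; ring |].
  change (a * f x + b * g x + lsum l (fun x => a * f x + b * g x)
          = a * (f x + lsum l f) + b * (g x + lsum l g)).
  rewrite IH; ring.
Qed.

Lemma lsum_bound {A : Type} (l : list A) (f : A -> R) M :
  (forall x, Rabs (f x) <= M) -> Rabs (lsum l f) <= INR (length l) * M.
Proof.
  intros H. induction l as [| x l IH].
  - unfold lsum; simpl. rewrite Rabs_R0; lra.
  - change (Rabs (f x + lsum l f) <= INR (length (x :: l)) * M).
    cbn [length]. rewrite S_INR. eapply Rle_trans; [apply Rabs_triang |].
    specialize (H x); lra.
Qed.

Lemma phi_lin t a b f g : phi t (fun x => a * f x + b * g x) = a * phi t f + b * phi t g.
Proof. unfold phi. rewrite lsum_lin; ring. Qed.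

Lemma phi_weight_bound t f M : (forall x, Rabs (f x) <= M) ->
  exit_weight t * Rabs (phi t f) <= (/ 2) ^ exit_label t * M.
Proof.
  intros H. set (k := INR (length (level_succs t))).
  assert (Hk : 0 <= k) by apply pos_INR.
  assert (Hphi : Rabs (phi t f) <= (1 + k) * M).
  { unfold phi, Rminus. eapply Rle_trans; [apply Rabs_triang |]. rewrite Rabs_Ropp.
    generalize (H t) (lsum_bound (level_succs t) f M H). fold k. lra. }
  unfold exit_weight. fold k. rewrite Rmult_assoc.
  apply Rmult_le_compat_l; [left; apply half_pow_pos |].
  apply Rmult_le_reg_l with (1 + k); [lra |].
  rewrite <- Rmult_assoc, Rinv_r, Rmult_1_l by lra. auto.
Qed.

Lemma coord_lin i a b f g : coord i (fun x => a * f x + b * g x) = a * coord i f + b * coord i g.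
Proof.
  destruct i as [y | t]; simpl; destruct excluded_middle_informative; try ring.
  rewrite phi_lin; ring.
Qed.

Lemma coord_bound i f M : 0 <= M -> (forall x, Rabs (f x) <= M) -> Rabs (coord i f) <= M.
Proof.
  intros HM H. destruct i as [y | t]; simpl; destruct excluded_middle_informative;
    try (rewrite Rabs_R0; auto).
  - assert (Hw := jump_weight_bounds y). rewrite Rabs_mult, Rabs_pos_eq by lra.
    rewrite <- (Rmult_1_l M). apply Rmult_le_compat; auto; try lra. apply Rabs_pos.
  - assert (Hw := exit_weight_pos t). rewrite Rabs_mult, Rabs_pos_eq by lra.
    eapply Rle_trans; [now apply phi_weight_bound |].
    rewrite <- (Rmult_1_l M) at 2. apply Rmult_le_compat_r; auto. apply half_pow_le.
Qed.

Lemma half_pow_label d : 0 < d -> exists n0, forall n, d <= (/ 2) ^ n -> (n < n0)%nat.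
Proof.
  intros Hd. destruct (half_pow_small d Hd) as [n0 Hn0]. exists n0. intros n Hn.
  destruct (lt_dec n n0) as [? | Hge]; auto. specialize (Hn0 n ltac:(lia)). lra.
Qed.

(** Finitely many labels and finitely many tops of the support remain, and a path contains at most
    one jump of each label. *)
Lemma jump_finite f d1 d2 : C0 T le f -> 0 < d1 -> 0 < d2 -> exists U, forall y,
  In y U <-> jump y /\ d1 <= jump_weight y /\ exists v, le y v /\ d2 <= Rabs (f v).
Proof.
  intros Hf Hd1 Hd2. apply C0_iff in Hf as [_ Hf]. destruct (Hf d2 Hd2) as [L HL].
  destruct (half_pow_label d1 Hd1) as [n0 Hn0].
  apply (finite_of_cover (fun y p => jumps_over (fst p) y /\ le y (snd p))
           (list_prod (seq 0 n0) L)).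
  - intros y (Hj & Hw & v & Hyv & Hv). destruct (HL v Hv) as (z & Hz & Hvz).
    exists (jump_label y, z); split; [apply in_prod |]; auto.
    + apply in_seq. specialize (Hn0 (jump_label y) Hw). lia.
    + split; [now apply jump_label_spec |]. simpl. now apply tle_trans with v.
  - intros y y' [n z] _ _ [[A1 A2] A3] [[B1 B2] B3]; simpl in *.
    destruct (comparable y y' z) as [H | H]; auto; destruct (le_cases _ _ H) as [? | Hlt]; auto.
    + specialize (B1 y Hlt). lra.
    + specialize (A1 y' Hlt). lra.
Qed.

Lemma lsum_none {A : Type} (l : list A) (f : A -> R) :
  (forall u, In u l -> f u = 0) -> lsum l f = 0.
Proof.
  induction l as [| x l IH]; intros H; [reflexivity |].
  change (f x + lsum l f = 0). rewrite IH, H; [ring | left; auto |].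
  intros u Hu; apply H; right; auto.
Qed.

(** If the path to [e] continues from [t] inside the level, exactly one level successor lies on it
    and its term cancels the value at [t]. *)
Lemma phi_ind t e : ~ bad t -> phi t (ind e) <> 0 ->
  le t e /\ forall v, succ t v -> le v e -> rho v <> rho t.
Proof.
  intros Hb Hphi. split.
  - apply NNPP; intros Hte. apply Hphi. unfold phi. rewrite (ind_out e t Hte), lsum_none; [ring |].
    intros u Hu. apply ind_out; intros Hue. apply Hte.
    apply in_level_succs in Hu as [Hu _]; auto.
    apply tle_trans with u; auto. now apply lt_le, succ_lt.
  - intros v Hv Hve Hlev. apply Hphi.
    destruct (not_bad_spec t Hb) as [[Hnd Hin] _].
    assert (Hc : tends0 (fun _ => lsum (level_succs t) (ind e) - ind e v)).
    { apply (sum_single (fun _ => ind e)); auto.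
      - apply Hin; now split.
      - intros u Hu Huv. apply nul_const, ind_out; intros Hue. apply Huv.
        apply Hin in Hu as [Hu _]. now apply (succ_comparable t u v e). }
    apply (proj1 (tends0_const _)) in Hc. unfold phi. rewrite !ind_in in *; auto; [lra |].
    apply tle_trans with v; auto. now apply lt_le, succ_lt.
Qed.

Lemma phi_step t l : phi t (stepf l) <> 0 -> exists p, In p l /\ phi t (ind (snd p)) <> 0.
Proof.
  induction l as [| [c e] l IH]; intros H.
  - exfalso; apply H. unfold phi. rewrite lsum_none; [unfold stepf, lsum; simpl; ring |].
    reflexivity.
  - destruct (Req_dec (phi t (ind e)) 0) as [E | E].
    + destruct IH as (p & Hp & Hp'); [| exists p; split; [right |]; auto].
      intros E'; apply H.
      replace (stepf ((c, e) :: l)) with (fun x => c * ind e x + 1 * stepf l x)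
        by (apply functional_extensionality; intros; rewrite stepf_cons; ring).
      rewrite phi_lin, E, E'; ring.
    + exists (c, e); split; [left |]; auto.
Qed.

(** A large coordinate of [f] survives in a step function within [eps / 2], hence in one of its
    finitely many indicators; each end and label allow only one [t]. *)
Lemma phi_finite f eps : C0 T le f -> 0 < eps -> exists U, forall t,
  In t U <-> ~ bad t /\ eps <= exit_weight t * Rabs (phi t f).
Proof.
  intros Hf Heps.
  destruct (step_approximation f (fun _ => True) Hf ltac:(tauto) (eps / 2)) as (l & _ & Hl);
    [lra |].
  destruct (C0_bounded f Hf) as (M & HM1 & HfM1).
  assert (HM : 0 < M) by lra.
  assert (HfM : forall x, Rabs (f x) <= M) by (intros x; specialize (HfM1 x); lra).
  destruct (half_pow_label (eps / M)) as [n0 Hn0]; [now apply Rdiv_lt_0_compat |].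
  apply (finite_of_cover (fun t p => exits_over (fst p) t /\ le t (snd p) /\
           forall v, succ t v -> le v (snd p) -> rho v <> rho t)
           (list_prod (seq 0 n0) (map snd l))).
  - intros t [Hb Ht].
    assert (Hw := exit_weight_pos t).
    assert (Hstep : phi t (stepf l) <> 0).
    { intros E.
      assert (Hd := phi_weight_bound t (fun x => 1 * f x + (-1) * stepf l x) (eps / 2)).
      rewrite phi_lin, E in Hd.
      replace (1 * phi t f + -1 * 0) with (phi t f) in Hd by ring.
      assert (Hh := half_pow_le (exit_label t)).
      assert ((/ 2) ^ exit_label t * (eps / 2) <= 1 * (eps / 2))
        by (apply Rmult_le_compat_r; lra).
      assert (exit_weight t * Rabs (phi t f) <= (/ 2) ^ exit_label t * (eps / 2)); [| lra].
      apply Hd. intros x. replace (1 * f x + -1 * stepf l x) with (f x - stepf l x) by ring.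
      auto. }
    destruct (phi_step t l Hstep) as (p & Hp & Hpe).
    destruct (phi_ind t (snd p) Hb Hpe) as [H1 H2].
    exists (exit_label t, snd p). split; [apply in_prod |].
    + apply in_seq. assert (H := Hn0 (exit_label t)). assert (exit_label t < n0)%nat; [| lia].
      apply H. apply Rmult_le_reg_r with M; auto.
      replace (eps / M * M) with eps by (field; lra).
      eapply Rle_trans; [apply Ht | now apply phi_weight_bound].
    + now apply in_map.
    + split; [now apply exit_label_spec | split; auto].
  (* The successor of [t] towards [t'] lies beyond the rational, whereas [rho t'] is at most that
     rational. *)
  - assert (Hasym : forall t t' n e, exits_over n t -> exits_over n t' -> lt t t' -> le t' e ->
      (forall v, succ t v -> le v e -> rho v <> rho t) -> False).
    { intros t t' n e [_ A] [B _] Hlt Hle Hx.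
      destruct (succ_exists t t' Hlt) as (v & Hv & Hvt).
      specialize (A v Hv (Hx v Hv (tle_trans _ _ _ Hvt Hle))).
      assert (H := rho_incr _ _ Hvt). lra. }
    intros t t' [n e] _ _ (A1 & A2 & A3) (B1 & B2 & B3); simpl in *.
    destruct (comparable t t' e) as [H | H]; auto; destruct (le_cases _ _ H) as [? | Hlt]; auto.
    + destruct (Hasym t t' n e); auto.
    + destruct (Hasym t' t n e); auto.
Qed.

Lemma coord_c0 f eps : C0 T le f -> 0 < eps ->
  exists l, forall i, eps <= Rabs (coord i f) -> In i l.
Proof.
  intros Hf Heps.
  destruct (C0_bounded f Hf) as (M & HM1 & HfM1).
  assert (HM : 0 < M) by lra.
  assert (HfM : forall x, Rabs (f x) <= M) by (intros x; specialize (HfM1 x); lra).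
  destruct (jump_finite f (eps / M) eps Hf) as [U1 H1]; auto.
  { now apply Rdiv_lt_0_compat. }
  destruct (phi_finite f eps Hf Heps) as [U2 H2].
  exists (map inl U1 ++ map inr U2).
  intros [y | t] Hi; simpl in Hi; apply in_or_app;
    destruct excluded_middle_informative as [Hd | Hd];
    try (rewrite Rabs_R0 in Hi; lra).
  - left. apply in_map. apply H1. assert (Hw := jump_weight_bounds y).
    rewrite Rabs_mult, Rabs_pos_eq in Hi by lra. split; [auto | split].
    + apply Rmult_le_reg_r with M; auto. replace (eps / M * M) with eps by (field; lra).
      eapply Rle_trans; [apply Hi |]. apply Rmult_le_compat_l; [lra | auto].
    + exists y; split; [apply tle_refl |].
      assert (jump_weight y * Rabs (f y) <= 1 * Rabs (f y))
        by (apply Rmult_le_compat_r; [apply Rabs_pos | lra]). lra.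
  - right. apply in_map. apply H2. assert (Hw := exit_weight_pos t).
    rewrite Rabs_mult, Rabs_pos_eq in Hi by lra. auto.
Qed.

Lemma coord_jump y f : jump y -> coord (inl y) f = jump_weight y * f y.
Proof. intros H; simpl; destruct excluded_middle_informative; tauto. Qed.

Lemma coord_phi t f : ~ bad t -> coord (inr t) f = exit_weight t * phi t f.
Proof. intros H; simpl; destruct excluded_middle_informative; tauto. Qed.

Lemma coord_injection :
  bounded_linear_injection (C0 T le) (@c0 (T + T)) (fun f i => coord i f).
Proof.
  refine (conj _ (conj _ (conj _ (conj _ _)))).
  - intros f Hf eps Heps. now apply coord_c0.
  - intros f g _ _ i.
    replace (fun x => f x + g x) with (fun x => 1 * f x + 1 * g x) by fun_ring.
    rewrite coord_lin; ring.
  - intros f c _ i.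
    replace (fun x => c * f x) with (fun x => c * f x + 0 * f x) by fun_ring.
    rewrite coord_lin; ring.
  - exists 1; intros f Hf. rewrite Rmult_1_l. apply supn_lub; [apply supn_nonneg |].
    intros i. apply coord_bound; [apply supn_nonneg |]. intros x. now apply C0_le_supn.
  - intros f g Hf Hg Heq x.
    set (d := fun x => 1 * f x + (-1) * g x).
    assert (Hd : C0 T le d) by now apply C0_lin.
    assert (Hdi : forall i, coord i d = 0).
    { intros i. unfold d. rewrite coord_lin, Heq. ring. }
    assert (Hn : nul (fun _ => d) x).
    { apply (all_nul (fun _ => d) (fun _ => True)); auto.
      - intros y _ Hy. apply nul_const. specialize (Hdi (inl y)).
        rewrite coord_jump in Hdi by auto. assert (Hw := jump_weight_bounds y).
        apply Rmult_integral in Hdi as [? | ?]; auto; lra.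
      - intros t _ Ht. apply tends0_const. specialize (Hdi (inr t)).
        rewrite coord_phi in Hdi by auto. assert (Hw := exit_weight_pos t).
        apply Rmult_integral in Hdi as [? | ?]; auto; lra.
      - now apply const_h_limit.
      - now apply const_h_vanish. }
    apply nul_const in Hn. unfold d in Hn. lra.
Qed.

(** * Points recoverable from active indices *)

(* [acc a e]: the point [e] can be recovered from [a] alone.  By uniqueness of bad points on a
   level, each [a] gives at most four such points: itself, its predecessor, the bad point on
   the level of [a], and the bad point on the level that ends just below [a]. *)
Definition acc (a e : T) : Prop :=
  e = a \/ succ e a \/
  (bad e /\ exists w, le w a /\ le w e /\ rho w = rho a /\ rho e = rho w) \/
  (bad e /\ exists w, lt w a /\ le w e /\ rho e = rho w /\
     forall v, le w v -> lt v a -> rho v = rho w).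

Definition is_meet (m x y : T) : Prop :=
  le m x /\ le m y /\ forall v, le v x -> le v y -> le v m.

(** Meets are included because a point where the support of [f] splits is located as the meet of two
    points recoverable on the two branches. *)
Definition accessible (A : T -> Prop) (e : T) : Prop :=
  (exists a, A a /\ acc a e) \/
  exists a a' e1 e2, A a /\ A a' /\ acc a e1 /\ acc a' e2 /\ is_meet e e1 e2.

Lemma finite_of_unique (P : T -> Prop) : (forall e e', P e -> P e' -> e = e') ->
  exists l, forall e, P e -> In e l.
Proof.
  intros H. destruct (classic (exists e, P e)) as [[e He] | Hn].
  - exists [e]; intros e' He'; left; auto.
  - exists []; intros e He; exfalso; apply Hn; now exists e.
Qed.

Lemma acc_finite a : exists l, forall e, acc a e -> In e l.
Proof.
  destruct (finite_of_unique (fun e => succ e a)) as [l1 H1].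
  { intros e e' He He'. apply tle_antisym.
    - apply (succ_le_lt e' a); auto. now apply succ_lt.
    - apply (succ_le_lt e a); auto. now apply succ_lt. }
  destruct (finite_of_unique (fun e => bad e /\
     exists w, le w a /\ le w e /\ rho w = rho a /\ rho e = rho w)) as [l2 H2].
  { intros e e' (Hb & w & A & B & C & D) (Hb' & w' & A' & B' & C' & D').
    destruct (comparable w w' a) as [H | H]; auto.
    - apply (rho_bad w); auto; try congruence. now apply tle_trans with w'.
    - apply (rho_bad w'); auto; try congruence. now apply tle_trans with w. }
  destruct (finite_of_unique (fun e => bad e /\
     exists w, lt w a /\ le w e /\ rho e = rho w /\
       forall v, le w v -> lt v a -> rho v = rho w)) as [l3 H3].
  { intros e e' (Hb & w & A & B & C & D) (Hb' & w' & A' & B' & C' & D').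
    destruct (comparable w w' a) as [H | H]; auto using lt_le.
    - apply (rho_bad w); auto.
      + now apply tle_trans with w'.
      + rewrite C'; auto.
    - apply (rho_bad w'); auto.
      + now apply tle_trans with w.
      + rewrite C; auto. }
  exists (a :: l1 ++ l2 ++ l3). intros e [-> | [H | [H | H]]]; [left; auto | | |];
    right; apply in_or_app; [left; auto | right | right]; apply in_or_app; auto.
Qed.

Lemma is_meet_unique m m' x y : is_meet m x y -> is_meet m' x y -> m = m'.
Proof. intros (A & B & C) (A' & B' & C'). apply tle_antisym; auto. Qed.

Lemma accessible_finite (A : list T) :
  exists l, forall e, accessible (fun a => In a A) e -> In e l.
Proof.
  assert (H1 : exists l1, forall a e, In a A -> acc a e -> In e l1).
  { induction A as [| a A [l Hl]].
    - exists []; intros a e [].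
    - destruct (acc_finite a) as [l' Hl']. exists (l' ++ l).
      intros b e [<- | Hb] He; apply in_or_app; eauto. }
  destruct H1 as [l1 H1].
  assert (H2 : forall L : list (T * T), exists l2, forall p m, In p L ->
            is_meet m (fst p) (snd p) -> In m l2).
  { induction L as [| p L [l Hl]].
    - exists []; intros p m [].
    - destruct (finite_of_unique (fun m => is_meet m (fst p) (snd p))) as [l' Hl'].
      { intros; eapply is_meet_unique; eauto. }
      exists (l' ++ l). intros q m [<- | Hq] Hm; apply in_or_app; eauto. }
  destruct (H2 (list_prod l1 l1)) as [l2 Hl2].
  exists (l1 ++ l2). intros e [(a & Ha & He) | (a & a' & e1 & e2 & Ha & Ha' & He1 & He2 & Hm)].
  - apply in_or_app; eauto.
  - apply in_or_app; right. apply (Hl2 (e1, e2) e); auto. apply in_prod; eauto.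
Qed.

Lemma accessible_mono (A B : T -> Prop) e :
  (forall a, A a -> B a) -> accessible A e -> accessible B e.
Proof.
  intros H [(a & Ha & He) | (a & a' & e1 & e2 & Ha & Ha' & He1 & He2 & Hm)].
  - left; exists a; auto.
  - right; exists a, a', e1, e2; auto.
Qed.

Lemma accessible_support (A : T -> Prop) e : accessible A e ->
  exists l, (forall a, In a l -> A a) /\ accessible (fun a => In a l) e.
Proof.
  intros [(a & Ha & He) | (a & a' & e1 & e2 & Ha & Ha' & He1 & He2 & Hm)].
  - exists [a]; split; [intros b [<- | []]; auto |]. left; exists a; simpl; auto.
  - exists [a; a']; split; [intros b [<- | [<- | []]]; auto |].
    right; exists a, a', e1, e2; simpl; auto 10.
Qed.

(** * Active points of a function and its hidden bad points *)

Section Accessibility.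
Variable f : T -> R.
Hypothesis f_C0 : C0 T le f.

(** A jump is active once [f] is nonzero anywhere above it. This matches the oscillation features
    and makes the jump found by [first_exit] active. *)
Definition active (a : T) : Prop :=
  (jump a /\ exists v, le a v /\ f v <> 0) \/ (~ bad a /\ phi a f <> 0).

Definition nonzero_above (u : T) : Prop := exists v, le u v /\ f v <> 0.

Definition hidden (b : T) : Prop := bad b /\ f b <> 0 /\ ~ accessible active b.

Lemma active_nonzero a : active a -> nonzero_above a.
Proof.
  intros [[_ H] | [Hb H]]; auto. apply NNPP; intros Hn. apply H.
  assert (Hz : forall v, le a v -> f v = 0).
  { intros v Hv. apply NNPP; intros Hv0; apply Hn; now exists v. }
  unfold phi. rewrite Hz, lsum_none; [ring | | apply tle_refl].
  intros u Hu. apply Hz. apply in_level_succs in Hu as [Hu _]; auto. now apply lt_le, succ_lt.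
Qed.

Lemma nonzero_above_le u v : le u v -> nonzero_above v -> nonzero_above u.
Proof. intros Huv (x & Hx & Hfx). exists x; split; auto. now apply tle_trans with v. Qed.

(** On a cone without active points all coordinates of [f] vanish, so the results on null sequences
    apply there to the constant sequence [f]. *)
Lemma quiet s : (forall a, le s a -> ~ active a) -> nonzero_above s ->
  f s <> 0 /\ exists b, bad b /\ le s b /\ rho b = rho s.
Proof.
  intros Hq (v & Hsv & Hv).
  assert (Hj : forall y, le s y -> jump y -> nul (fun _ => f) y).
  { intros y Hy Jy. apply nul_const. apply NNPP; intros Hfy. apply (Hq y Hy).
    left; split; auto. exists y; split; auto using tle_refl. }
  assert (Hp : forall t, le s t -> ~ bad t -> tends0 (fun _ => phi t f)).
  { intros t Ht Hb. apply tends0_const. apply NNPP; intros Hph. apply (Hq t Ht).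
    right; auto. }
  assert (Hfs : f s <> 0).
  { intros Hs. destruct (nul_or_close (fun _ => f) (fun x => le s x)
      (fun x y Hx Hxy => tle_trans s x y Hx Hxy) Hj Hp
      (const_h_limit f f_C0) (const_h_vanish f f_C0) s v) as [H | [_ H]]; auto using tle_refl.
    - now apply nul_const in H.
    - apply Hv. apply nul_const. apply (close_nul (fun _ => f) v s); auto.
      now apply nul_const. }
  split; auto.
  apply (nonnul_below_bad (fun _ => f) (fun x => le s x)
      (fun x y Hx Hxy => tle_trans s x y Hx Hxy) Hj Hp
      (const_h_limit f f_C0) (const_h_vanish f f_C0)); auto using tle_refl.
  now rewrite nul_const.
Qed.

Lemma first_exit t a : le t a -> rho a <> rho t ->
  exists y, lt t y /\ le y a /\ jump y /\ forall v, le t v -> lt v y -> rho v = rho t.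
Proof.
  intros Hta Hne.
  assert (Hlt : rho t < rho a) by (assert (H := rho_incr _ _ Hta); lra).
  destruct (least (fun y => rho t < rho y) a Hlt) as (y & A & B & C).
  assert (Hty : lt t y).
  { destruct (comparable_lt y t a) as [H | H]; auto. apply rho_incr in H; lra. }
  exists y; repeat split; auto.
  - apply Hty.
  - apply Hty.
  - apply (jump_of_gap y (rho t)); auto. intros s Hs. apply Rnot_lt_le. now apply C.
  - intros v Hv Hvy. assert (H := rho_incr _ _ Hv). assert (H' := C v Hvy). lra.
Qed.

(** If [a] is on the level of [t], then [b] is the bad point on the level of [a]. Otherwise the path
    to [a] leaves the level at an active jump, and [b] is the bad point on the level ending just
    below that jump. *)
Lemma bad_accessible t a b : bad b -> le t b -> rho b = rho t -> le t a ->
  nonzero_above a -> active a \/ rho a <> rho t -> exists a', active a' /\ acc a' b.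
Proof.
  intros Hb Htb Hrb Hta Hnz Ha.
  destruct (Req_dec (rho a) (rho t)) as [E | E].
  - destruct Ha as [Ha | Ha]; [| contradiction]. exists a; split; auto.
    right; right; left. split; auto. exists t; auto.
  - destruct (first_exit t a Hta E) as (y & H1 & H2 & H3 & H4).
    exists y; split.
    + left; split; auto. now apply nonzero_above_le with a.
    + right; right; right. split; auto. exists t; auto.
Qed.

Lemma is_meet_branch t u u' x y : succ t u -> succ t u' -> u <> u' -> le u x -> le u' y ->
  is_meet t x y.
Proof.
  intros Hu Hu' Hne Hx Hy.
  assert (Hbr : forall u x v, succ t u -> le u x -> le v x -> le v t \/ le u v).
  { intros w z v Hw Hz Hv. destruct (comparable_lt w v z) as [H | H]; auto.
    left; now apply (succ_le_lt t w). }
  split; [| split].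
  - apply tle_trans with u; auto. now apply lt_le, succ_lt.
  - apply tle_trans with u'; auto. now apply lt_le, succ_lt.
  - intros v Hvx Hvy. destruct (Hbr u x v) as [? | H1]; auto.
    destruct (Hbr u' y v) as [? | H2]; auto.
    exfalso; apply Hne. now apply (succ_comparable t u u' v).
Qed.

Lemma branch_cases u : nonzero_above u ->
  (exists a, le u a /\ active a) \/
  ((forall a, le u a -> ~ active a) /\ f u <> 0 /\ exists b, bad b /\ le u b /\ rho b = rho u).
Proof.
  intros Hu. destruct (classic (exists a, le u a /\ active a)) as [? | Hn]; auto.
  right. assert (Hq : forall a, le u a -> ~ active a).
  { intros a H1 H2; apply Hn; now exists a. }
  split; auto. now apply quiet.
Qed.

Lemma branch_level t u : ~ accessible active t -> succ t u -> nonzero_above u ->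
  rho u = rho t.
Proof.
  intros Ht Hu Hnz. destruct (jump_or_level t u Hu) as [Hj | ?]; auto.
  exfalso; apply Ht. left; exists u; split; [left; auto |]. right; left; auto.
Qed.

(** Each branch with nonzero values contains an active point or the bad point of the level. Two
    active points have [t] as meet; a bad point opposite an active one is recoverable from it or
    from an exit below it, so [t] is again a meet; two bad points coincide. *)
Lemma branch_unique t u u' : ~ accessible active t -> succ t u -> succ t u' ->
  nonzero_above u -> nonzero_above u' -> u = u'.
Proof.
  intros Ht Hu Hu' Hn Hn'. apply NNPP; intros Hne.
  assert (Hl := branch_level t u Ht Hu Hn). assert (Hl' := branch_level t u' Ht Hu' Hn').
  assert (Htu := lt_le _ _ (succ_lt _ _ Hu)). assert (Htu' := lt_le _ _ (succ_lt _ _ Hu')).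
  assert (Hmix : forall u u' a b, succ t u -> succ t u' -> u <> u' -> le u a -> active a ->
            bad b -> le u' b -> rho b = rho u' -> rho u' = rho t -> False).
  { clear - Ht rho_incr rho_bad Htree Hhaus f_C0.
    intros u u' a b Hu Hu' Hne Ha Hac Hb Hub Hrb Hr. apply Ht.
    destruct (bad_accessible t a b) as (a' & H1 & H2); auto using active_nonzero.
    - apply tle_trans with u'; auto. now apply lt_le, succ_lt.
    - congruence.
    - apply tle_trans with u; auto. now apply lt_le, succ_lt.
    - right; exists a, a', a, b. repeat (split; auto); try now left.
      + apply tle_trans with u; auto. now apply lt_le, succ_lt.
      + apply tle_trans with u'; auto. now apply lt_le, succ_lt.
      + now apply (is_meet_branch t u u' a b). }
  destruct (branch_cases u Hn) as [(a & Ha1 & Ha2) | (_ & _ & b & Hb1 & Hb2 & Hb3)];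
    destruct (branch_cases u' Hn') as [(a' & Ha1' & Ha2') | (_ & _ & b' & Hb1' & Hb2' & Hb3')].
  - apply Ht. right; exists a, a', a, a'. repeat (split; auto); try now left.
    + now apply tle_trans with u.
    + now apply tle_trans with u'.
    + now apply (is_meet_branch t u u').
  - apply (Hmix u u' a b'); auto.
  - apply (Hmix u' u a' b); auto.
  - assert (b = b').
    { apply (rho_bad t); auto; try congruence.
      - now apply tle_trans with u.
      - now apply tle_trans with u'. }
    subst b'. apply Hne. now apply (succ_comparable t u u' b).
Qed.

Lemma bad_no_branch t u : ~ accessible active t -> bad t -> succ t u -> ~ nonzero_above u.
Proof.
  intros Ht Hb Hu Hn. assert (Hl := branch_level t u Ht Hu Hn).
  assert (Htu := succ_lt _ _ Hu).
  destruct (branch_cases u Hn) as [(a & Ha1 & Ha2) | (_ & _ & b & Hb1 & Hb2 & Hb3)].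
  - destruct (bad_accessible t a t) as (a' & H1 & H2); auto using tle_refl, active_nonzero.
    + apply tle_trans with u; auto using lt_le.
    + apply Ht. left; now exists a'.
  - assert (Htb : lt t b) by now apply lt_le_trans with u.
    assert (t = b).
    { apply (rho_bad t); auto using tle_refl, lt_le. congruence. }
    subst; now apply (lt_irrefl b).
Qed.

(** The hypothesis of [step_approximation], with the recoverable and the hidden points as [E]. *)
Lemma no_jump_off_accessible t : ~ (accessible active t \/ hidden t) ->
  (forall v, le t v -> f v = 0) \/
  exists u, succ t u /\ f u = f t /\ forall v, lt t v -> ~ le u v -> f v = 0.
Proof.
  intros Ht. assert (Ha : ~ accessible active t) by tauto.
  assert (Hh : ~ hidden t) by tauto.
  assert (Hphi : ~ bad t -> phi t f = 0).
  { intros Hb. apply NNPP; intros Hp. apply Ha. left; exists t; split; [right; auto |].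
    now left. }
  destruct (classic (exists u, succ t u /\ nonzero_above u)) as [(u & Hu & Hn) | Hno].
  - right; exists u; split; auto.
    assert (Hb : ~ bad t) by (intros Hb; now apply (bad_no_branch t u)).
    split.
    + apply Rminus_diag_uniq. apply tends0_const.
      apply (phi_single (fun _ => f) (eq t)); auto.
      * intros t' <- _. now apply tends0_const, Hphi.
      * split; auto. now apply branch_level.
      * intros u' [Hu' _] Hne. apply nul_const. apply NNPP; intros Hf. apply Hne.
        apply (branch_unique t); auto. exists u'; split; auto using tle_refl.
    + intros v Htv Huv. apply NNPP; intros Hf. apply Huv.
      destruct (succ_exists t v Htv) as (u' & Hu' & Hv).
      rewrite (branch_unique t u u'); auto. now exists v.
  - left.
    assert (Hz : forall v, lt t v -> f v = 0).
    { intros v Hv. apply NNPP; intros Hf. apply Hno.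
      destruct (succ_exists t v Hv) as (u' & Hu' & Huv). exists u'; split; auto.
      now exists v. }
    assert (Hft : f t = 0).
    { destruct (classic (bad t)) as [Hb | Hb].
      - apply NNPP; intros Hf. apply Hh. split; auto.
      - apply nul_const. apply (phi_none (fun _ => f) (eq t)); auto.
        + intros t' <- _. now apply tends0_const, Hphi.
        + intros u [Hu _]. apply nul_const, Hz. now apply succ_lt. }
    intros v Hv. destruct (le_cases _ _ Hv) as [<- | Hv']; auto.
Qed.

(** Let [x] be the first point on the level of [b]. It is no jump, since otherwise [b] would be
    recoverable from it; so it is a limit point with [rho] strictly smaller below. Nothing
    recoverable lies above [x], and another hidden point there would share the level with [b] or
    reveal [b] through an exit. *)
Lemma hidden_isolated b (F : list T) : hidden b ->
  (forall e, In e F -> accessible active e \/ hidden e) ->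
  exists a, jump a /\ le a b /\ forall e, In e F -> le a e -> e = b.
Proof.
  intros (Hb & Hfb & Hnb) HF.
  destruct (least (fun s => le s b /\ rho s = rho b) b) as (x & [A B] & _ & C).
  { split; auto using tle_refl. }
  assert (Cx : forall s, lt s x -> rho s < rho x).
  { intros s Hs. assert (H := rho_lt _ _ Hs).
    destruct (Rle_lt_or_eq_dec _ _ H) as [? | E]; auto. exfalso.
    apply (C s Hs). split; [| congruence]. apply tle_trans with x; auto using lt_le. }
  assert (Hnj : ~ jump x).
  { intros Hj. apply Hnb. left; exists x; split.
    - left; split; auto. now exists b.
    - right; right; left. split; auto. exists x; auto using tle_refl. }
  assert (Hx : limit x).
  { destruct (rank_cases x) as [Hm | [[t Ht] | Hl]]; auto; exfalso.
    - apply Hnj. apply (jump_of_gap x (rho x - 1)); [| lra].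
      intros s Hs; exfalso; now apply (Hm s).
    - destruct (jump_or_level t x Ht) as [? | E]; [contradiction |].
      assert (H := Cx t (succ_lt _ _ Ht)). lra. }
  assert (Hin : forall a, active a -> ~ le x a).
  { intros a Ha Hxa. apply Hnb. left. apply (bad_accessible x a b); auto.
    now apply active_nonzero. }
  assert (Hacc : forall a e, active a -> acc a e -> ~ le x e).
  { intros a e Ha He Hxe. apply (Hin a Ha).
    assert (Hw : forall w, le w a -> le w e -> rho e = rho w -> le x a).
    { intros w H1 H2 H3. destruct (comparable_lt x w e) as [H | H]; auto.
      - now apply tle_trans with w.
      - assert (H4 := Cx w H). assert (H5 := rho_incr _ _ Hxe). lra. }
    destruct He as [-> | [He | [(_ & w & ? & ? & ? & ?) | (_ & w & ? & ? & ? & ?)]]]; auto.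
    - apply tle_trans with e; auto. now apply lt_le, succ_lt.
    - now apply (Hw w).
    - apply (Hw w); auto using lt_le. }
  assert (HFx : forall e, In e F -> le x e -> e = b).
  { intros e He Hxe. destruct (HF e He) as [[(a & Ha & Hae) | Hm] | (He1 & He2 & He3)].
    - exfalso; now apply (Hacc a e).
    - destruct Hm as (a & a' & e1 & e2 & Ha & _ & He1 & _ & Hm & _).
      exfalso; apply (Hacc a e1); auto. now apply tle_trans with e.
    - destruct (Req_dec (rho e) (rho x)) as [E | E].
      + apply (rho_bad x); auto.
      + exfalso. apply Hnb. left. apply (bad_accessible x e b); auto.
        exists e; split; auto using tle_refl. }
  (* As [x] itself is no jump, the cone starts slightly lower, past all branches towards other
     members of [F]; [rho] increases between [y0] and [x], which yields a jump there. *)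
  destruct (limit_not_le_list x F Hx) as (y0 & Hy0 & H0).
  destruct (first_exit y0 x) as (a & H1 & H2 & H3 & _); auto using lt_le.
  { assert (H := Cx y0 Hy0). lra. }
  exists a. split; [auto | split; [now apply tle_trans with x |]].
  intros e He Hae. apply HFx; auto. apply NNPP; intros Hxe.
  now apply (H0 a e He Hxe (lt_le _ _ H1)).
Qed.
End Accessibility.

(** * The midpoint locally uniformly convex norm *)

Section Midpoint.

(** [None] is the point at infinity, where all functions vanish; a pair containing it turns an
    oscillation into a value. *)
Definition fext (f : T -> R) (o : option T) : R := match o with Some x => f x | None => 0 end.

Definition ole (o : option T) (e : T) : Prop :=
  match o with Some x => le x e | None => False end.

Definition cut (y : T) (f : T -> R) (o : option T) : R :=
  match o with
  | Some x => if excluded_middle_informative (le y x) then f x else 0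
  | None => 0
  end.

Definition cut_diff (y : T) (p : option T * option T) (f : T -> R) : R :=
  cut y f (fst p) - cut y f (snd p).

Definition osc_sq (y : T) (f : T -> R) : R := supn (fun p => cut_diff y p f ^ 2).

Definition index : Type := ((T + T) + T)%type.

Definition loc (i : index) : T :=
  match i with inl (inl y) => y | inl (inr t) => t | inr y => y end.

Definition feature (i : index) (f : T -> R) : R :=
  match i with
  | inl c => coord c f ^ 2
  | inr y => if excluded_middle_informative (jump y) then jump_weight y * osc_sq y f else 0
  end.

Definition same_cell (A : list index) (o o' : option T) : Prop :=
  forall e, accessible (fun a => In a (map loc A)) e -> (ole o e <-> ole o' e).

(** The strict order makes every limit point fit one of two cases: it is outside with all points
    below it, or its cone contains a left interval at it. *)
Definition outside (B : list index) (o : option T) : Prop :=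
  match o with Some x => forall a, In a (map loc B) -> ~ lt a x | None => True end.

Definition comparable_pair (A B : list index) (p : option T * option T) : Prop :=
  same_cell A (fst p) (snd p) /\ outside B (fst p) /\ outside B (snd p).

Definition cell_diff (A B : list index) (p : option T * option T) (f : T -> R) : R :=
  if excluded_middle_informative (comparable_pair A B p)
  then fext f (fst p) - fext f (snd p) else 0.

Definition cell_osc_sq (A B : list index) (f : T -> R) : R :=
  supn (fun p => cell_diff A B p f ^ 2).

Lemma sq_qsn_bound (L : (T -> R) -> R) :
  (forall f g, L (fun x => f x + g x) = L f + L g) ->
  (forall c f, L (fun x => c * f x) = c * L f) ->
  (forall f M, 0 <= M -> (forall x, Rabs (f x) <= M) -> Rabs (L f) <= 2 * M) ->
  qsn T (C0 T le) (fun f => L f ^ 2) /\ qbd T (C0 T le) 4 (fun f => L f ^ 2).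
Proof.
  intros H1 H2 H3; split.
  - apply (qsn_square T (C0 T le) L); auto.
  - intros f Hf. replace (4 * supn f ^ 2) with ((2 * supn f) ^ 2) by ring.
    apply sq_le_of_abs, H3; [apply supn_nonneg |]. intros x; now apply C0_le_supn.
Qed.

Lemma cut_bound y f o M : 0 <= M -> (forall x, Rabs (f x) <= M) -> Rabs (cut y f o) <= M.
Proof.
  intros HM H. destruct o as [x |]; simpl; [destruct excluded_middle_informative |]; auto;
    rewrite Rabs_R0; auto.
Qed.

Lemma fext_bound f o M : 0 <= M -> (forall x, Rabs (f x) <= M) -> Rabs (fext f o) <= M.
Proof. intros HM H. destruct o as [x |]; simpl; auto. rewrite Rabs_R0; auto. Qed.

Lemma diff_bound a b M : Rabs a <= M -> Rabs b <= M -> Rabs (a - b) <= 2 * M.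
Proof. abs_lra. Qed.

Lemma cut_diff_qsn y p : qsn T (C0 T le) (fun f => cut_diff y p f ^ 2) /\
  qbd T (C0 T le) 4 (fun f => cut_diff y p f ^ 2).
Proof.
  apply (sq_qsn_bound (cut_diff y p)); unfold cut_diff.
  - intros f g. destruct p as [[x |] [x' |]]; simpl;
      repeat destruct excluded_middle_informative; ring.
  - intros c f. destruct p as [[x |] [x' |]]; simpl;
      repeat destruct excluded_middle_informative; ring.
  - intros f M HM H. apply diff_bound; now apply cut_bound.
Qed.

Lemma osc_sq_qsn y : qsn T (C0 T le) (osc_sq y).
Proof.
  apply (qsn_sup T (C0 T le) C0_plus (fun p f => cut_diff y p f ^ 2) 4);
    intros p; apply cut_diff_qsn.
Qed.

Lemma osc_sq_qbd y : qbd T (C0 T le) 4 (osc_sq y).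
Proof.
  apply (qbd_sup T (C0 T le) (fun p f => cut_diff y p f ^ 2) 4); [lra | |];
    intros p; apply cut_diff_qsn.
Qed.

Lemma osc_sq_ge y f p : C0 T le f -> cut_diff y p f ^ 2 <= osc_sq y f.
Proof.
  intros Hf. apply (sup_ub T (C0 T le) (fun p f => cut_diff y p f ^ 2) 4 f p); auto;
    intros q; apply cut_diff_qsn.
Qed.

Lemma cell_diff_qsn A B p : qsn T (C0 T le) (fun f => cell_diff A B p f ^ 2) /\
  qbd T (C0 T le) 4 (fun f => cell_diff A B p f ^ 2).
Proof.
  apply (sq_qsn_bound (cell_diff A B p)); unfold cell_diff;
    destruct excluded_middle_informative as [Hp | Hp].
  - intros f g. destruct p as [[x |] [x' |]]; simpl; ring.
  - intros; ring.
  - intros c f. destruct p as [[x |] [x' |]]; simpl; ring.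
  - intros; ring.
  - intros f M HM H. apply diff_bound; now apply fext_bound.
  - intros f M HM H. rewrite Rabs_R0; lra.
Qed.

Lemma cell_osc_sq_qsn A B : qsn T (C0 T le) (cell_osc_sq A B).
Proof.
  apply (qsn_sup T (C0 T le) C0_plus (fun p f => cell_diff A B p f ^ 2) 4);
    intros p; apply cell_diff_qsn.
Qed.

Lemma cell_osc_sq_qbd A B : qbd T (C0 T le) 4 (cell_osc_sq A B).
Proof.
  apply (qbd_sup T (C0 T le) (fun p f => cell_diff A B p f ^ 2) 4); [lra | |];
    intros p; apply cell_diff_qsn.
Qed.

Lemma cell_osc_sq_ge A B p f : C0 T le f -> cell_diff A B p f ^ 2 <= cell_osc_sq A B f.
Proof.
  intros Hf. apply (sup_ub T (C0 T le) (fun p f => cell_diff A B p f ^ 2) 4 f p); auto;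
    intros q; apply cell_diff_qsn.
Qed.

Lemma coord_sq_qsn c : qsn T (C0 T le) (fun f => coord c f ^ 2) /\
  qbd T (C0 T le) 4 (fun f => coord c f ^ 2).
Proof.
  apply (sq_qsn_bound (coord c)).
  - intros f g. replace (fun x => f x + g x) with (fun x => 1 * f x + 1 * g x) by fun_ring.
    rewrite coord_lin; ring.
  - intros a f. replace (fun x => a * f x) with (fun x => a * f x + 0 * f x) by fun_ring.
    rewrite coord_lin; ring.
  - intros f M HM H. assert (Hc := coord_bound c f M HM H). lra.
Qed.

Lemma feature_qsn i : qsn T (C0 T le) (feature i).
Proof.
  destruct i as [c | y]; [exact (proj1 (coord_sq_qsn c)) |].
  unfold feature; destruct (excluded_middle_informative (jump y)); [| apply qsn_zero].
  apply qsn_scal; [left; apply jump_weight_bounds | apply osc_sq_qsn].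
Qed.

Lemma feature_qbd i : qbd T (C0 T le) 4 (feature i).
Proof.
  destruct i as [c | y]; [exact (proj2 (coord_sq_qsn c)) |].
  intros f Hf. simpl feature.
  assert (H0 : 0 <= 4 * supn f ^ 2) by (apply Rmult_le_pos; [lra | apply pow2_ge_0]).
  destruct excluded_middle_informative; auto.
  assert (H := osc_sq_qbd y f Hf). assert (Hw := jump_weight_bounds y).
  assert (H1 := proj1 (osc_sq_qsn y) f Hf).
  assert (jump_weight y * osc_sq y f <= 1 * osc_sq y f) by (apply Rmult_le_compat_r; lra). lra.
Qed.

Lemma feature_c0 f : C0 T le f -> forall eps, 0 < eps ->
  exists l, forall i, eps <= feature i f -> In i l.
Proof.
  intros Hf eps Heps.
  destruct (coord_c0 f (Rmin 1 eps) Hf) as [l1 Hl1]; [apply Rmin_pos; lra |].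
  set (S := 4 * supn f ^ 2 + 1).
  assert (HS : 0 < S) by (unfold S; generalize (pow2_ge_0 (supn f)); lra).
  (* If [f] is at most [d = Rmin 1 (eps / 5)] on the cone, its squared oscillation is at most
     [4 * d ^ 2 <= 4 * d], which is below [eps]. *)
  destruct (jump_finite f (eps / S) (Rmin 1 (eps / 5)) Hf) as [U HU].
  { now apply Rdiv_lt_0_compat. }
  { apply Rmin_pos; lra. }
  exists (map inl l1 ++ map inr U). intros [c | y] Hi; simpl in Hi; apply in_or_app.
  - left; apply in_map, Hl1. apply Rnot_lt_le; intros Hlt.
    assert (H1 := Rmin_l 1 eps). assert (H2 := Rmin_r 1 eps). assert (H3 := Rabs_pos (coord c f)).
    change (eps <= coord c f ^ 2) in Hi. rewrite <- pow2_abs in Hi. nra.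
  - destruct excluded_middle_informative as [Hj |]; [| lra].
    right; apply in_map, HU. assert (Hw := jump_weight_bounds y).
    assert (Ho := osc_sq_qbd y f Hf). split; [auto | split].
    + apply Rmult_le_reg_r with S; auto. replace (eps / S * S) with eps by (field; lra).
      eapply Rle_trans; [apply Hi |]. apply Rmult_le_compat_l; unfold S; lra.
    + apply NNPP; intros Hn. set (d := Rmin 1 (eps / 5)) in *.
      assert (Hd : 0 < d) by (apply Rmin_pos; lra).
      assert (Hs : forall x, le y x -> Rabs (f x) <= d).
      { intros x Hx. apply Rnot_lt_le; intros Hlt. apply Hn; exists x; split; auto; lra. }
      assert (Hcut : forall o, Rabs (cut y f o) <= d).
      { intros [x |]; simpl; [destruct excluded_middle_informative; auto |];
          rewrite Rabs_R0; lra. }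
      assert (Hosc : osc_sq y f <= (2 * d) ^ 2).
      { apply supn_lub; [apply pow2_ge_0 |]. intros p. rewrite Rabs_pos_eq by apply pow2_ge_0.
        apply sq_le_of_abs; unfold cut_diff; apply diff_bound; auto. }
      assert (H1 := Rmin_l 1 (eps / 5)). assert (H2 := Rmin_r 1 (eps / 5)). fold d in H1, H2.
      assert (H3 := proj1 (osc_sq_qsn y) f Hf).
      assert (jump_weight y * osc_sq y f <= 1 * osc_sq y f) by (apply Rmult_le_compat_r; lra).
      nra.
Qed.

Lemma active_index f a : C0 T le f -> active f a ->
  exists i, loc i = a /\ 0 < feature i f.
Proof.
  intros Hf [[Hj (v & Hv & Hfv)] | [Hb Hp]].
  - exists (inr a); split; auto. simpl. destruct excluded_middle_informative; [| contradiction].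
    apply Rmult_lt_0_compat; [apply jump_weight_bounds |].
    assert (H := osc_sq_ge a f (Some v, None) Hf). unfold cut_diff, cut in H; simpl in H.
    destruct excluded_middle_informative in H; [| contradiction].
    rewrite Rminus_0_r in H. assert (0 < f v ^ 2) by (apply pow2_gt_0; auto). lra.
  - exists (inl (inr a)); split; auto. change (0 < coord (inr a) f ^ 2).
    rewrite coord_phi by auto. apply pow2_gt_0. apply Rmult_integral_contrapositive; split; auto.
    assert (H := exit_weight_pos a). lra.
Qed.

Lemma active_indices f (P : list T) : C0 T le f -> (forall a, In a P -> active f a) ->
  exists J, (forall i, In i J -> 0 < feature i f) /\ forall a, In a P -> In a (map loc J).
Proof.
  intros Hf. induction P as [| a P IH]; intros H.
  - exists []; split; [intros i [] | intros a []].
  - destruct IH as (J & H1 & H2); [intros; apply H; right; auto |].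
    destruct (active_index f a Hf (H a (or_introl eq_refl))) as (i & Hi & Hfi).
    exists (i :: J); split.
    + intros j [<- | Hj]; auto.
    + intros b [<- | Hb]; simpl; auto.
Qed.

Lemma fext_stepf l o o' : (forall p, In p l -> ole o (snd p) <-> ole o' (snd p)) ->
  fext (stepf l) o = fext (stepf l) o'.
Proof.
  intros H. destruct o as [x |], o' as [y |]; simpl; auto.
  - now apply stepf_eq.
  - apply stepf_zero. intros p Hp Hx. now apply (H p Hp) in Hx.
  - symmetry; apply stepf_zero. intros p Hp Hx. now apply (H p Hp) in Hx.
Qed.

(* The cells cut out by points accessible from the indices [A] carry [f] up to [2 * eps];
   only the cones above the points of [B], where [f] is nearly a multiple of a single
   indicator, escape this description. *)
Lemma cell_description f eps : C0 T le f -> 0 < eps ->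
  exists l J B, (forall x, Rabs (f x - stepf l x) <= eps) /\
    (forall i, In i J -> 0 < feature i f) /\ incl B J /\
    (forall i, In i B -> jump (loc i) /\
       exists b, le (loc i) b /\ forall e, In e (map snd l) -> le (loc i) e -> e = b) /\
    forall A B', incl J A -> (forall i, In i B' <-> In i B) ->
      forall p, comparable_pair A B' p -> fext (stepf l) (fst p) = fext (stepf l) (snd p).
Proof.
  intros Hf Heps.
  destruct (step_approximation f (fun t => accessible (active f) t \/ hidden f t) Hf
    (no_jump_off_accessible f Hf) eps Heps) as (l & HE & Hl).
  set (F := map snd l).
  assert (HF : forall e, In e F -> accessible (active f) e \/ hidden f e).
  { intros e He. apply in_map_iff in He as (p & <- & Hp). auto. }
  assert (HB : forall F', incl F' F -> exists B : list index,
     (forall i, In i B -> 0 < feature i f) /\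
     (forall i, In i B -> jump (loc i) /\
       exists b, le (loc i) b /\ forall e, In e F -> le (loc i) e -> e = b) /\
     forall b, In b F' -> hidden f b -> exists i, In i B /\ le (loc i) b).
  { induction F' as [| b F' IH]; intros Hin.
    - exists []; split; [| split]; intros i [].
    - destruct IH as (B & H1 & H2 & H3); [intros e He; apply Hin; right; auto |].
      destruct (classic (hidden f b)) as [Hb | Hb].
      + destruct (hidden_isolated f b F Hb HF) as (a & Ha1 & Ha2 & Ha3).
        assert (Hact : active f a).
        { left; split; auto. exists b; split; auto. apply Hb. }
        destruct (active_index f a Hf Hact) as (i & <- & Hi).
        exists (i :: B); split; [| split].
        * intros j [<- | Hj]; auto.
        * intros j [<- | Hj]; auto. split; auto. exists b; auto.
        * intros e [<- | He] Hh; [exists i; split; [left |]; auto |].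
          destruct (H3 e He Hh) as (j & ? & ?). exists j; split; [right |]; auto.
      + exists B; split; [| split]; auto. intros e [<- | He] Hh; [contradiction | auto]. }
  destruct (HB F (incl_refl F)) as (B & HB1 & HB2 & HB3).
  assert (HP : forall F', incl F' F -> exists P, (forall a, In a P -> active f a) /\
     forall e, In e F' -> accessible (active f) e -> accessible (fun a => In a P) e).
  { induction F' as [| e F' IH]; intros Hin.
    - exists []; split; [intros a [] | intros e []].
    - destruct IH as (P & H1 & H2); [intros e' He'; apply Hin; right; auto |].
      destruct (classic (accessible (active f) e)) as [He | He].
      + destruct (accessible_support _ _ He) as (P' & HP1 & HP2).
        exists (P' ++ P); split.
        * intros a Ha. apply in_app_or in Ha as [? | ?]; auto.
        * intros e' [<- | He'] Hacc.
          -- eapply accessible_mono; [| apply HP2]. intros; apply in_or_app; auto.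
          -- eapply accessible_mono; [| now apply H2]. intros; apply in_or_app; auto.
      + exists P; split; auto. intros e' [<- | He'] Hacc; [contradiction | auto]. }
  destruct (HP F (incl_refl F)) as (P & HP1 & HP2).
  destruct (active_indices f P Hf HP1) as (J & HJ1 & HJ2).
  exists l, (B ++ J), B. split; [auto | split; [| split; [| split]]].
  - intros i Hi. apply in_app_or in Hi as [? | ?]; auto.
  - intros i Hi; apply in_or_app; auto.
  - auto.
  - intros A B' HA HB' [o o'] (Hcell & Ho & Ho'); simpl in *.
    apply fext_stepf. intros p Hp.
    assert (Hpe : In (snd p) F) by now apply in_map.
    destruct (classic (accessible (active f) (snd p))) as [Hacc | Hacc].
    + apply Hcell. eapply accessible_mono; [| now apply HP2].
      intros a Ha. apply HJ2 in Ha. apply in_map_iff in Ha as (i & <- & Hi).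
      apply in_map, HA, in_or_app; auto.
    + destruct (HF _ Hpe) as [? | Hh]; [contradiction |].
      destruct (HB3 _ Hpe Hh) as (i & Hi & Hib).
      (* Outside the cone, lying below the hidden point is the same as lying below the apex [loc i],
         which is recoverable from its own index. *)
      assert (Hout : forall q, outside B' q -> (ole q (snd p) <-> ole q (loc i))).
      { intros [x |] Hq; simpl; [| tauto]. split; intros Hx.
        - destruct (comparable_lt x (loc i) (snd p)) as [? | Hlt]; auto.
          exfalso; apply (Hq (loc i)); auto. apply in_map; now apply HB'.
        - now apply tle_trans with (loc i). }
      rewrite (Hout o Ho), (Hout o' Ho'). apply Hcell. left. exists (loc i); split; [| now left].
      apply in_map, HA, in_or_app; auto.
Qed.

(** * Perturbations whose midpoint defect tends to 0 *)

Section Limit.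
Variable N : (T -> R) -> R.
Hypothesis N_feature : forall f i eps, C0 T le f -> 0 < eps ->
  exists C, 0 <= C /\ forall h, C0 T le h ->
     mid_defect (feature i) f h <= eps + C * mid_defect (fun g => N g ^ 2) f h.
Hypothesis N_cell : forall f J B, C0 T le f -> (forall i, In i J -> 0 < feature i f) ->
  incl B J -> exists A B', incl J A /\ (forall i, In i B' <-> In i B) /\
     exists C, 0 <= C /\ forall h, C0 T le h ->
       mid_defect (cell_osc_sq A B') f h <= C * mid_defect (fun g => N g ^ 2) f h.
Variable f : T -> R.
Variable h : nat -> T -> R.
Hypothesis f_C0 : C0 T le f.
Hypothesis h_C0 : forall n, C0 T le (h n).
Hypothesis defect_tends0 : tends0 (fun n => mid_defect (fun g => N g ^ 2) f (h n)).

Lemma C0_defect_nonneg q g : qsn T (C0 T le) q -> C0 T le g -> 0 <= mid_defect q f g.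
Proof.
  intros Hq Hg. apply (mid_defect_nonneg T (C0 T le)); auto using C0_plus.
  intros; now apply C0_scal.
Qed.

Lemma feature_defect_tends0 i : tends0 (fun n => mid_defect (feature i) f (h n)).
Proof.
  intros eps Heps. destruct (N_feature f i (eps / 2) f_C0) as (C & HC & H); [lra |].
  destruct (defect_tends0 (eps / (2 * (C + 1)))) as [n0 Hn0].
  { apply Rdiv_lt_0_compat; lra. }
  exists n0; intros n Hn. specialize (Hn0 n Hn). specialize (H (h n) (h_C0 n)).
  rewrite Rabs_pos_eq by (apply C0_defect_nonneg; auto using feature_qsn).
  assert (Hb : C * mid_defect (fun g => N g ^ 2) f (h n) <= C * (eps / (2 * (C + 1)))).
  { apply Rmult_le_compat_l; auto. eapply Rle_trans; [apply Rle_abs | auto]. }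
  assert (C * (eps / (2 * (C + 1))) <= eps / 2); [| lra].
  apply Rle_trans with ((C + 1) * (eps / (2 * (C + 1)))).
  - apply Rmult_le_compat_r; [| lra]. left; apply Rdiv_lt_0_compat; lra.
  - right; field; lra.
Qed.

Lemma coord_tends0 c : tends0 (fun n => coord c (h n)).
Proof.
  apply tends0_of_sq.
  eapply tends0_ext; [| apply (tends0_lin (/ 2) 0 _ _ (feature_defect_tends0 (inl c))
                                 (feature_defect_tends0 (inl c)))].
  intros n; unfold mid_defect, feature.
  replace (fun x => f x + h n x) with (fun x => 1 * f x + 1 * h n x) by fun_ring.
  replace (fun x => f x - h n x) with (fun x => 1 * f x + (-1) * h n x) by fun_ring.
  rewrite !coord_lin. field.
Qed.

Lemma jump_tends0 y : jump y -> tends0 (fun n => h n y).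
Proof.
  intros Hj. assert (H := coord_tends0 (inl y)). assert (Hw := jump_weight_bounds y).
  eapply tends0_ext; [| apply (tends0_lin (/ jump_weight y) 0 _ _ H H)].
  intros n; cbv beta. rewrite coord_jump by auto. field; lra.
Qed.

Lemma phi_tends0 t : ~ bad t -> tends0 (fun n => phi t (h n)).
Proof.
  intros Hb. assert (H := coord_tends0 (inr t)). assert (Hw := exit_weight_pos t).
  eapply tends0_ext; [| apply (tends0_lin (/ exit_weight t) 0 _ _ H H)].
  intros n; cbv beta. rewrite coord_phi by auto. field; lra.
Qed.

Lemma osc_defect_tends0 y : jump y -> tends0 (fun n => mid_defect (osc_sq y) f (h n)).
Proof.
  intros Hj. assert (H := feature_defect_tends0 (inr y)). assert (Hw := jump_weight_bounds y).
  eapply tends0_ext; [| apply (tends0_lin (/ jump_weight y) 0 _ _ H H)].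
  intros n; unfold mid_defect; simpl. destruct excluded_middle_informative; [| contradiction].
  field; lra.
Qed.

(** The parallelogram identity on one pair, with the two squares bounded by the suprema. A pair
    almost attaining the oscillation of [f] therefore has a small difference for [h n]. *)
Lemma cut_pair_defect y n p : C0 T le (h n) ->
  2 * cut_diff y p f ^ 2 + 2 * cut_diff y p (h n) ^ 2
  <= 2 * osc_sq y f + mid_defect (osc_sq y) f (h n).
Proof.
  intros Hh. unfold mid_defect, cut_diff.
  assert (H1 := osc_sq_ge y _ p (C0_plus f (h n) f_C0 Hh)).
  assert (Hm : C0 T le (fun x => f x - h n x)).
  { apply (V_minus T (C0 T le)); auto using C0_plus. intros; now apply C0_scal. }
  assert (H2 := osc_sq_ge y _ p Hm).
  assert (Ep : forall o, cut y (fun x => f x + h n x) o = cut y f o + cut y (h n) o).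
  { intros [x |]; simpl; [destruct excluded_middle_informative |]; ring. }
  assert (Em : forall o, cut y (fun x => f x - h n x) o = cut y f o - cut y (h n) o).
  { intros [x |]; simpl; [destruct excluded_middle_informative |]; ring. }
  unfold cut_diff in H1, H2. rewrite !Ep in H1. rewrite !Em in H2. nra.
Qed.

Lemma cut_some y g x : le y x -> cut y g (Some x) = g x.
Proof. intros H; simpl; destruct excluded_middle_informative; tauto. Qed.

(** On this cone [f] is nearly [c] times an indicator, so its oscillation is almost attained by
    every pair of a point of the chain and infinity, and by [a] paired with any point off the chain.
    The first pairs bound [h n] on the chain, the second off it. *)
Lemma cone_small a b c eps d : jump a -> le a b -> 0 < d -> 0 < eps ->
  8 * Rabs c * eps + 16 * eps ^ 2 <= d ^ 2 / 2 ->
  (forall x, le a x -> le x b -> Rabs (f x - c) <= eps) ->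
  (forall x, le a x -> ~ le x b -> Rabs (f x) <= eps) ->
  exists n0, forall n, (n0 <= n)%nat -> forall x, le a x -> Rabs (h n x) <= 2 * d.
Proof.
  intros Hj Hab Hd Heps Hsmall Hin Hout.
  assert (Hval : forall o, Rabs (cut a f o) <= eps \/ Rabs (cut a f o - c) <= eps).
  { intros [x |]; simpl; [destruct excluded_middle_informative |].
    - destruct (classic (le x b)); auto.
    - left; rewrite Rabs_R0; lra.
    - left; rewrite Rabs_R0; lra. }
  assert (Hosc : osc_sq a f <= (Rabs c + 2 * eps) ^ 2).
  { apply supn_lub; [apply pow2_ge_0 |]. intros p. rewrite Rabs_pos_eq by apply pow2_ge_0.
    apply sq_le_of_abs; unfold cut_diff.
    destruct (Hval (fst p)) as [H | H]; destruct (Hval (snd p)) as [H' | H'];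
      revert H H'; abs_lra. }
  destruct (osc_defect_tends0 a Hj (d ^ 2)) as [n0 Hn0]; [now apply pow_lt |].
  exists n0; intros n Hn. specialize (Hn0 n Hn).
  assert (Hdef := Rle_trans _ _ _ (Rle_abs _) Hn0).
  assert (Hpair : forall p, Rabs c - 2 * eps <= Rabs (cut_diff a p f) ->
     Rabs (cut_diff a p (h n)) <= d).
  { intros p Hp. apply abs_le_of_sq; [lra |].
    assert (H := cut_pair_defect a n p (h_C0 n)).
    set (v := cut_diff a p f) in *.
    (* The squares of [Rabs c + 2 * eps] and [Rabs c - 2 * eps] differ by [8 * Rabs c * eps]; if
       [Rabs c < 2 * eps], the first square alone is below [16 * eps ^ 2]. *)
    assert (Hv : (Rabs c + 2 * eps) ^ 2 - v ^ 2 <= 8 * Rabs c * eps + 16 * eps ^ 2).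
    { rewrite <- (pow2_abs v). assert (H1 := Rabs_pos v). assert (H2 := Rabs_pos c).
      destruct (Rle_or_lt (2 * eps) (Rabs c)) as [H3 | H3]; nra. }
    lra. }
  assert (Hchain : forall x, le a x -> le x b -> Rabs (h n x) <= d).
  { intros x Hax Hxb. assert (H := Hpair (Some x, None)). unfold cut_diff, fst, snd in H.
    rewrite !cut_some in H by auto. change (cut a f None) with 0 in H.
    change (cut a (h n) None) with 0 in H. rewrite !Rminus_0_r in H. apply H.
    specialize (Hin x Hax Hxb). revert Hin; abs_lra. }
  intros x Hx. destruct (classic (le x b)) as [Hxb | Hxb].
  - specialize (Hchain x Hx Hxb). lra.
  - assert (H := Hpair (Some a, Some x)). unfold cut_diff, fst, snd in H.
    rewrite !cut_some in H by auto using tle_refl.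
    assert (Ha := Hchain a (tle_refl a) Hab).
    assert (H1 := Hin a (tle_refl a) Hab). assert (H2 := Hout x Hx Hxb).
    assert (H3 : Rabs (h n a - h n x) <= d).
    { apply H. revert H1 H2; abs_lra. }
    revert Ha H3; abs_lra.
Qed.

Definition controlled (A B : list index) (d : R) (n : nat) : Prop :=
  (forall i x, In i B -> le (loc i) x -> Rabs (h n x) <= 2 * d) /\
  forall p, comparable_pair A B p -> Rabs (fext (h n) (fst p) - fext (h n) (snd p)) <= d.

Lemma eventually_controlled d : 0 < d ->
  exists A B n0, forall n, (n0 <= n)%nat -> controlled A B d n.
Proof.
  intros Hd.
  destruct (C0_bounded f f_C0) as (M & HM1 & HfM1).
  assert (HM : 1 <= M) by lra.
  assert (HfM : forall x, Rabs (f x) <= M - 1) by (intros x; specialize (HfM1 x); lra).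
  (* The bound [d / 4] makes the squared cell oscillation of [f] at most [(d / 2) ^ 2]. The last
     bound gives the hypothesis of [cone_small]: with [Rabs c <= M] and [eps <= 1 <= M], its left
     side is at most [24 * M * eps <= d ^ 2 / 2]. *)
  set (eps := Rmin 1 (Rmin (d / 4) (d ^ 2 / (48 * M)))).
  assert (Hd2 : 0 < d ^ 2) by now apply pow_lt.
  assert (Heps : 0 < eps).
  { unfold eps; repeat apply Rmin_pos; try lra. apply Rdiv_lt_0_compat; lra. }
  assert (He1 : eps <= 1) by apply Rmin_l.
  assert (He2 : eps <= d / 4) by (eapply Rle_trans; [apply Rmin_r | apply Rmin_l]).
  assert (He3 : eps * (48 * M) <= d ^ 2).
  { replace (d ^ 2) with (d ^ 2 / (48 * M) * (48 * M)) by (field; lra).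
    apply Rmult_le_compat_r; [lra |]. eapply Rle_trans; [apply Rmin_r | apply Rmin_r]. }
  destruct (cell_description f eps f_C0 Heps) as (l & J & B & Hl & HJ & HBJ & HB & Hcell).
  destruct (N_cell f J B f_C0 HJ HBJ) as (A & B' & HA & HB' & C & HC & Hdef).
  assert (Hcells : exists n1, forall n, (n1 <= n)%nat -> forall p, comparable_pair A B' p ->
            Rabs (fext (h n) (fst p) - fext (h n) (snd p)) <= d).
  { assert (Hf2 : cell_osc_sq A B' f <= (2 * eps) ^ 2).
    { apply supn_lub; [apply pow2_ge_0 |]. intros p. rewrite Rabs_pos_eq by apply pow2_ge_0.
      apply sq_le_of_abs. unfold cell_diff.
      destruct excluded_middle_informative as [Hp |]; [| rewrite Rabs_R0; lra].
      assert (E := Hcell A B' HA HB' p Hp).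
      assert (Hle : forall o, Rabs (fext f o - fext (stepf l) o) <= eps).
      { intros [x |]; simpl; auto. rewrite Rminus_0_r, Rabs_R0; lra. }
      assert (H1 := Hle (fst p)). assert (H2 := Hle (snd p)). rewrite E in H1.
      revert H1 H2; abs_lra. }
    destruct (defect_tends0 (d ^ 2 / (C + 1))) as [n1 Hn1].
    { apply Rdiv_lt_0_compat; lra. }
    exists n1; intros n Hn p Hp. specialize (Hn1 n Hn). specialize (Hdef (h n) (h_C0 n)).
    apply abs_le_of_sq; [lra |].
    assert (H1 := cell_osc_sq_ge A B' p (h n) (h_C0 n)). unfold cell_diff in H1.
    destruct excluded_middle_informative as [_ | Hn']; [| contradiction].
    assert (H2 := qsn_le_mid_defect T (C0 T le) C0_plus
       (fun c g Hg => C0_scal c g Hg) _ f (h n) (cell_osc_sq_qsn A B') f_C0 (h_C0 n)).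
    assert (H3 : C * mid_defect (fun g => N g ^ 2) f (h n) <= C * (d ^ 2 / (C + 1))).
    { apply Rmult_le_compat_l; auto. eapply Rle_trans; [apply Rle_abs | auto]. }
    assert (H4 : C * (d ^ 2 / (C + 1)) <= d ^ 2).
    { apply Rle_trans with ((C + 1) * (d ^ 2 / (C + 1))).
      - apply Rmult_le_compat_r; [| lra]. left; apply Rdiv_lt_0_compat; lra.
      - right; field; lra. }
    assert (H5 : (2 * eps) ^ 2 <= (d / 2) ^ 2) by (apply pow_incr; lra).
    nra. }
  assert (Hcones : forall B0, incl B0 B -> exists n2, forall n, (n2 <= n)%nat ->
            forall i x, In i B0 -> le (loc i) x -> Rabs (h n x) <= 2 * d).
  { induction B0 as [| i B0 IH]; intros Hin.
    - exists 0%nat; intros n _ i x [].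
    - destruct IH as [n2 Hn2]; [intros j Hj; apply Hin; right; auto |].
      destruct (HB i) as (Hji & b & Hab & Hb); [apply Hin; left; auto |].
      set (a := loc i) in *.
      destruct (cone_small a b (stepf l a) eps d) as [n3 Hn3]; auto.
      + assert (Hc : Rabs (stepf l a) <= M).
        { assert (H1 := Hl a). assert (H2 := HfM a).
          revert H1 H2; abs_lra. }
        assert (H0 := Rabs_pos (stepf l a)). nra.
      + intros x Hax Hxb. rewrite <- (stepf_eq l x a); auto.
        intros p Hp. split; intros H; [now apply tle_trans with x |].
        rewrite (Hb (snd p)); auto. now apply in_map.
      + intros x Hax Hxb. assert (H := Hl x). rewrite stepf_zero, Rminus_0_r in H; auto.
        intros p Hp Hxp. apply Hxb. rewrite <- (Hb (snd p)); auto.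
        * now apply in_map.
        * now apply tle_trans with x.
      + exists (n2 + n3)%nat. intros n Hn j x [<- | Hj] Hx.
        * apply Hn3; auto; lia.
        * apply (Hn2 n ltac:(lia) j x); auto. }
  destruct Hcells as [n1 Hn1]. destruct (Hcones B (incl_refl B)) as [n2 Hn2].
  exists A, B', (n1 + n2)%nat. intros n Hn. split.
  - intros i x Hi. apply (Hn2 n ltac:(lia)). now apply HB'.
  - apply (Hn1 n ltac:(lia)).
Qed.

Lemma outside_or_cone B x : outside B (Some x) \/ exists i, In i B /\ lt (loc i) x.
Proof.
  destruct (classic (exists i, In i B /\ lt (loc i) x)) as [H | H]; auto.
  left. intros a Ha Hax. apply in_map_iff in Ha as (i & <- & Hi). apply H; now exists i.
Qed.

Lemma pointwise_tends0 x : tends0 (fun n => h n x).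
Proof.
  apply (all_nul h (fun _ => True)); auto.
  - intros y _ Hy. now apply jump_tends0.
  - intros t _ Ht. now apply phi_tends0.
  - intros z Hz eps Heps.
    (* Strictly inside a cone of [B] both values are small. Elsewhere a left interval at [z] avoids
       the finitely many recoverable points and stays in the cell of [z]. *)
    destruct (eventually_controlled (eps / 4)) as (A & B & n0 & Hn0); [lra |].
    destruct (outside_or_cone B z) as [Hout | (i & Hi & Hiz)].
    + destruct (accessible_finite (map loc A)) as [l Hl].
      destruct (limit_not_le_list z l Hz) as (y0 & Hy0 & H0).
      exists y0; split; auto. intros y Hy Hyz. exists n0; intros n Hn.
      destruct (Hn0 n Hn) as [_ H]. apply Rle_trans with (eps / 4); [| lra].
      apply (H (Some z, Some y)). split; [| split]; auto.
      * intros e He. simpl. split; intros Hle; [now apply tle_trans with z |].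
        apply NNPP; intros Hze. apply (H0 y e); auto.
      * intros a Ha Hay. apply (Hout a Ha). now apply lt_le_trans with y.
    + exists (loc i); split; auto. intros y Hy Hyz. exists n0; intros n Hn.
      destruct (Hn0 n Hn) as [H _].
      assert (H1 := H i z Hi (lt_le _ _ Hiz)). assert (H2 := H i y Hi Hy).
      revert H1 H2; abs_lra.
  - intros eps Heps.
    destruct (eventually_controlled (eps / 2)) as (A & B & n0 & Hn0); [lra |].
    destruct (accessible_finite (map loc A)) as [l Hl]. exists l. intros z.
    destruct (classic (exists e, In e l /\ le z e)) as [He | He]; auto.
    left; exists n0; intros n Hn. destruct (Hn0 n Hn) as [H1 H2].
    destruct (outside_or_cone B z) as [Hout | (i & Hi & Hiz)].
    + assert (H := H2 (Some z, None)). simpl in H. rewrite Rminus_0_r in H.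
      apply Rle_trans with (eps / 2); [| lra]. apply H. split; [| split]; simpl; auto.
      intros e Hacc; simpl. split; [| easy]. intros Hze. apply He; exists e; auto.
    + replace eps with (2 * (eps / 2)) by field. apply (H1 i); auto using lt_le.
Qed.

Lemma cell_representatives (l : list T) (P : option T -> Prop) :
  exists L, forall o, P o -> exists r, In r L /\ P r /\ forall e, In e l -> (ole o e <-> ole r e).
Proof.
  revert P; induction l as [| e l IH]; intros P.
  - destruct (classic (exists o, P o)) as [[r Hr] | Hn].
    + exists [r]; intros o Ho. exists r; simpl; repeat split; auto; contradiction.
    + exists []; intros o Ho; exfalso; apply Hn; now exists o.
  - destruct (IH (fun o => P o /\ ole o e)) as [L1 H1].
    destruct (IH (fun o => P o /\ ~ ole o e)) as [L2 H2].
    exists (L1 ++ L2). intros o Ho. destruct (classic (ole o e)) as [He | He].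
    + destruct (H1 o (conj Ho He)) as (r & A & [B B'] & C).
      exists r; split; [apply in_or_app; auto | split; auto].
      intros e' [<- | He']; [tauto | auto].
    + destruct (H2 o (conj Ho He)) as (r & A & [B B'] & C).
      exists r; split; [apply in_or_app; auto | split; auto].
      intros e' [<- | He']; [tauto | auto].
Qed.

(** Pointwise convergence is uniform on one representative for each of the finitely many cells;
    control inside the cells and on the cones extends it to the tree. *)
Lemma uniform_tends0 : tends0 (fun n => supn (h n)).
Proof.
  intros eps Heps.
  destruct (eventually_controlled (eps / 2)) as (A & B & n0 & Hn0); [lra |].
  destruct (accessible_finite (map loc A)) as [l Hl].
  destruct (cell_representatives l (outside B)) as [L HL].
  assert (Hrep : exists n1, forall n, (n1 <= n)%nat -> forall r, In r L ->
            Rabs (fext (h n) r) <= eps / 2).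
  { clear HL. induction L as [| r L [n1 Hn1]].
    - exists 0%nat; intros n _ r [].
    - assert (Hr : tends0 (fun n => fext (h n) r)).
      { destruct r as [x |]; simpl; [apply pointwise_tends0 | now apply tends0_const]. }
      destruct (Hr (eps / 2)) as [n2 Hn2]; [lra |].
      exists (n1 + n2)%nat; intros n Hn r' [<- | Hr']; [apply Hn2; lia | apply Hn1; auto; lia]. }
  destruct Hrep as [n1 Hn1]. exists (n0 + n1)%nat. intros n Hn.
  rewrite Rabs_pos_eq by apply supn_nonneg. apply supn_lub; [lra |]. intros x.
  destruct (Hn0 n ltac:(lia)) as [H1 H2].
  destruct (outside_or_cone B x) as [Hout | (i & Hi & Hix)].
  - destruct (HL (Some x) Hout) as (r & Hr & Hor & Hcell).
    assert (H3 := Hn1 n ltac:(lia) r Hr).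
    assert (H4 : Rabs (fext (h n) (Some x) - fext (h n) r) <= eps / 2).
    { apply (H2 (Some x, r)). split; [| split]; auto. intros e He; apply Hcell; auto. }
    simpl in H4. revert H3 H4; abs_lra.
  - replace eps with (2 * (eps / 2)) by field. apply (H1 i); auto using lt_le.
Qed.
End Limit.

Lemma MLUR_of_rho : exists N, equiv_norm_on (C0 T le) N /\ MLUR_on (C0 T le) N.
Proof.
  destruct (renorming T (C0 T le) C0_plus (fun c g Hg => C0_scal c g Hg)
    (fun g x Hg => C0_le_supn g x Hg) index feature cell_osc_sq 4 ltac:(lra)
    feature_qsn feature_qbd feature_c0 cell_osc_sq_qsn cell_osc_sq_qbd)
    as (N & HN & Hfeat & Hcell).
  exists N; split; auto. intros f h Hf Hh Hp Hm.
  apply tends0_Un_cv in Hp. apply tends0_Un_cv in Hm.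
  assert (Hd : tends0 (fun n => mid_defect (fun g => N g ^ 2) f (h n))).
  (* With [p] and [m] the differences of [N (f + h)] and [N (f - h)] from [N f], the defect of
     [N ^ 2] is [p ^ 2 + m ^ 2 + 2 * N f * (p + m)]. *)
  { assert (Hq := tends0_lin 1 1 _ _ (tends0_sq _ Hp) (tends0_sq _ Hm)).
    assert (Hl := tends0_lin (2 * N f) (2 * N f) _ _ Hp Hm).
    eapply tends0_ext; [| apply (tends0_lin 1 1 _ _ Hq Hl)].
    intros n; unfold mid_defect; simpl; ring. }
  assert (Hu := uniform_tends0 N Hfeat Hcell f h Hf Hh Hd).
  destruct HN as [(Hpos & _) (a & b & Ha & Hb & Hab)].
  apply tends0_Un_cv. intros eps Heps.
  destruct (Hu (eps / b)) as [n0 Hn0]; [now apply Rdiv_lt_0_compat |].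
  exists n0; intros n Hn. specialize (Hn0 n Hn).
  rewrite Rabs_pos_eq in Hn0 by apply supn_nonneg.
  rewrite Rminus_0_r, Rabs_pos_eq by auto.
  eapply Rle_trans; [apply (Hab (h n) (Hh n)) |].
  replace eps with (b * (eps / b)) by (field; lra). apply Rmult_le_compat_l; lra.
Qed.
End Midpoint.
End Rho.
End Tree.

Theorem theorem5p1 (T : Type) (le : T -> T -> Prop)
  (Htree : is_tree T le) (Hhaus : hausdorff_tree T le) :
  let V := C0 T le in
  ((exists N, equiv_norm_on V N /\ strictly_convex_on V N) <->
   (exists N, equiv_norm_on V N /\ MLUR_on V N)) /\
  ((exists N, equiv_norm_on V N /\ MLUR_on V N) <->
   (exists rho : T -> R, tree_increasing T le rho /\
      (forall G : T -> Prop, ever_branching T le G ->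
         ~ (exists c, forall t, G t -> rho t = c)) /\
      (forall s u1 u2,
         tree_bad T le rho u1 -> le s u1 -> rho u1 = rho s ->
         tree_bad T le rho u2 -> le s u2 -> rho u2 = rho s -> u1 = u2))) /\
  ((exists N, equiv_norm_on V N /\ MLUR_on V N) <->
   (exists (I : Type) (S : (T -> R) -> (I -> R)),
      bounded_linear_injection V (@c0 I) S)).
Proof.
  intros V.
  assert (H21 : (exists N, equiv_norm_on V N /\ MLUR_on V N) ->
                exists N, equiv_norm_on V N /\ strictly_convex_on V N).
  { intros (N & HN & Hm). exists N; split; auto.
    now apply (strictly_convex_of_MLUR T le Htree Hhaus). }
  assert (H13 : forall N, equiv_norm_on V N -> strictly_convex_on V N ->
    tree_increasing T le (peak_norm T le N) /\
    (forall G : T -> Prop, ever_branching T le G ->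
       ~ (exists c, forall t, G t -> peak_norm T le N t = c)) /\
    (forall s u1 u2, tree_bad T le (peak_norm T le N) u1 -> le s u1 ->
       peak_norm T le N u1 = peak_norm T le N s ->
       tree_bad T le (peak_norm T le N) u2 -> le s u2 ->
       peak_norm T le N u2 = peak_norm T le N s -> u1 = u2)).
  { intros N [HN (a & b & Ha & Hb & Hab)] Hsc. split; [| split].
    - exact (peak_norm_increasing T le Htree Hhaus N HN).
    - exact (peak_norm_not_constant T le Htree Hhaus N HN a b Ha Hb Hab Hsc).
    - exact (peak_norm_bad_unique T le Htree Hhaus N HN a b Ha Hb Hab Hsc). }
  assert (H12 : (exists N, equiv_norm_on V N /\ strictly_convex_on V N) ->
                exists N, equiv_norm_on V N /\ MLUR_on V N).
  { intros (N & HN & Hsc). destruct (H13 N HN Hsc) as (H1 & H2 & H3).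
    exact (MLUR_of_rho T le Htree Hhaus _ H1 H2 H3). }
  split; [| split]; split; auto.
  - intros (N & HN & Hsc)%H21. exists (peak_norm T le N). now apply H13.
  - intros (rho & H1 & H2 & H3). exact (MLUR_of_rho T le Htree Hhaus rho H1 H2 H3).
  - intros (N & HN & Hsc)%H21. destruct (H13 N HN Hsc) as (H1 & H2 & H3).
    exists (T + T)%type, (fun f i => coord T le (peak_norm T le N) i f).
    exact (coord_injection T le Htree Hhaus _ H1 H2 H3).
  - intros (I & S & HS). apply H12.
    now apply (strictly_convex_of_injection T le Htree Hhaus I S).
Qed.
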